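(* Consider the system and notation described in the context, and suppose $0<a_1<\sqrt{4d_1r}$ and $L>L_1^*$. (i) If $L-x_2\ge L^*$ (large protection zone), $m\le p^{-1}e^{-|\frac{a_1}{d_1}-\frac{a_2}{d_2}|x_2}$ and $\bar w^2(x_2)\le h$, then the system possesses a unique coexistence steady state $(u,w)$, which is globally asymptotically stable. (ii) If $L-x_2<L^*$ (small protection zone), $m<\min\{\bar m,\,p^{-1}e^{-|\frac{a_1}{d_1}-\frac{a_2}{d_2}|x_2}\}$ and $\bar w^2(x_2)\le h$, then the system possesses a unique coexistence steady state $(u,w)$, which is globally asymptotically stable.
   Context: Let $d_1,d_2,r,m,p,q,h,L>0$, $a_1>0$, $a_2\ge0$ and $0<x_2\le L$. Let $\chi_{[0,x_2)}(x)=1$ for $0\le x<x_2$ and $0$ for $x_2\le x\le L$. Consider the system $u_t=d_1u_{xx}-a_1u_x+u(r-u-m\chi_{[0,x_2)}w)$, $x\in(0,L)$; $w_t=d_2w_{xx}-a_2w_x+h-qw-puw$, $x\in(0,x_2)$; $d_1u_x(0,t)-a_1u(0,t)=u_x(L,t)=0$; $d_2w_x(0,t)-a_2w(0,t)=d_2w_x(x_2,t)-a_2w(x_2,t)=0$; nonnegative, not identically zero initial data. A coexistence steady state is a time-independent solution $(u,w)$ with $u>0$ on $[0,L]$, $w>0$ on $[0,x_2]$; globally asymptotically stable means all solutions with nonnegative nontrivial initial data converge to it uniformly as $t\to\infty$. Let $\bar w$ be the unique positive solution of $d_2w''-a_2w'+h-qw=0$ on $(0,x_2)$, $d_2w'(0)-a_2w(0)=d_2w'(x_2)-a_2w(x_2)=0$.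 For $0\le y_1<y_2\le L$, $d>0$, $a\ge0$, bounded $s$, $\lambda_1(d,a,s,(y_1,y_2))$ is the principal eigenvalue of $d\varphi''-a\varphi'+s\varphi=\lambda\varphi$ on $(y_1,y_2)$, $d\varphi'(y_1)-a\varphi(y_1)=\varphi'(y_2)=0$. When $L-x_2<L^*$, $\bar m>0$ denotes the critical value of $m$ at which $\lambda_1(d_1,a_1,r-m\chi_{[0,x_2)}\bar w,(0,L))=0$ (this eigenvalue is strictly decreasing in $m$). For $0<a_1<\sqrt{4d_1r}$: $L^*=2d_1\big(\pi-\arctan\frac{\sqrt{4d_1r-a_1^2}}{a_1}\big)/\sqrt{4d_1r-a_1^2}$; $L_1^*=2d_1\arctan\big(\frac{a_1\sqrt{4d_1r-a_1^2}}{2d_1r-a_1^2}\big)/\sqrt{4d_1r-a_1^2}$ if $a_1\le\sqrt{2d_1r}$ and $L_1^*=2d_1\big(\pi+\arctan\frac{a_1\sqrt{4d_1r-a_1^2}}{2d_1r-a_1^2}\big)/\sqrt{4d_1r-a_1^2}$ if $\sqrt{2d_1r}<a_1<\sqrt{4d_1r}$. *)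

(* Defs.v *)
From Stdlib Require Import Reals Lra.
From Coquelicot Require Import Coquelicot.
Open Scope R_scope.

(** Indicator of [0,x2) (used only for 0 <= x <= L). *)
Definition chi (x2 x : R) : R := if Rlt_dec x x2 then 1 else 0.

Definition cont_on (D : R -> Prop) (f : R -> R) : Prop :=
  forall x, D x -> forall eps, 0 < eps -> exists delta, 0 < delta /\
    forall y, D y -> Rabs (y - x) < delta -> Rabs (f y - f x) < eps.

Definition cont2_on (D : R -> R -> Prop) (f : R -> R -> R) : Prop :=
  forall x t, D x t -> forall eps, 0 < eps -> exists delta, 0 < delta /\
    forall y s, D y s -> Rabs (y - x) < delta -> Rabs (s - t) < delta ->
      Rabs (f y s - f x t) < eps.

(** (Strong/classical) global solution of the parabolic system on t >= 0.
    u is defined on [0,L] x [0,oo), w on [0,x2] x [0,oo).  u, u_x, u_t are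
    continuous (u_x, u_t for t > 0, up to the boundary); u_xx exists and the
    u-equation holds at every interior point x <> x2 (at x = x2 the
    coefficient chi is discontinuous, so u is only C^1 in x there);
    w is classical on [0,x2]. Boundary values of u_x, w_x are the continuous
    extensions of the interior derivatives. *)
Definition is_solution (d1 d2 r m p q h L a1 a2 x2 : R)
  (u w : R -> R -> R) : Prop :=
  exists ux ut wx wt : R -> R -> R,
    cont2_on (fun x t => 0 <= x <= L /\ 0 <= t) u /\
    cont2_on (fun x t => 0 <= x <= x2 /\ 0 <= t) w /\
    cont2_on (fun x t => 0 <= x <= L /\ 0 < t) ux /\
    cont2_on (fun x t => 0 <= x <= L /\ 0 < t) ut /\
    cont2_on (fun x t => 0 <= x <= x2 /\ 0 < t) wx /\
    cont2_on (fun x t => 0 <= x <= x2 /\ 0 < t) wt /\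
    (forall x t, 0 < x < L -> 0 < t ->
       is_derive (fun y => u y t) x (ux x t) /\
       is_derive (fun s => u x s) t (ut x t)) /\
    (forall x t, 0 < x < L -> x <> x2 -> 0 < t ->
       exists uxx, is_derive (fun y => ux y t) x uxx /\
         ut x t = d1 * uxx - a1 * ux x t
                  + u x t * (r - u x t - m * chi x2 x * w x t)) /\
    (forall x t, 0 < x < x2 -> 0 < t ->
       is_derive (fun y => w y t) x (wx x t) /\
       is_derive (fun s => w x s) t (wt x t) /\
       exists wxx, is_derive (fun y => wx y t) x wxx /\
         wt x t = d2 * wxx - a2 * wx x t + h - q * w x t - p * u x t * w x t) /\
    (forall t, 0 < t ->
       d1 * ux 0 t - a1 * u 0 t = 0 /\ ux L t = 0 /\
       d2 * wx 0 t - a2 * w 0 t = 0 /\ d2 * wx x2 t - a2 * w x2 t = 0).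

Definition is_steady_state (d1 d2 r m p q h L a1 a2 x2 : R)
  (U W : R -> R) : Prop :=
  is_solution d1 d2 r m p q h L a1 a2 x2 (fun x _ => U x) (fun x _ => W x).

Definition is_coexistence_steady_state (d1 d2 r m p q h L a1 a2 x2 : R)
  (U W : R -> R) : Prop :=
  is_steady_state d1 d2 r m p q h L a1 a2 x2 U W /\
  (forall x, 0 <= x <= L -> 0 < U x) /\
  (forall x, 0 <= x <= x2 -> 0 < W x).

Definition admissible_initial (L x2 : R) (u w : R -> R -> R) : Prop :=
  (forall x, 0 <= x <= L -> 0 <= u x 0) /\ (exists x, 0 <= x <= L /\ u x 0 <> 0) /\
  (forall x, 0 <= x <= x2 -> 0 <= w x 0) /\ (exists x, 0 <= x <= x2 /\ w x 0 <> 0).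

Definition unif_conv (a b : R) (u : R -> R -> R) (U : R -> R) : Prop :=
  forall eps, 0 < eps -> exists T, forall t, T <= t ->
    forall x, a <= x <= b -> Rabs (u x t - U x) < eps.

Definition unique_GAS_coexistence (d1 d2 r m p q h L a1 a2 x2 : R) : Prop :=
  exists U W,
    is_coexistence_steady_state d1 d2 r m p q h L a1 a2 x2 U W /\
    (forall U' W', is_coexistence_steady_state d1 d2 r m p q h L a1 a2 x2 U' W' ->
       (forall x, 0 <= x <= L -> U' x = U x) /\
       (forall x, 0 <= x <= x2 -> W' x = W x)) /\
    (forall u w, is_solution d1 d2 r m p q h L a1 a2 x2 u w ->
       admissible_initial L x2 u w ->
       unif_conv 0 L u U /\ unif_conv 0 x2 w W).

Definition is_wbar (d2 q h a2 x2 : R) (W : R -> R) : Prop :=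
  exists Wx : R -> R,
    cont_on (fun x => 0 <= x <= x2) W /\ cont_on (fun x => 0 <= x <= x2) Wx /\
    (forall x, 0 < x < x2 -> is_derive W x (Wx x) /\
       exists Wxx, is_derive Wx x Wxx /\ d2 * Wxx - a2 * Wx x + h - q * W x = 0) /\
    d2 * Wx 0 - a2 * W 0 = 0 /\ d2 * Wx x2 - a2 * W x2 = 0 /\
    (forall x, 0 <= x <= x2 -> 0 < W x).

(** lam is the principal eigenvalue lambda_1(d,a,s,(y1,y2)) of
    d phi'' - a phi' + s phi = lam phi, d phi'(y1) - a phi(y1) = phi'(y2) = 0,
    i.e. the eigenvalue possessing a positive eigenfunction.  s is bounded,
    possibly discontinuous; the equation is required at interior points where
    s is continuous (phi is C^1 everywhere). *)
Definition principal_eigenvalue (d a : R) (s : R -> R) (y1 y2 lam : R) : Prop :=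
  exists phi phix : R -> R,
    cont_on (fun x => y1 <= x <= y2) phi /\ cont_on (fun x => y1 <= x <= y2) phix /\
    (forall x, y1 <= x <= y2 -> 0 < phi x) /\
    (forall x, y1 < x < y2 -> is_derive phi x (phix x)) /\
    (forall x, y1 < x < y2 -> continuity_pt s x ->
       exists phixx, is_derive phix x phixx /\
         d * phixx - a * phix x + s x * phi x = lam * phi x) /\
    d * phix y1 - a * phi y1 = 0 /\ phix y2 = 0.

Definition Lstar (d1 r a1 : R) : R :=
  2 * d1 * (PI - atan (sqrt (4 * d1 * r - a1 ^ 2) / a1)) / sqrt (4 * d1 * r - a1 ^ 2).

(** At a1 = sqrt(2 d1 r) the arctan argument is +oo; we use its limit PI/2
    (both branches of the formula tend to it). *)
Definition L1star (d1 r a1 : R) : R :=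
  let s := sqrt (4 * d1 * r - a1 ^ 2) in
  let theta :=
    match Rlt_dec (a1 ^ 2) (2 * d1 * r) with
    | left _ => atan (a1 * s / (2 * d1 * r - a1 ^ 2))
    | right _ =>
      match Req_EM_T (a1 ^ 2) (2 * d1 * r) with
      | left _ => PI / 2
      | right _ => PI + atan (a1 * s / (2 * d1 * r - a1 ^ 2))
      end
    end in
  2 * d1 * theta / s.

(* Main.v *)
Require Import Defs.
From Stdlib Require Import Reals Lra Lia Psatz Classical ClassicalEpsilon.
From Coquelicot Require Import Coquelicot.
Open Scope R_scope.

(** The system is competitive: with [w = exp (a2 x / d2) om] both components solve
    drift-diffusion equations with Robin or Neumann conditions, and increasing [u]
    lowers [om] and conversely.  For [K] large, solving the linear problems
    [d y'' + b y' - K y + f = 0] with [f = K u + reaction] defines a map that is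
    monotone in the competitive order.  Iterating it from the pair ([r], [0]) and
    from ([c psi], [wbar]), where [psi] is a strict positive subsolution of the
    [u]-equation linearised at [u = 0], [w = wbar], gives two ordered coexistence
    states, and the minimum principle shows by induction that every solution is
    eventually squeezed between the iterates.

    Two ordered states [U2 <= U1], [W1 <= W2] coincide: with [ph = U1 - U2] and
    [ze = W2 - W1], testing the identity for [U2 L U1 - U1 L U2] with
    [ph^2 / (U1 U2)], its analogue for [W], and adding, yields the integrand
    [ph^3 - m ph^2 ze + s^3 (h ze^3 / (W1 W2) - p ph ze^2)], which dominates
    [(ph - s ze)^2 (ph + s ze)] when [m <= s <= 1 / p] and [W1 W2 <= h].

    The protection zone enters only through [psi]: for a large zone it is an
    exponential glued to a modulated sine, for a small one a perturbation of the
    eigenfunction at [mbar].  Uniqueness follows from global stability. *)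

(** * Continuity and mean values on intervals *)

Ltac minmax :=
  unfold Rmin, Rmax in *;
  repeat match goal with
  | |- context [Rle_dec ?u ?v] => destruct (Rle_dec u v)
  | H : context [Rle_dec ?u ?v] |- _ => destruct (Rle_dec u v)
  end; lra.

Definition clamp (a b x : R) : R := Rmax a (Rmin b x).

Lemma clamp_in (a b x : R) : a <= b -> a <= clamp a b x <= b.
Proof.
  intros Hab; unfold clamp. minmax.
Qed.

Lemma clamp_id (a b x : R) : a <= x <= b -> clamp a b x = x.
Proof.
  intros Hx; unfold clamp. minmax.
Qed.

Lemma clamp_dist (a b x y : R) : Rabs (clamp a b x - clamp a b y) <= Rabs (x - y).
Proof.
  unfold clamp, Rmax, Rmin, Rabs.
  destruct (Rle_dec b x); destruct (Rle_dec b y);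
  repeat match goal with
  | |- context [Rle_dec ?u ?v] => destruct (Rle_dec u v)
  | |- context [Rcase_abs ?u] => destruct (Rcase_abs u)
  end; lra.
Qed.

Lemma cont_on_clamp (a b : R) (f : R -> R) :
  a <= b -> cont_on (fun x => a <= x <= b) f ->
  forall x, continuity_pt (fun y => f (clamp a b y)) x.
Proof.
  intros Hab Hf x eps Heps.
  destruct (Hf _ (clamp_in a b x Hab) eps Heps) as [del [Hdel H]].
  exists del; split; [exact Hdel|]. intros y [_ Hy]; simpl in *; unfold Rdist in *.
  apply H; [apply clamp_in; lra|].
  eapply Rle_lt_trans; [apply clamp_dist|exact Hy].
Qed.

Lemma cont_on_subset (D E : R -> Prop) (f : R -> R) :
  (forall x, D x -> E x) -> cont_on E f -> cont_on D f.
Proof.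
  intros HDE Hf x Hx eps Heps.
  destruct (Hf x (HDE x Hx) eps Heps) as [del [Hdel H]].
  exists del; split; auto.
Qed.

Lemma cont2_on_subset (D E : R -> R -> Prop) (f : R -> R -> R) :
  (forall x t, D x t -> E x t) -> cont2_on E f -> cont2_on D f.
Proof.
  intros HDE Hf x t Hx eps Heps.
  destruct (Hf x t (HDE x t Hx) eps Heps) as [del [Hdel H]].
  exists del; split; auto.
Qed.

Ltac restrict H :=
  (eapply cont_on_subset || eapply cont2_on_subset); [|exact H]; cbv beta; intros; lra.

Lemma continuity_cont_on (D : R -> Prop) (f : R -> R) :
  (forall x, D x -> continuity_pt f x) -> cont_on D f.
Proof.
  intros Hf x Hx eps Heps. destruct (Hf x Hx eps Heps) as [del [Hdel H]].
  exists del; split; [exact Hdel|]. intros y _ Hy.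
  destruct (Req_dec x y) as [->|Hne].
  - rewrite Rminus_diag, Rabs_R0; lra.
  - apply (H y). split; [split; [exact I|exact Hne]|exact Hy].
Qed.

Lemma cont2_on_filterlim (D : R -> R -> Prop) (f : R -> R -> R) :
  cont2_on D f <->
  forall x t, D x t ->
    filterlim (fun p : R * R => f (fst p) (snd p))
      (within (fun p => D (fst p) (snd p)) (locally (x, t))) (locally (f x t)).
Proof.
  split.
  - intros Hf x t HD P [eps HP].
    destruct (Hf x t HD eps (cond_pos eps)) as [del [Hdel H]].
    exists (mkposreal del Hdel). intros [y s] [Hy Hs] HDy. apply HP.
    apply (H y s HDy Hy Hs).
  - intros Hf x t HD eps Heps.
    destruct (Hf x t HD (ball (f x t) eps)) as [del H].
    { exists (mkposreal eps Heps); intros y Hy; exact Hy. }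
    exists del; split; [apply cond_pos|]. intros y s HDy Hy Hs.
    apply (H (y, s)); [split; [exact Hy|exact Hs]|exact HDy].
Qed.

Lemma cont2_on_plus (D : R -> R -> Prop) (f g : R -> R -> R) :
  cont2_on D f -> cont2_on D g -> cont2_on D (fun x t => f x t + g x t).
Proof.
  rewrite !cont2_on_filterlim. intros Hf Hg x t HD.
  eapply filterlim_comp_2; [apply Hf, HD|apply Hg, HD|].
  apply (filterlim_plus (f x t) (g x t)).
Qed.

Lemma cont2_on_mult (D : R -> R -> Prop) (f g : R -> R -> R) :
  cont2_on D f -> cont2_on D g -> cont2_on D (fun x t => f x t * g x t).
Proof.
  rewrite !cont2_on_filterlim. intros Hf Hg x t HD.
  eapply filterlim_comp_2; [apply Hf, HD|apply Hg, HD|].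
  apply (filterlim_mult (f x t) (g x t)).
Qed.

Lemma cont2_on_fst (D : R -> R -> Prop) (E : R -> Prop) (f : R -> R) :
  (forall x t, D x t -> E x) -> cont_on E f -> cont2_on D (fun x _ => f x).
Proof.
  intros HDE Hf x t HD eps Heps.
  destruct (Hf x (HDE x t HD) eps Heps) as [del [Hdel H]].
  exists del; split; [exact Hdel|]. intros y s HDy Hy _. apply H; eauto.
Qed.

Lemma cont2_on_snd (D : R -> R -> Prop) (E : R -> Prop) (f : R -> R) :
  (forall x t, D x t -> E t) -> cont_on E f -> cont2_on D (fun _ t => f t).
Proof.
  intros HDE Hf x t HD eps Heps.
  destruct (Hf t (HDE x t HD) eps Heps) as [del [Hdel H]].
  exists del; split; [exact Hdel|]. intros y s HDy _ Hs. apply H; eauto.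
Qed.

Lemma cont2_on_const (D : R -> R -> Prop) (c : R) : cont2_on D (fun _ _ => c).
Proof.
  intros x t _ eps Heps. exists 1; split; [lra|]. intros.
  rewrite Rminus_diag, Rabs_R0; lra.
Qed.

Lemma cont2_on_ext (D : R -> R -> Prop) (f g : R -> R -> R) :
  (forall x t, D x t -> f x t = g x t) -> cont2_on D f -> cont2_on D g.
Proof.
  intros E Hf x t HD eps Heps.
  destruct (Hf x t HD eps Heps) as [del [Hdel H]].
  exists del; split; [exact Hdel|]. intros y s HDy Hy Hs.
  rewrite <- !E by assumption. auto.
Qed.

Lemma cont2_on_slice (D : R -> R -> Prop) (f : R -> R -> R) (t : R) :
  cont2_on D f -> cont_on (fun x => D x t) (fun x => f x t).
Proof.
  intros Hf x HD eps Heps.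
  destruct (Hf x t HD eps Heps) as [del [Hdel H]].
  exists del; split; [exact Hdel|]. intros y HDy Hy. apply H; auto.
  rewrite Rminus_diag, Rabs_R0; exact Hdel.
Qed.

Lemma cont_on_of_cont2 (D : R -> Prop) (f : R -> R) :
  cont2_on (fun x _ => D x) (fun x _ => f x) -> cont_on D f.
Proof. intros H. exact (cont2_on_slice _ _ 0 H). Qed.

Lemma cont_on_plus (D : R -> Prop) (f g : R -> R) :
  cont_on D f -> cont_on D g -> cont_on D (fun x => f x + g x).
Proof.
  intros Hf Hg. apply cont_on_of_cont2.
  apply cont2_on_plus; apply cont2_on_fst with (E := D); auto.
Qed.

Lemma cont_on_mult (D : R -> Prop) (f g : R -> R) :
  cont_on D f -> cont_on D g -> cont_on D (fun x => f x * g x).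
Proof.
  intros Hf Hg. apply cont_on_of_cont2.
  apply cont2_on_mult; apply cont2_on_fst with (E := D); auto.
Qed.

Lemma cont_on_const (D : R -> Prop) (c : R) : cont_on D (fun _ => c).
Proof. apply cont_on_of_cont2, cont2_on_const. Qed.

Lemma cont_on_ext (D : R -> Prop) (f g : R -> R) :
  (forall x, D x -> f x = g x) -> cont_on D f -> cont_on D g.
Proof.
  intros E Hf. apply cont_on_of_cont2, (cont2_on_ext _ (fun x _ => f x)); [auto|].
  apply cont2_on_fst with (E := D); auto.
Qed.

Lemma cont_on_comp (D : R -> Prop) (g f : R -> R) :
  cont_on D f -> (forall x, D x -> continuity_pt g (f x)) ->
  cont_on D (fun x => g (f x)).
Proof.
  intros Hf Hg x HD eps Heps.
  destruct (Hg x HD eps Heps) as [e1 [He1 H1]].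
  destruct (Hf x HD e1 He1) as [del [Hdel H]].
  exists del; split; [exact Hdel|]. intros y HDy Hy.
  destruct (Req_dec (f x) (f y)) as [E|Hne].
  - rewrite E, Rminus_diag, Rabs_R0; lra.
  - apply (H1 (f y)). split; [split; [exact I|exact Hne]|]. apply H; auto.
Qed.

Lemma is_derive_continuity_pt (f : R -> R) (x l : R) :
  is_derive f x l -> continuity_pt f x.
Proof.
  intros H. apply continuity_pt_filterlim, (ex_derive_continuous f x).
  exists l; exact H.
Qed.

Lemma is_derive_const_R (k x : R) : is_derive (fun _ => k) x 0.
Proof. apply (is_derive_const (K := R_AbsRing) (V := R_NormedModule)). Qed.

Lemma is_derive_cont_on (D : R -> Prop) (f df : R -> R) :
  (forall x, is_derive f x (df x)) -> cont_on D f.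
Proof.
  intros H. apply continuity_cont_on. intros x _.
  exact (is_derive_continuity_pt _ _ _ (H x)).
Qed.

Lemma locally_open_interval (a b x : R) :
  a < x < b -> locally x (fun y => a < y < b).
Proof.
  intros Hx.
  assert (Hd : 0 < Rmin (x - a) (b - x)) by minmax.
  exists (mkposreal _ Hd). intros y Hy. unfold ball in Hy; simpl in Hy.
  unfold AbsRing_ball, abs, minus, plus, opp in Hy; simpl in Hy.
  apply Rabs_lt_between in Hy. minmax.
Qed.

Lemma mean_value (f : R -> R) (a b : R) :
  a < b -> cont_on (fun x => a <= x <= b) f ->
  (forall x, a < x < b -> exists l : R, is_derive f x l) ->
  exists (c l : R), a < c < b /\ is_derive f c l /\ f b - f a = l * (b - a).
Proof.
  intros Hab Hc Hd.
  pose (F := fun x => f (clamp a b x)).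
  assert (HF : forall c, a < c < b -> derivable_pt F c).
  { intros c Hcab. apply ex_derive_Reals_0. destruct (Hd c Hcab) as [l Hl].
    exists l. apply (is_derive_ext_loc f); [|exact Hl].
    apply (filter_imp (fun y => a < y < b)); [|apply locally_open_interval, Hcab].
    intros y Hy. unfold F. rewrite clamp_id; lra. }
  destruct (MVT F id a b HF (fun c _ => derivable_pt_id c) Hab) as [c [P E]].
  - intros c _. apply cont_on_clamp; [lra|exact Hc].
  - intros c _. apply derivable_continuous_pt, derivable_pt_id.
  - destruct (Hd c P) as [l Hl]. exists c, l. split; [exact P|split; [exact Hl|]].
    assert (El : derive_pt F c (HF c P) = l).
    { rewrite Derive_Reals. apply is_derive_unique.
      apply (is_derive_ext_loc f); [|exact Hl].
      apply (filter_imp (fun y => a < y < b)); [|apply locally_open_interval, P].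
      intros y Hy. unfold F. rewrite clamp_id; lra. }
    rewrite El, (derive_pt_id c) in E. unfold F, id in E.
    rewrite !clamp_id in E by lra. lra.
Qed.

Lemma nondecreasing_of_derive (f : R -> R) (a b : R) :
  a <= b -> cont_on (fun x => a <= x <= b) f ->
  (forall x, a < x < b -> exists l : R, is_derive f x l /\ 0 <= l) -> f a <= f b.
Proof.
  intros [Hab| ->] Hc Hd; [|lra].
  destruct (mean_value f a b Hab Hc) as [c [l [Hcab [Hl E]]]].
  - intros x Hx. destruct (Hd x Hx) as [l [Hl _]]. exists l; exact Hl.
  - destruct (Hd c Hcab) as [l' [Hl' Hpos]].
    assert (l = l').
    { rewrite <- (is_derive_unique _ _ _ Hl). apply is_derive_unique, Hl'. }
    subst. nra.
Qed.

Lemma lipschitz_of_derive (f : R -> R) (a b M : R) :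
  a <= b -> cont_on (fun x => a <= x <= b) f ->
  (forall x, a < x < b -> exists l : R, is_derive f x l /\ Rabs l <= M) ->
  Rabs (f b - f a) <= M * (b - a).
Proof.
  intros [Hab| ->] Hc Hd.
  - destruct (mean_value f a b Hab Hc) as [c [l [Hcab [Hl E]]]].
    + intros x Hx. destruct (Hd x Hx) as [l [Hl _]]. exists l; exact Hl.
    + destruct (Hd c Hcab) as [l' [Hl' Hb]].
      assert (l = l').
      { rewrite <- (is_derive_unique _ _ _ Hl). apply is_derive_unique, Hl'. }
      subst. rewrite E, Rabs_mult, (Rabs_right (b - a)) by lra.
      apply Rmult_le_compat_r; lra.
  - rewrite !Rminus_diag, Rabs_R0. lra.
Qed.

Lemma is_derive_removable (f g : R -> R) (x0 a b : R) :
  a < x0 < b -> (forall x, a < x < b -> continuity_pt f x) ->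
  (forall x, a < x < b -> x <> x0 -> is_derive f x (g x)) ->
  continuity_pt g x0 -> is_derive f x0 (g x0).
Proof.
  intros Hx0 Hf Hd Hg. apply is_derive_Reals. intros eps Heps.
  destruct (Hg eps Heps) as [del [Hdel H]]. simpl in H. unfold Rdist in H.
  assert (Hd0 : 0 < Rmin del (Rmin (x0 - a) (b - x0))) by minmax.
  exists (mkposreal _ Hd0). simpl. intros k Hk Hkd.
  assert (Hkk : Rabs k < del /\ Rabs k < x0 - a /\ Rabs k < b - x0)
    by (clear - Hkd; minmax).
  destruct Hkk as [Hk1 [Hk2 Hk3]].
  apply Rabs_lt_between in Hk1, Hk2, Hk3.
  assert (Hmv : exists c, c <> x0 /\ Rabs (c - x0) < del /\ a < c < b /\
                  f (x0 + k) - f x0 = g c * k).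
  { destruct (Rdichotomy k 0 Hk) as [Hneg|Hpos].
    - destruct (mean_value f (x0 + k) x0) as [c [l [Hc [Hl E]]]]; [lra| | |].
      + apply continuity_cont_on. intros; apply Hf; lra.
      + intros x Hx. exists (g x). apply Hd; lra.
      + exists c. split; [lra|]. split; [apply Rabs_def1; lra|]. split; [lra|].
        assert (l = g c).
        { rewrite <- (is_derive_unique _ _ _ Hl). apply is_derive_unique, Hd; lra. }
        subst. lra.
    - destruct (mean_value f x0 (x0 + k)) as [c [l [Hc [Hl E]]]]; [lra| | |].
      + apply continuity_cont_on. intros; apply Hf; lra.
      + intros x Hx. exists (g x). apply Hd; lra.
      + exists c. split; [lra|]. split; [apply Rabs_def1; lra|]. split; [lra|].
        assert (l = g c).
        { rewrite <- (is_derive_unique _ _ _ Hl). apply is_derive_unique, Hd; lra. }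
        subst. lra. }
  destruct Hmv as [c [Hc [Hcd [Hcab E]]]].
  rewrite E. replace (g c * k / k) with (g c) by (field; exact Hk).
  apply H. split; [split; [exact I|auto]|exact Hcd].
Qed.

(** * Minimum principles *)

Lemma cont2_on_tube (A B S T : R) (z : R -> R -> R) (t : R) (eps : R) :
  cont2_on (fun x t => A <= x <= B /\ S <= t <= T) z ->
  S <= t <= T -> 0 < eps ->
  exists d, 0 < d /\ forall s, S <= s <= T -> Rabs (s - t) < d ->
    forall x, A <= x <= B -> Rabs (z x s - z x t) < eps.
Proof.
  intros Hz Ht Heps.
  assert (Hdel : forall x, exists del : posreal, A <= x <= B ->
     forall y s, (A <= y <= B /\ S <= s <= T) -> Rabs (y - x) < del ->
       Rabs (s - t) < del -> Rabs (z y s - z x t) < eps / 2).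
  { intros x. destruct (classic (A <= x <= B)) as [Hx|Hx].
    - destruct (Hz x t (conj Hx Ht) (eps / 2)) as [del [Hdel H]]; [lra|].
      exists (mkposreal del Hdel). intros _. exact H.
    - exists (mkposreal 1 Rlt_0_1). intros; contradiction. }
  pose (delta := fun x => proj1_sig (constructive_indefinite_description _ (Hdel x))).
  destruct (compactness_value_1d A B delta) as [d Hd].
  exists d; split; [apply cond_pos|]. intros s Hs Hst x Hx.
  specialize (Hd x Hx). apply NNPP in Hd. destruct Hd as [y [Hy [Hxy Hdy]]].
  pose proof (proj2_sig (constructive_indefinite_description _ (Hdel y)) Hy) as H.
  change (forall y0 s, (A <= y0 <= B /\ S <= s <= T) -> Rabs (y0 - y) < delta y ->
       Rabs (s - t) < delta y -> Rabs (z y0 s - z y t) < eps / 2) in H.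
  assert (H1 := H x s (conj Hx Hs) Hxy ltac:(lra)).
  assert (H2 := H x t (conj Hx Ht) Hxy
     ltac:(rewrite Rminus_diag, Rabs_R0; apply cond_pos)).
  apply Rabs_lt_between in H1, H2. apply Rabs_def1; lra.
Qed.

Lemma cont2_on_attains_min (A B S T : R) (z : R -> R -> R) :
  A <= B -> S <= T -> cont2_on (fun x t => A <= x <= B /\ S <= t <= T) z ->
  exists x0 t0, (A <= x0 <= B /\ S <= t0 <= T) /\
    forall x t, A <= x <= B -> S <= t <= T -> z x0 t0 <= z x t.
Proof.
  intros HAB HST Hz.
  assert (Hmin : forall t, exists x0, S <= t <= T ->
     A <= x0 <= B /\ forall x, A <= x <= B -> z x0 t <= z x t).
  { intros t. destruct (classic (S <= t <= T)) as [Ht|Ht]; [|exists 0; contradiction].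
    destruct (continuity_ab_min (fun x => z (clamp A B x) t) A B HAB) as [x0 [H1 H2]].
    - intros c _. apply (cont_on_clamp A B (fun x => z x t) HAB).
      apply (cont_on_subset _ (fun x => A <= x <= B /\ S <= t <= T)); [tauto|].
      exact (cont2_on_slice _ _ t Hz).
    - exists x0. intros _. split; [exact H2|]. intros x Hx. specialize (H1 x Hx).
      rewrite !clamp_id in H1 by lra. exact H1. }
  pose (xm := fun t => proj1_sig (constructive_indefinite_description _ (Hmin t))).
  assert (Hxm : forall t, S <= t <= T ->
     A <= xm t <= B /\ forall x, A <= x <= B -> z (xm t) t <= z x t).
  { intros t. exact (proj2_sig (constructive_indefinite_description _ (Hmin t))). }
  assert (Hg : cont_on (fun t => S <= t <= T) (fun t => z (xm t) t)).
  { intros t Ht eps Heps.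
    destruct (cont2_on_tube A B S T z t eps Hz Ht Heps) as [d [Hd H]].
    exists d; split; [exact Hd|]. intros s Hs Hst.
    destruct (Hxm t Ht) as [I1 M1], (Hxm s Hs) as [I2 M2].
    pose proof (H s Hs Hst _ I1) as E1. pose proof (H s Hs Hst _ I2) as E2.
    specialize (M1 _ I2). specialize (M2 _ I1).
    apply Rabs_lt_between in E1, E2. apply Rabs_def1; lra. }
  destruct (continuity_ab_min (fun t => z (xm (clamp S T t)) (clamp S T t)) S T HST)
    as [t0 [H1 H2]].
  - intros c _. exact (cont_on_clamp S T (fun t => z (xm t) t) HST Hg c).
  - exists (xm t0), t0. destruct (Hxm t0 H2) as [I1 M1].
    split; [split; assumption|]. intros x t Hx Ht.
    specialize (H1 t Ht). rewrite !clamp_id in H1 by lra.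
    destruct (Hxm t Ht) as [I2 M2]. specialize (M2 x Hx). lra.
Qed.

Lemma cont2_on_bounded (A B S T : R) (z : R -> R -> R) :
  A <= B -> S <= T -> cont2_on (fun x t => A <= x <= B /\ S <= t <= T) z ->
  exists M, 0 < M /\ forall x t, A <= x <= B -> S <= t <= T -> Rabs (z x t) <= M.
Proof.
  intros HAB HST Hz.
  assert (Hz' : cont2_on (fun x t => A <= x <= B /\ S <= t <= T)
                  (fun x t => -1 * z x t)).
  { apply cont2_on_mult; [apply cont2_on_const|exact Hz]. }
  destruct (cont2_on_attains_min A B S T z HAB HST Hz) as [x0 [t0 [_ H0]]].
  destruct (cont2_on_attains_min A B S T _ HAB HST Hz') as [x1 [t1 [_ H1]]].
  exists (Rabs (z x0 t0) + Rabs (z x1 t1) + 1).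
  split; [pose proof (Rabs_pos (z x0 t0)); pose proof (Rabs_pos (z x1 t1)); lra|].
  intros x t Hx Ht. specialize (H0 x t Hx Ht). specialize (H1 x t Hx Ht).
  unfold Rabs. repeat destruct (Rcase_abs _); lra.
Qed.

Lemma cont_on_attains_min (A B : R) (f : R -> R) :
  A <= B -> cont_on (fun x => A <= x <= B) f ->
  exists x0, A <= x0 <= B /\ forall x, A <= x <= B -> f x0 <= f x.
Proof.
  intros HAB Hf.
  destruct (cont2_on_attains_min A B 0 1 (fun x _ => f x) HAB Rle_0_1) as [x0 [t0 [H1 H2]]].
  - apply cont2_on_fst with (E := fun x => A <= x <= B); [tauto|exact Hf].
  - exists x0. split; [tauto|]. intros x Hx. apply (H2 x 0 Hx); lra.
Qed.

Lemma cont_on_bounded (A B : R) (f : R -> R) :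
  A <= B -> cont_on (fun x => A <= x <= B) f ->
  exists M, 0 < M /\ forall x, A <= x <= B -> Rabs (f x) <= M.
Proof.
  intros HAB Hf.
  destruct (cont2_on_bounded A B 0 1 (fun x _ => f x) HAB Rle_0_1) as [M [H1 H2]].
  - apply cont2_on_fst with (E := fun x => A <= x <= B); [tauto|exact Hf].
  - exists M. split; [tauto|]. intros x Hx. apply (H2 x 0 Hx); lra.
Qed.

Definition C1on (A B : R) (f fx : R -> R) : Prop :=
  cont_on (fun x => A <= x <= B) f /\ cont_on (fun x => A <= x <= B) fx /\
  forall x, A < x < B -> is_derive f x (fx x).

Lemma C1on_of_derive (A B : R) (f fx fxx : R -> R) :
  (forall x, is_derive f x (fx x)) -> (forall x, is_derive fx x (fxx x)) -> C1on A B f fx.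
Proof.
  intros H1 H2. split; [exact (is_derive_cont_on _ f fx H1)|].
  split; [exact (is_derive_cont_on _ fx fxx H2)|intros x _; apply H1].
Qed.

Lemma is_derive_eq (f : R -> R) (x l l' : R) :
  is_derive f x l -> is_derive f x l' -> l = l'.
Proof.
  intros H1 H2. rewrite <- (is_derive_unique _ _ _ H1).
  apply is_derive_unique, H2.
Qed.

Lemma C1on_mean_value (A B : R) (f fx : R -> R) (a b : R) :
  C1on A B f fx -> A <= a -> a < b -> b <= B ->
  exists c, a < c < b /\ f b - f a = fx c * (b - a).
Proof.
  intros [Hf [_ Hd]] Ha Hab Hb.
  destruct (mean_value f a b Hab) as [c [l [Hc [Hl E]]]].
  - restrict Hf.
  - intros x Hx. exists (fx x). apply Hd; lra.
  - exists c. split; [exact Hc|]. rewrite E. f_equal.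
    apply (is_derive_eq f c); [exact Hl|apply Hd; lra].
Qed.

(* One-sided mean values replace the second derivative test, which would need
   a second derivative at the minimum itself; there it may fail to exist. *)
Lemma second_derivative_near_min (A B c x0 : R) (f fx : R -> R) :
  A < B -> C1on A B f fx ->
  (forall x, A < x < B -> x <> c -> exists l : R, is_derive fx x l) ->
  A <= x0 <= B -> (forall x, A <= x <= B -> f x0 <= f x) ->
  (x0 = A -> fx A <= 0) -> (x0 = B -> 0 <= fx B) ->
  fx x0 = 0 /\
  forall del, 0 < del -> exists (x l : R), A < x < B /\ x <> c /\ Rabs (x - x0) < del /\
    is_derive fx x l /\ 0 <= l.
Proof.
  intros HAB HC Hd2 Hx0 Hmin HA HB.
  destruct (HC) as [Hf [Hfx Hd]].
  assert (Hleft : forall a, A <= a < x0 -> exists xi, a < xi < x0 /\ fx xi <= 0).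
  { intros a Ha.
    destruct (C1on_mean_value A B f fx a x0 HC) as [xi [H1 H2]]; try lra.
    exists xi. split; [exact H1|]. pose proof (Hmin a ltac:(lra)). nra. }
  assert (Hright : forall b, x0 < b <= B -> exists xi, x0 < xi < b /\ 0 <= fx xi).
  { intros b Hb.
    destruct (C1on_mean_value A B f fx x0 b HC) as [xi [H1 H2]]; try lra.
    exists xi. split; [exact H1|]. pose proof (Hmin b ltac:(lra)). nra. }
  assert (Hle : fx x0 <= 0).
  { destruct (Req_dec x0 A) as [->|Hne]; [apply HA; reflexivity|].
    apply Rnot_lt_le. intros Hpos.
    destruct (Hfx x0 Hx0 (fx x0) Hpos) as [del [Hdel H]].
    destruct (Hleft (Rmax A (x0 - del))) as [xi [H1 H2]]; [minmax|].
    assert (A <= Rmax A (x0 - del) /\ x0 - del <= Rmax A (x0 - del))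
      by (split; [apply Rmax_l|apply Rmax_r]).
    assert (Hxi := H xi ltac:(lra) ltac:(apply Rabs_def1; lra)).
    apply Rabs_lt_between in Hxi. lra. }
  assert (Hge : 0 <= fx x0).
  { destruct (Req_dec x0 B) as [->|Hne]; [apply HB; reflexivity|].
    apply Rnot_lt_le. intros Hneg.
    destruct (Hfx x0 Hx0 (- fx x0) ltac:(lra)) as [del [Hdel H]].
    destruct (Hright (Rmin B (x0 + del))) as [xi [H1 H2]]; [minmax|].
    assert (Rmin B (x0 + del) <= B /\ Rmin B (x0 + del) <= x0 + del)
      by (split; [apply Rmin_l|apply Rmin_r]).
    assert (Hxi := H xi ltac:(lra) ltac:(apply Rabs_def1; lra)).
    apply Rabs_lt_between in Hxi. lra. }
  split; [lra|]. intros del Hdel.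
  destruct (Rle_lt_or_eq_dec A x0 (proj1 Hx0)) as [HAx|<-].
  - pose (a := Rmax (Rmax A (x0 - del)) (if Rlt_dec c x0 then c else A)).
    assert (Ha : A <= a < x0 /\ x0 - del <= a /\ (c < x0 -> c <= a)).
    { unfold a. destruct (Rlt_dec c x0); minmax. }
    destruct (Hleft a ltac:(lra)) as [xi [H1 H2]].
    destruct (mean_value fx xi x0) as [e [l [He [Hl E]]]]; [lra| | |].
    + restrict Hfx.
    + intros x Hx. apply Hd2; lra.
    + exists e, l. refine (conj _ (conj _ (conj _ (conj Hl _)))); [lra|lra|apply Rabs_def1; lra|nra].
  - pose (b := Rmin (Rmin B (A + del)) (if Rlt_dec A c then c else B)).
    assert (Hb : A < b <= B /\ b <= A + del /\ (A < c -> b <= c)).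
    { unfold b. destruct (Rlt_dec A c); minmax. }
    destruct (Hright b ltac:(lra)) as [xi [H1 H2]].
    destruct (mean_value fx A xi) as [e [l [He [Hl E]]]]; [lra| | |].
    + restrict Hfx.
    + intros x Hx. apply Hd2; lra.
    + exists e, l. refine (conj _ (conj _ (conj _ (conj Hl _)))); [lra|lra|apply Rabs_def1; lra|nra].
Qed.

Lemma elliptic_minimum_principle (A B c d b K : R) (y yx : R -> R) :
  A < B -> 0 < d -> 0 < K -> C1on A B y yx ->
  (y A < 0 -> yx A <= 0) -> (y B < 0 -> 0 <= yx B) ->
  (forall x, A < x < B -> x <> c -> exists yxx : R, is_derive yx x yxx /\
     (y x < 0 -> d * yxx + b * yx x - K * y x <= 0)) ->
  forall x, A <= x <= B -> 0 <= y x.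
Proof.
  intros HAB Hd HK HC HA HB Heq.
  destruct HC as [Hy [Hyx Hder]].
  destruct (cont_on_attains_min A B y) as [x0 [Hx0 Hmin]]; [lra|exact Hy|].
  assert (H0 : 0 <= y x0);
    [|intros x Hx; specialize (Hmin x Hx); lra].
  apply Rnot_lt_le. intros Hneg.
  destruct (second_derivative_near_min A B c x0 y yx) as [Hz Hnear]; auto.
  - exact (conj Hy (conj Hyx Hder)).
  - intros x Hx Hxc. destruct (Heq x Hx Hxc) as [l [Hl _]]. exists l; exact Hl.
  - intros ->; auto.
  - intros ->; auto.
  - assert (Hc : cont_on (fun x => A <= x <= B) (fun x => b * yx x + - K * y x)).
    { apply cont_on_plus; apply cont_on_mult; auto using cont_on_const. }
    assert (Hpos : 0 < - K * y x0) by nra.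
    destruct (Hc x0 Hx0 (- K * y x0) Hpos) as [d1 [Hd1 H1]].
    destruct (Hy x0 Hx0 (- y x0) ltac:(lra)) as [d2 [Hd2 H2]].
    destruct (Hnear (Rmin d1 d2) ltac:(apply Rmin_glb_lt; lra))
      as [x [l [Hx [Hxc [Hxd [Hl Hl0]]]]]].
    pose proof (Rmin_l d1 d2); pose proof (Rmin_r d1 d2).
    assert (E1 := H1 x ltac:(lra) ltac:(lra)).
    assert (E2 := H2 x ltac:(lra) ltac:(lra)).
    apply Rabs_lt_between in E1, E2. rewrite Hz in E1.
    destruct (Heq x Hx Hxc) as [l' [Hl' Hineq]].
    rewrite (is_derive_eq _ _ _ _ Hl' Hl) in Hineq.
    specialize (Hineq ltac:(lra)). nra.
Qed.

Definition parabolic_field (A B S T : R) (z zx zt : R -> R -> R) : Prop :=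
  cont2_on (fun x t => A <= x <= B /\ S <= t <= T) z /\
  cont2_on (fun x t => A <= x <= B /\ S < t <= T) zx /\
  cont2_on (fun x t => A <= x <= B /\ S < t <= T) zt /\
  forall x t, A < x < B -> S < t <= T ->
    is_derive (fun y => z y t) x (zx x t) /\ is_derive (fun s => z x s) t (zt x t).

Lemma parabolic_field_slice (A B S T : R) (z zx zt : R -> R -> R) (t : R) :
  parabolic_field A B S T z zx zt -> S < t <= T ->
  C1on A B (fun x => z x t) (fun x => zx x t).
Proof.
  intros [Hz [Hzx [Hzt Hd]]] Ht. split; [|split].
  - apply (cont_on_subset _ (fun x => A <= x <= B /\ S <= t <= T)); [intros; lra|].
    exact (cont2_on_slice _ _ t Hz).
  - apply (cont_on_subset _ (fun x => A <= x <= B /\ S < t <= T)); [intros; lra|].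
    exact (cont2_on_slice _ _ t Hzx).
  - intros x Hx. exact (proj1 (Hd x t Hx Ht)).
Qed.

(* [zt] is a time derivative only at interior points; on the lateral boundary
   the inequality is reached by continuity. *)
Lemma time_derivative_at_min (A B S T : R) (z zx zt : R -> R -> R) (x0 t0 k : R) :
  A < B -> parabolic_field A B S T z zx zt ->
  A <= x0 <= B -> S < t0 <= T ->
  (forall t, S <= t <= t0 -> exp (k * t0) * z x0 t0 <= exp (k * t) * z x0 t) ->
  zt x0 t0 <= - k * z x0 t0.
Proof.
  intros HAB [Hz [Hzx [Hzt Hd]]] Hx0 Ht0 Hmin.
  apply Rnot_lt_le. intros Hgt.
  assert (Hck : cont_on (fun t => S <= t <= T) (fun t => exp (k * t))).
  { apply (is_derive_cont_on _ _ (fun t => k * exp (k * t))). intros t.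
    auto_derive; [exact I|ring]. }
  assert (Hcy : cont2_on (fun x t => A <= x <= B /\ S <= t <= T)
                 (fun x t => exp (k * t) * z x t)).
  { apply cont2_on_mult; [|exact Hz].
    apply (cont2_on_snd _ (fun t => S <= t <= T)); [tauto|exact Hck]. }
  assert (Hcd : cont2_on (fun x t => A <= x <= B /\ S < t <= T)
                 (fun x t => exp (k * t) * (zt x t + k * z x t))).
  { apply cont2_on_mult.
    - apply (cont2_on_snd _ (fun t => S <= t <= T)); [intros; lra|exact Hck].
    - apply cont2_on_plus; [exact Hzt|]. apply cont2_on_mult; [apply cont2_on_const|].
      restrict Hz. }
  pose (eta := exp (k * t0) * (zt x0 t0 + k * z x0 t0)).
  assert (Heta : 0 < eta) by (apply Rmult_lt_0_compat; [apply exp_pos|lra]).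
  destruct (Hcd x0 t0 (conj Hx0 Ht0) (eta / 2) ltac:(lra)) as [del [Hdel H]].
  pose (s := Rmax ((S + t0) / 2) (t0 - del / 2)).
  assert (Hs : S < s < t0 /\ t0 - del / 2 <= s).
  { unfold s. clear - Hdel Ht0. minmax. }
  pose (gap := eta / 2 * (t0 - s)).
  assert (Hgap : 0 < gap) by (unfold gap; nra).
  assert (Hint : forall x, A < x < B -> Rabs (x - x0) < del ->
     exp (k * s) * z x s + gap <= exp (k * t0) * z x t0).
  { intros x Hx Hxd.
    assert (HD : forall t, S < t <= T -> is_derive (fun t => exp (k * t) * z x t) t
                    (exp (k * t) * (zt x t + k * z x t))).
    { intros t Ht. destruct (Hd x t Hx Ht) as [_ Ht'].
      evar_last.
      - apply (is_derive_mult (fun t => exp (k * t)) (fun t => z x t) t).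
        + auto_derive; [exact I|reflexivity].
        + exact Ht'.
        + intros; apply Rmult_comm.
      - unfold plus, mult; simpl. ring. }
    destruct (mean_value (fun t => exp (k * t) * z x t) s t0) as [c [l [Hc [Hl E]]]];
      [lra| | |].
    - apply continuity_cont_on. intros t Ht.
      apply (is_derive_continuity_pt _ _ _ (HD t ltac:(lra))).
    - intros t Ht. eexists. apply HD; lra.
    - rewrite (is_derive_eq _ _ _ _ Hl (HD c ltac:(lra))) in E.
      assert (Hxc : A <= x <= B /\ S < c <= T) by lra.
      assert (Hcd0 : Rabs (c - t0) < del) by (apply Rabs_def1; lra).
      assert (E1 := H x c Hxc Hxd Hcd0).
      fold eta in E1. apply Rabs_lt_between in E1. cbv beta in E, E1.
      assert (eta / 2 * (t0 - s) <= exp (k * c) * (zt x c + k * z x c) * (t0 - s))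
        by (apply Rmult_le_compat_r; lra).
      unfold gap. lra. }
  assert (Hgap2 : 0 < gap / 2) by lra.
  assert (Hsd : A <= x0 <= B /\ S <= s <= T) by lra.
  assert (Ht0d : A <= x0 <= B /\ S <= t0 <= T) by lra.
  destruct (Hcy x0 s Hsd _ Hgap2) as [e1 [He1 H1]].
  destruct (Hcy x0 t0 Ht0d _ Hgap2) as [e2 [He2 H2]].
  assert (Hx : exists x, A < x < B /\ Rabs (x - x0) < del /\ Rabs (x - x0) < e1 /\
     Rabs (x - x0) < e2).
  { pose (e := Rmin del (Rmin e1 e2)).
    assert (He : 0 < e /\ e <= del /\ e <= e1 /\ e <= e2).
    { unfold e. clear - Hdel He1 He2. minmax. }
    clearbody e. destruct (Rlt_dec x0 B) as [HxB|HxB].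
    - assert (Hy : exists y, x0 < y < B /\ y < x0 + e).
      { exists (Rmin ((x0 + B) / 2) (x0 + e / 2)). clear - HxB He. minmax. }
      destruct Hy as [y Hy]. exists y. repeat split; try lra; apply Rabs_def1; lra.
    - assert (Hy : exists y, A < y < x0 /\ x0 - e < y).
      { exists (Rmax ((A + x0) / 2) (x0 - e / 2)). clear - HxB He HAB Hx0. minmax. }
      destruct Hy as [y Hy]. exists y. repeat split; try lra; apply Rabs_def1; lra. }
  destruct Hx as [x [Hx [X0 [X1 X2]]]].
  assert (Hxs : A <= x <= B /\ S <= s <= T) by lra.
  assert (Hxt : A <= x <= B /\ S <= t0 <= T) by lra.
  assert (Z1 : Rabs (s - s) < e1) by (rewrite Rminus_diag, Rabs_R0; lra).
  assert (Z2 : Rabs (t0 - t0) < e2) by (rewrite Rminus_diag, Rabs_R0; lra).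
  assert (E1 := H1 x s Hxs X1 Z1).
  assert (E2 := H2 x t0 Hxt X2 Z2).
  assert (Hst : S <= s <= t0) by lra.
  specialize (Hint x Hx X0). specialize (Hmin s Hst).
  apply Rabs_lt_between in E1, E2. lra.
Qed.

Lemma parabolic_minimum_principle (A B S T c d b C : R) (z zx zt : R -> R -> R) :
  A < B -> S <= T -> 0 < d -> parabolic_field A B S T z zx zt ->
  (forall x, A <= x <= B -> 0 <= z x S) ->
  (forall t, S < t <= T -> z A t < 0 -> zx A t <= 0) ->
  (forall t, S < t <= T -> z B t < 0 -> 0 <= zx B t) ->
  (forall x t, A < x < B -> x <> c -> S < t <= T ->
     exists zxx : R, is_derive (fun y => zx y t) x zxx /\
       (z x t < 0 -> d * zxx + b * zx x t + C * z x t <= zt x t)) ->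
  forall x t, A <= x <= B -> S <= t <= T -> 0 <= z x t.
Proof.
  intros HAB HST Hd HP Hini HA HB Heq.
  destruct (HP) as [Hz [Hzx [Hzt Hder]]].
  pose (k := - (C + 1)).
  assert (Hcy : cont2_on (fun x t => A <= x <= B /\ S <= t <= T)
                 (fun x t => exp (k * t) * z x t)).
  { apply cont2_on_mult; [|exact Hz].
    apply (cont2_on_snd _ (fun t => S <= t <= T)); [tauto|].
    apply (is_derive_cont_on _ _ (fun t => k * exp (k * t))). intros t.
    auto_derive; [exact I|ring]. }
  destruct (cont2_on_attains_min A B S T _ ltac:(lra) HST Hcy)
    as [x0 [t0 [[Hx0 Ht0] Hmin]]].
  assert (H0 : 0 <= z x0 t0).
  { apply Rnot_lt_le. intros Hneg.
    assert (Ht : S < t0).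
    { destruct (Rle_lt_or_eq_dec S t0 (proj1 Ht0)) as [?|E]; [assumption|].
      specialize (Hini x0 Hx0). rewrite E in Hini. lra. }
    assert (Hzt0 : zt x0 t0 <= - k * z x0 t0).
    { apply (time_derivative_at_min A B S T z zx zt); auto; [lra|].
      intros t Ht'. apply Hmin; lra. }
    destruct (second_derivative_near_min A B c x0 (fun x => z x t0) (fun x => zx x t0))
      as [Hzx0 Hnear]; auto.
    - apply (parabolic_field_slice A B S T z zx zt); auto; lra.
    - intros x Hx Hxc. destruct (Heq x t0 Hx Hxc ltac:(lra)) as [l [Hl _]].
      exists l; exact Hl.
    - intros x Hx. specialize (Hmin x t0 Hx Ht0).
      apply Rmult_le_reg_l with (2 := Hmin). apply exp_pos.
    - intros E; rewrite E in *; apply HA; lra.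
    - intros E; rewrite E in *; apply HB; lra.
    - assert (HD0 : A <= x0 <= B /\ S < t0 <= T) by lra.
      assert (Hc : cont2_on (fun x t => A <= x <= B /\ S < t <= T)
                 (fun x t => zt x t + (-b * zx x t + -C * z x t))).
      { apply cont2_on_plus; [exact Hzt|]. apply cont2_on_plus;
          (apply cont2_on_mult; [apply cont2_on_const|]); [exact Hzx|].
        restrict Hz. }
      destruct (Hc x0 t0 HD0 (- z x0 t0) ltac:(lra)) as [e1 [He1 H1]].
      destruct (Hz x0 t0 (conj Hx0 Ht0) (- z x0 t0) ltac:(lra)) as [e2 [He2 H2]].
      destruct (Hnear (Rmin e1 e2) ltac:(apply Rmin_glb_lt; lra))
        as [x [l [Hx [Hxc [Hxd [Hl Hl0]]]]]].
      pose proof (Rmin_l e1 e2); pose proof (Rmin_r e1 e2).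
      assert (E1 := H1 x t0 ltac:(lra) ltac:(lra)
        ltac:(rewrite Rminus_diag, Rabs_R0; lra)).
      assert (E2 := H2 x t0 ltac:(lra) ltac:(lra)
        ltac:(rewrite Rminus_diag, Rabs_R0; lra)).
      apply Rabs_lt_between in E1, E2. rewrite Hzx0 in E1.
      destruct (Heq x t0 Hx Hxc ltac:(lra)) as [l' [Hl' Hineq]].
      rewrite (is_derive_eq _ _ _ _ Hl' Hl) in Hineq.
      specialize (Hineq ltac:(lra)). unfold k in Hzt0.
      assert (0 <= d * l) by nra. lra. }
  intros x t Hx Ht. specialize (Hmin x t Hx Ht).
  pose proof (exp_pos (k * t)). pose proof (exp_pos (k * t0)).
  apply Rnot_lt_le. intros Hneg. nra.
Qed.

(** * The linear Robin problem *)

Lemma continuous_cont_on (D : R -> Prop) (f : R -> R) :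
  (forall x, continuous f x) -> cont_on D f.
Proof.
  intros Hf. apply continuity_cont_on. intros x _. apply continuity_pt_filterlim, Hf.
Qed.

Lemma continuous_clamp (a b : R) (f : R -> R) :
  a <= b -> cont_on (fun x => a <= x <= b) f ->
  forall x, continuous (fun y => f (clamp a b y)) x.
Proof.
  intros Hab Hf x. apply continuity_pt_filterlim, cont_on_clamp; assumption.
Qed.

Lemma chi_lt (c x : R) : x < c -> chi c x = 1.
Proof. intros H. unfold chi. destruct (Rlt_dec x c); lra. Qed.

Lemma chi_ge (c x : R) : c <= x -> chi c x = 0.
Proof. intros H. unfold chi. destruct (Rlt_dec x c); lra. Qed.

Lemma is_derive_primitive (g : R -> R) (x : R) :
  (forall y, continuous g y) -> is_derive (fun y => RInt g 0 y) x (g x).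
Proof.
  intros Hg. apply (is_derive_RInt g (fun y => RInt g 0 y) 0 x); [|apply Hg].
  apply filter_forall. intros y. apply (RInt_correct (V := R_CompleteNormedModule)).
  apply (ex_RInt_continuous (V := R_CompleteNormedModule)). intros z _. apply Hg.
Qed.

Lemma Rmin_continuous (c x : R) : continuous (fun y => Rmin y c) x.
Proof.
  apply continuity_pt_filterlim. intros eps Heps. exists eps; split; [exact Heps|].
  intros y [_ Hy]. simpl in *. unfold Rdist in *.
  eapply Rle_lt_trans; [|exact Hy].
  unfold Rmin. destruct (Rle_dec y c); destruct (Rle_dec x c);
    unfold Rabs; repeat destruct (Rcase_abs _); lra.
Qed.

(* Equals the integral over [0, x] of exp (- lam s) (f1 s + chi c s f2 s),
   written without integrating a discontinuous function. *)
Definition chi_primitive (c : R) (f1 f2 : R -> R) (lam x : R) : R :=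
  RInt (fun s => exp (- lam * s) * f1 s) 0 x
  + RInt (fun s => exp (- lam * s) * f2 s) 0 (Rmin x c).

Lemma exp_mult_continuous (lam : R) (f : R -> R) :
  (forall x, continuous f x) ->
  forall x, continuous (fun s => exp (lam * s) * f s) x.
Proof.
  intros Hf x. apply (continuous_mult (fun s => exp (lam * s)) f); [|apply Hf].
  apply (ex_derive_continuous (fun s => exp (lam * s))). auto_derive. exact I.
Qed.

Lemma chi_primitive_continuous (c : R) (f1 f2 : R -> R) (lam : R) :
  (forall x, continuous f1 x) -> (forall x, continuous f2 x) ->
  forall x, continuous (chi_primitive c f1 f2 lam) x.
Proof.
  intros H1 H2 x. unfold chi_primitive.
  apply (continuous_plus (fun x => RInt (fun s => exp (- lam * s) * f1 s) 0 x)
           (fun x => RInt (fun s => exp (- lam * s) * f2 s) 0 (Rmin x c))).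
  - apply (ex_derive_continuous (fun x => RInt (fun s => exp (- lam * s) * f1 s) 0 x)).
    eexists. apply is_derive_primitive. apply exp_mult_continuous, H1.
  - apply (continuous_comp (fun y => Rmin y c)
             (fun x => RInt (fun s => exp (- lam * s) * f2 s) 0 x));
      [apply Rmin_continuous|].
    apply (ex_derive_continuous (fun x => RInt (fun s => exp (- lam * s) * f2 s) 0 x)).
    eexists. apply is_derive_primitive. apply exp_mult_continuous, H2.
Qed.

Lemma chi_primitive_derive (c : R) (f1 f2 : R -> R) (lam x : R) :
  (forall x, continuous f1 x) -> (forall x, continuous f2 x) -> x <> c ->
  is_derive (chi_primitive c f1 f2 lam) x (exp (- lam * x) * (f1 x + chi c x * f2 x)).
Proof.
  intros H1 H2 Hxc. unfold chi_primitive. rewrite Rmult_plus_distr_l.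
  apply (is_derive_plus (fun x => RInt (fun s => exp (- lam * s) * f1 s) 0 x)
           (fun x => RInt (fun s => exp (- lam * s) * f2 s) 0 (Rmin x c))).
  { apply (is_derive_primitive (fun s => exp (- lam * s) * f1 s)).
    apply exp_mult_continuous, H1. }
  destruct (Rlt_dec x c) as [Hlt|Hge].
  - rewrite chi_lt, Rmult_1_l by exact Hlt.
    apply (is_derive_ext_loc (fun x => RInt (fun s => exp (- lam * s) * f2 s) 0 x)).
    + apply (filter_imp (fun y => x - 1 < y < c)); [|apply locally_open_interval; lra].
      intros y Hy. rewrite Rmin_left by lra. reflexivity.
    + apply (is_derive_primitive (fun s => exp (- lam * s) * f2 s)).
      apply exp_mult_continuous, H2.
  - rewrite chi_ge by lra. rewrite Rmult_0_l, Rmult_0_r.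
    apply (is_derive_ext_loc (fun _ => RInt (fun s => exp (- lam * s) * f2 s) 0 c)).
    + apply (filter_imp (fun y => c < y < x + 1)); [|apply locally_open_interval; lra].
      intros y Hy. rewrite Rmin_right by lra. reflexivity.
    + apply is_derive_const_R.
Qed.

Definition robin_solution (d b gam K l c : R) (f y yx : R -> R) : Prop :=
  C1on 0 l y yx /\ yx 0 = gam * y 0 /\ yx l = 0 /\
  forall x, 0 < x < l -> x <> c -> exists yxx : R, is_derive yx x yxx /\
    d * yxx + b * yx x - K * y x + f x = 0.

Definition robin_super (d b gam K l c : R) (f y yx : R -> R) : Prop :=
  C1on 0 l y yx /\ yx 0 <= gam * y 0 /\ 0 <= yx l /\
  forall x, 0 < x < l -> x <> c -> exists yxx : R, is_derive yx x yxx /\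
    d * yxx + b * yx x - K * y x + f x <= 0.

Definition robin_sub (d b gam K l c : R) (f y yx : R -> R) : Prop :=
  C1on 0 l y yx /\ gam * y 0 <= yx 0 /\ yx l <= 0 /\
  forall x, 0 < x < l -> x <> c -> exists yxx : R, is_derive yx x yxx /\
    0 <= d * yxx + b * yx x - K * y x + f x.

Lemma robin_solution_super (d b gam K l c : R) (f y yx : R -> R) :
  robin_solution d b gam K l c f y yx -> robin_super d b gam K l c f y yx.
Proof.
  intros [HC [H0 [Hl H]]]. split; [exact HC|]. split; [lra|]. split; [lra|].
  intros x Hx Hxc. destruct (H x Hx Hxc) as [l' [Hd E]]. exists l'. split; [exact Hd|lra].
Qed.

Lemma robin_solution_sub (d b gam K l c : R) (f y yx : R -> R) :
  robin_solution d b gam K l c f y yx -> robin_sub d b gam K l c f y yx.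
Proof.
  intros [HC [H0 [Hl H]]]. split; [exact HC|]. split; [lra|]. split; [lra|].
  intros x Hx Hxc. destruct (H x Hx Hxc) as [l' [Hd E]]. exists l'. split; [exact Hd|lra].
Qed.

Lemma C1on_plus (A B : R) (f fx g gx : R -> R) :
  C1on A B f fx -> C1on A B g gx ->
  C1on A B (fun x => f x + g x) (fun x => fx x + gx x).
Proof.
  intros [F1 [F2 F3]] [G1 [G2 G3]]. split; [|split].
  - apply cont_on_plus; assumption.
  - apply cont_on_plus; assumption.
  - intros x Hx. apply (is_derive_plus f g); auto.
Qed.

Lemma is_derive_mult_R (f g : R -> R) (x df dg : R) :
  is_derive f x df -> is_derive g x dg ->
  is_derive (fun y => f y * g y) x (df * g x + f x * dg).
Proof.
  intros Hf Hg. apply (is_derive_mult f g x df dg Hf Hg). intros; apply Rmult_comm.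
Qed.

Lemma C1on_mult (A B : R) (f fx g gx : R -> R) :
  C1on A B f fx -> C1on A B g gx ->
  C1on A B (fun x => f x * g x) (fun x => fx x * g x + f x * gx x).
Proof.
  intros [F1 [F2 F3]] [G1 [G2 G3]]. split; [|split].
  - apply cont_on_mult; assumption.
  - apply cont_on_plus; apply cont_on_mult; assumption.
  - intros x Hx. apply is_derive_mult_R; auto.
Qed.

Lemma C1on_const (A B k : R) : C1on A B (fun _ => k) (fun _ => 0).
Proof.
  split; [|split]; try apply cont_on_const.
  intros x _. apply is_derive_const_R.
Qed.

Lemma C1on_scal (A B k : R) (f fx : R -> R) :
  C1on A B f fx -> C1on A B (fun x => k * f x) (fun x => k * fx x).
Proof.
  intros [F1 [F2 F3]]. split; [|split].
  - apply cont_on_mult; [apply cont_on_const|assumption].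
  - apply cont_on_mult; [apply cont_on_const|assumption].
  - intros x Hx. apply is_derive_scal; auto.
Qed.

Lemma robin_comparison (d b gam K l c eps : R) (f g y yx v vx : R -> R) :
  0 < d -> 0 <= gam -> 0 < K -> 0 < l -> 0 <= eps ->
  robin_sub d b gam K l c f y yx -> robin_super d b gam K l c g v vx ->
  (forall x, 0 < x < l -> x <> c -> f x <= g x + eps) ->
  forall x, 0 <= x <= l -> y x <= v x + eps / K.
Proof.
  intros Hd Hgam HK Hl Heps [Cy [Y0 [Yl Hy]]] [Cv [V0 [Vl Hv]]] Hfg x Hx.
  assert (Hek : 0 <= eps / K) by (apply Rdiv_le_0_compat; lra).
  assert (Hek' : K * (eps / K) = eps) by (field; lra).
  pose proof (elliptic_minimum_principle 0 l c d b K
    (fun x => v x + -1 * y x + eps / K) (fun x => vx x + -1 * yx x + 0)) as H.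
  cbv beta in H.
  enough (0 <= v x + -1 * y x + eps / K) by lra. apply H; auto.
  - apply (C1on_plus 0 l (fun x => v x + -1 * y x) _ (fun _ => eps / K) (fun _ => 0));
      [|apply C1on_const].
    apply (C1on_plus 0 l v vx (fun x => -1 * y x)); [exact Cv|].
    apply C1on_scal, Cy.
  - intros Hneg. nra.
  - intros Hneg. lra.
  - intros z Hz Hzc. destruct (Hy z Hz Hzc) as [yxx [Dy Ey]].
    destruct (Hv z Hz Hzc) as [vxx [Dv Ev]]. exists (vxx + -1 * yxx + 0). split.
    + apply (is_derive_plus (fun x => vx x + -1 * yx x) (fun _ => 0));
        [|apply is_derive_const_R].
      apply (is_derive_plus vx (fun x => -1 * yx x)); [exact Dv|].
      apply is_derive_scal, Dy.
    + intros _. specialize (Hfg z Hz Hzc). nra.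
Qed.

Lemma lipschitz_except_point (f : R -> R) (a b c M : R) :
  a <= b -> cont_on (fun x => a <= x <= b) f ->
  (forall x, a < x < b -> x <> c -> exists l : R, is_derive f x l /\ Rabs l <= M) ->
  Rabs (f b - f a) <= M * (b - a).
Proof.
  intros Hab Hc Hd. destruct (classic (a < c < b)) as [Hacb|Hn].
  - replace (f b - f a) with ((f b - f c) + (f c - f a)) by ring.
    eapply Rle_trans; [apply Rabs_triang|].
    replace (M * (b - a)) with (M * (b - c) + M * (c - a)) by ring.
    apply Rplus_le_compat; apply lipschitz_of_derive; try lra;
      try (restrict Hc);
      intros x Hx; apply Hd; lra.
  - apply lipschitz_of_derive; auto. intros x Hx. apply Hd; [exact Hx|].
    intros ->. contradiction.
Qed.

Lemma exp_le_compat (x y : R) : x <= y -> exp x <= exp y.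
Proof.
  intros [H|H]; [left; apply exp_increasing, H|right; rewrite H; reflexivity].
Qed.

Lemma exp_bound (k x l : R) : 0 <= x <= l -> exp (k * x) <= exp (Rabs k * l).
Proof.
  intros Hx. apply exp_le_compat. pose proof (Rle_abs k). pose proof (Rabs_pos k). nra.
Qed.

Lemma robin_gradient_bound (d b gam K l c M N : R) (f y yx : R -> R) :
  0 < d -> 0 < K -> 0 < l -> 0 <= N ->
  robin_solution d b gam K l c f y yx ->
  (forall x, 0 <= x <= l -> Rabs (y x) <= M) ->
  (forall x, 0 < x < l -> x <> c -> Rabs (f x) <= N) ->
  forall x, 0 <= x <= l ->
  Rabs (yx x) <= exp (Rabs (b / d) * l) * (exp (Rabs (b / d) * l) * ((K * M + N) / d) * l).
Proof.
  intros Hd HK Hl HN0 [[Cy [Cyx Dy]] [Y0 [Yl Hy]]] HM HN x Hx.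
  pose (E := exp (Rabs (b / d) * l)). fold E.
  assert (HE : 0 < E) by apply exp_pos.
  pose (v := fun x => exp (b / d * x) * yx x).
  assert (Hv : Rabs (v l - v x) <= E * ((K * M + N) / d) * (l - x)).
  { apply (lipschitz_except_point v x l c); [lra| |].
    - apply cont_on_mult.
      + apply (is_derive_cont_on _ _ (fun t => b / d * exp (b / d * t))). intros t.
        auto_derive; [exact I|ring].
      + restrict Cyx.
    - intros z Hz Hzc. destruct (Hy z ltac:(lra) Hzc) as [yxx [D Eq]].
      exists (exp (b / d * z) * ((K * y z - f z) / d)). split.
      + evar_last.
        * apply (is_derive_mult_R (fun x => exp (b / d * x)) yx z); [|exact D].
          auto_derive; [exact I|reflexivity].
        * assert (yxx = (K * y z - f z - b * yx z) / d) by (field_simplify_eq; lra).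
          subst yxx. field. lra.
      + rewrite Rabs_mult, (Rabs_right (exp _)) by (left; apply exp_pos).
        apply Rmult_le_compat; [left; apply exp_pos|apply Rabs_pos|apply exp_bound; lra|].
        unfold Rdiv. rewrite Rabs_mult, (Rabs_right (/ d))
          by (left; apply Rinv_0_lt_compat, Hd).
        apply Rmult_le_compat_r; [left; apply Rinv_0_lt_compat, Hd|].
        specialize (HM z ltac:(lra)). specialize (HN z ltac:(lra) Hzc).
        unfold Rminus. eapply Rle_trans; [apply Rabs_triang|].
        rewrite Rabs_Ropp, Rabs_mult, (Rabs_right K) by lra. nra. }
  assert (Hq : 0 <= E * ((K * M + N) / d)).
  { apply Rmult_le_pos; [lra|]. apply Rdiv_le_0_compat; [|lra].
    pose proof (HM 0 ltac:(lra)). pose proof (Rabs_pos (y 0)). nra. }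
  unfold v in Hv at 1. rewrite Yl, Rmult_0_r, Rminus_0_l, Rabs_Ropp in Hv.
  unfold v in Hv. rewrite Rabs_mult, (Rabs_right (exp _)) in Hv
    by (left; apply exp_pos).
  assert (Hone : Rabs (yx x) = exp (- (b / d) * x) * (exp (b / d * x) * Rabs (yx x))).
  { rewrite <- Rmult_assoc, <- exp_plus.
    replace (- (b / d) * x + b / d * x) with 0 by ring. rewrite exp_0. ring. }
  rewrite Hone. apply Rmult_le_compat.
  - left; apply exp_pos.
  - apply Rmult_le_pos; [left; apply exp_pos|apply Rabs_pos].
  - unfold E. rewrite <- (Rabs_Ropp (b / d)). apply exp_bound, Hx.
  - eapply Rle_trans; [exact Hv|]. apply Rmult_le_compat_l; lra.
Qed.

Definition robin_root (d b K s : R) : R := (- b + s * sqrt (b ^ 2 + 4 * d * K)) / (2 * d).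

Definition robin_tau (d b gam K l c : R) (f1 f2 : R -> R) : R :=
  let lp := robin_root d b K 1 in
  let lm := robin_root d b K (-1) in
  / (d * (lp - lm)) *
  (lp * exp (lp * l) * chi_primitive c f1 f2 lp l
   - lm * exp (lm * l) * chi_primitive c f1 f2 lm l)
  / (lp * exp (lp * l) * (gam - lm) + lm * exp (lm * l) * (lp - gam)).

Definition robin_mode (c : R) (f1 f2 : R -> R) (lam A k x : R) : R :=
  exp (lam * x) * (A + k * chi_primitive c f1 f2 lam x).

(* Variation of constants; the two free constants are proportional to
   [gam - lm] and [lp - gam] so that the condition at [0] holds, and
   [robin_tau] is fixed by the condition at [l]. *)
Definition robin_coef_p (d b gam K l c : R) (f1 f2 : R -> R) : R -> R :=
  let lp := robin_root d b K 1 in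
  let lm := robin_root d b K (-1) in
  robin_mode c f1 f2 lp ((gam - lm) * robin_tau d b gam K l c f1 f2)
    (- / (d * (lp - lm))).

Definition robin_coef_m (d b gam K l c : R) (f1 f2 : R -> R) : R -> R :=
  let lp := robin_root d b K 1 in
  let lm := robin_root d b K (-1) in
  robin_mode c f1 f2 lm ((lp - gam) * robin_tau d b gam K l c f1 f2)
    (/ (d * (lp - lm))).

Definition robin_y (d b gam K l c : R) (f1 f2 : R -> R) (x : R) : R :=
  robin_coef_p d b gam K l c f1 f2 x + robin_coef_m d b gam K l c f1 f2 x.

Definition robin_yx (d b gam K l c : R) (f1 f2 : R -> R) (x : R) : R :=
  robin_root d b K 1 * robin_coef_p d b gam K l c f1 f2 x
  + robin_root d b K (-1) * robin_coef_m d b gam K l c f1 f2 x.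

Lemma robin_roots (d b K : R) : 0 < d -> 0 < K ->
  robin_root d b K (-1) < 0 < robin_root d b K 1 /\
  d * robin_root d b K 1 ^ 2 + b * robin_root d b K 1 - K = 0 /\
  d * robin_root d b K (-1) ^ 2 + b * robin_root d b K (-1) - K = 0.
Proof.
  intros Hd HK. unfold robin_root.
  assert (Hdisc : 0 <= b ^ 2 + 4 * d * K) by nra.
  pose proof (sqrt_sqrt _ Hdisc) as Hs. pose proof (sqrt_pos (b ^ 2 + 4 * d * K)) as Hs0.
  set (s := sqrt (b ^ 2 + 4 * d * K)) in *.
  assert (Hbs : - s < b < s) by (split; nra).
  assert (Hi : 0 < / (2 * d)) by (apply Rinv_0_lt_compat; lra).
  split; [|split].
  - unfold Rdiv. split; nra.
  - field_simplify_eq; [|lra]. simpl. nra.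
  - field_simplify_eq; [|lra]. simpl. nra.
Qed.

Section RobinSolver.

Variables (d b gam K l c : R) (f1 f2 : R -> R).
Hypothesis (Hd : 0 < d) (Hgam : 0 <= gam) (HK : 0 < K) (Hl : 0 < l) (Hc : 0 < c).
Hypothesis (Hf1 : forall x, continuous f1 x) (Hf2 : forall x, continuous f2 x).

Let lp := robin_root d b K 1.
Let lm := robin_root d b K (-1).
Let P := robin_coef_p d b gam K l c f1 f2.
Let Q := robin_coef_m d b gam K l c f1 f2.
Let f := fun x => f1 x + chi c x * f2 x.

Lemma robin_mode_continuous (lam A k x : R) : continuous (robin_mode c f1 f2 lam A k) x.
Proof.
  apply (exp_mult_continuous lam (fun x => A + k * chi_primitive c f1 f2 lam x)).
  intros y. apply (continuous_plus (fun _ => A) (fun x => k * chi_primitive c f1 f2 lam x));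
    [apply continuous_const|].
  apply (continuous_mult (fun _ => k)); [apply continuous_const|].
  apply chi_primitive_continuous; assumption.
Qed.

Lemma robin_mode_derive (lam A k x : R) : x <> c ->
  is_derive (robin_mode c f1 f2 lam A k) x (lam * robin_mode c f1 f2 lam A k x + k * f x).
Proof.
  intros Hx. unfold robin_mode. evar_last.
  - apply (is_derive_mult_R (fun x => exp (lam * x))
      (fun x => A + k * chi_primitive c f1 f2 lam x)).
    + auto_derive; [exact I|reflexivity].
    + apply (is_derive_plus (fun _ => A) (fun x => k * chi_primitive c f1 f2 lam x)).
      * apply is_derive_const_R.
      * apply is_derive_scal, chi_primitive_derive; assumption.
  - unfold plus; simpl. fold (f x).
    assert (E : exp (lam * x) * exp (- lam * x) = 1).
    { rewrite <- exp_plus. replace (lam * x + - lam * x) with 0 by ring. apply exp_0. }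
    transitivity (lam * (exp (lam * x) * (A + k * chi_primitive c f1 f2 lam x))
      + k * f x * (exp (lam * x) * exp (- lam * x))); [ring|].
    rewrite E. ring.
Qed.

Lemma robin_coef_continuous (x : R) : continuous P x /\ continuous Q x.
Proof. split; apply robin_mode_continuous. Qed.

Lemma robin_coef_p_derive (x : R) : x <> c ->
  is_derive P x (lp * P x - / (d * (lp - lm)) * f x).
Proof.
  intros Hx. replace (lp * P x - / (d * (lp - lm)) * f x)
    with (lp * P x + - / (d * (lp - lm)) * f x) by ring.
  exact (robin_mode_derive lp _ _ x Hx).
Qed.

Lemma robin_coef_m_derive (x : R) : x <> c ->
  is_derive Q x (lm * Q x + / (d * (lp - lm)) * f x).
Proof. intros Hx. exact (robin_mode_derive lm _ _ x Hx). Qed.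

Lemma robin_y_continuous (x : R) : continuous (robin_y d b gam K l c f1 f2) x.
Proof.
  destruct (robin_coef_continuous x) as [HP HQ]. exact (continuous_plus P Q x HP HQ).
Qed.

Lemma robin_yx_continuous (x : R) : continuous (robin_yx d b gam K l c f1 f2) x.
Proof.
  destruct (robin_coef_continuous x) as [HP HQ].
  apply (continuous_plus (fun x => lp * P x) (fun x => lm * Q x)).
  - exact (continuous_mult (fun _ => lp) P x (continuous_const lp x) HP).
  - exact (continuous_mult (fun _ => lm) Q x (continuous_const lm x) HQ).
Qed.

Lemma robin_y_derive (x : R) :
  is_derive (robin_y d b gam K l c f1 f2) x (robin_yx d b gam K l c f1 f2 x).
Proof.
  assert (Hne : forall x, x <> c ->
    is_derive (robin_y d b gam K l c f1 f2) x (robin_yx d b gam K l c f1 f2 x)).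
  { intros y Hy. evar_last.
    - apply (is_derive_plus P Q); [apply robin_coef_p_derive|apply robin_coef_m_derive];
        exact Hy.
    - unfold robin_yx, plus; simpl. fold lp lm P Q. ring. }
  destruct (Req_dec x c) as [->|Hx]; [|apply Hne, Hx].
  apply (is_derive_removable _ _ c (c - 1) (c + 1)); [lra| | |].
  - intros y _. apply continuity_pt_filterlim, robin_y_continuous.
  - intros y _ Hy. apply Hne, Hy.
  - apply continuity_pt_filterlim, robin_yx_continuous.
Qed.

Lemma robin_y_solution :
  robin_solution d b gam K l c f (robin_y d b gam K l c f1 f2)
    (robin_yx d b gam K l c f1 f2).
Proof.
  destruct (robin_roots d b K Hd HK) as [[Hm Hp] [Ep Em]]. fold lp lm in Hm, Hp, Ep, Em.
  assert (Hprim0 : forall lam, chi_primitive c f1 f2 lam 0 = 0).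
  { intros lam. unfold chi_primitive. rewrite Rmin_left by lra.
    rewrite !RInt_point. unfold zero; simpl. ring. }
  split; [split; [|split]|split; [|split]].
  - apply continuous_cont_on, robin_y_continuous.
  - apply continuous_cont_on, robin_yx_continuous.
  - intros x _. apply robin_y_derive.
  - unfold robin_yx, robin_y, robin_coef_p, robin_coef_m, robin_mode. fold lp lm.
    rewrite !Hprim0, !Rmult_0_r, exp_0. ring.
  - unfold robin_yx, robin_coef_p, robin_coef_m, robin_mode. fold lp lm.
    assert (Hdet : 0 < lp * exp (lp * l) * (gam - lm) + lm * exp (lm * l) * (lp - gam)).
    { assert (He : exp (lm * l) < exp (lp * l)) by (apply exp_increasing; nra).
      pose proof (exp_pos (lm * l)).
      assert (0 < (- lm * lp) * (exp (lp * l) - exp (lm * l)))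
        by (apply Rmult_lt_0_compat; nra).
      assert (0 <= gam * (lp * exp (lp * l) + - lm * exp (lm * l))).
      { apply Rmult_le_pos; [exact Hgam|]. nra. }
      nra. }
    unfold robin_tau. fold lp lm. field. repeat split; lra.
  - intros x Hx Hxc.
    exists (lp * (lp * P x - / (d * (lp - lm)) * f x)
            + lm * (lm * Q x + / (d * (lp - lm)) * f x)). split.
    + apply (is_derive_plus (fun x => lp * P x) (fun x => lm * Q x)).
      * apply is_derive_scal, robin_coef_p_derive, Hxc.
      * apply is_derive_scal, robin_coef_m_derive, Hxc.
    + unfold robin_yx, robin_y. fold lp lm P Q.
      transitivity (P x * (d * lp ^ 2 + b * lp - K) + Q x * (d * lm ^ 2 + b * lm - K));
        [field; lra|]. rewrite Ep, Em. ring.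
Qed.

End RobinSolver.

(** * Uniform limits and asymptotic comparison *)

Definition unif_seq (l : R) (f : nat -> R -> R) (g : R -> R) : Prop :=
  forall eps, 0 < eps -> exists N : nat, forall n, (N <= n)%nat ->
    forall x, 0 <= x <= l -> Rabs (f n x - g x) <= eps.

Lemma lipschitz_pointwise_uniform (l Lam : R) (f : nat -> R -> R) (g : R -> R) :
  0 < l -> 0 <= Lam ->
  (forall n x y, 0 <= x <= l -> 0 <= y <= l -> Rabs (f n x - f n y) <= Lam * Rabs (x - y)) ->
  (forall x, 0 <= x <= l -> is_lim_seq (fun n => f n x) (g x)) ->
  (forall x y, 0 <= x <= l -> 0 <= y <= l -> Rabs (g x - g y) <= Lam * Rabs (x - y)) /\
  unif_seq l f g.
Proof.
  intros Hl HLam Hf Hlim.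
  assert (Hpt : forall x eps, 0 <= x <= l -> 0 < eps ->
    exists N : nat, forall n, (N <= n)%nat -> Rabs (f n x - g x) < eps).
  { intros x eps Hx Heps. pose proof (Hlim x Hx) as H. apply is_lim_seq_spec in H.
    exact (H (mkposreal eps Heps)). }
  assert (Hg : forall x y, 0 <= x <= l -> 0 <= y <= l ->
    Rabs (g x - g y) <= Lam * Rabs (x - y)).
  { intros x y Hx Hy. apply Rnot_lt_le. intros Hlt.
    pose (eps := (Rabs (g x - g y) - Lam * Rabs (x - y)) / 2).
    assert (Heps : 0 < eps) by (unfold eps; lra).
    destruct (Hpt x eps Hx Heps) as [N1 H1]. destruct (Hpt y eps Hy Heps) as [N2 H2].
    specialize (H1 (N1 + N2)%nat ltac:(lia)). specialize (H2 (N1 + N2)%nat ltac:(lia)).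
    specialize (Hf (N1 + N2)%nat x y Hx Hy).
    assert (Rabs (g x - g y) <= Rabs (f (N1 + N2)%nat x - g x)
       + Rabs (f (N1 + N2)%nat x - f (N1 + N2)%nat y) + Rabs (f (N1 + N2)%nat y - g y)).
    { unfold Rabs. repeat destruct (Rcase_abs _); lra. }
    unfold eps in *. lra. }
  split; [exact Hg|]. intros eps Heps.
  destruct (Rle_lt_or_eq_dec 0 Lam HLam) as [HL|<-].
  - pose (del := eps / (4 * Lam)).
    assert (Hdel : 0 < del) by (apply Rdiv_lt_0_compat; lra).
    assert (HLd : Lam * del = eps / 4) by (unfold del; field; lra).
    assert (Hgrid : forall k : nat, exists N : nat, forall n, (N <= n)%nat ->
       forall i : nat, (i <= k)%nat -> INR i * del <= l ->
       Rabs (f n (INR i * del) - g (INR i * del)) < eps / 4).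
    { induction k as [|k [N HN]].
      - destruct (Hpt 0 (eps / 4) ltac:(lra) ltac:(lra)) as [N HN].
        exists N. intros n Hn i Hi _. assert (i = 0)%nat by lia. subst i.
        rewrite Rmult_0_l. apply HN, Hn.
      - destruct (Rle_dec (INR (S k) * del) l) as [Hk|Hk].
        + destruct (Hpt (INR (S k) * del) (eps / 4)) as [N' HN'];
            [split; [apply Rmult_le_pos; [apply pos_INR|lra]|exact Hk]|lra|].
          exists (N + N')%nat. intros n Hn i Hi Hil.
          destruct (Nat.eq_dec i (S k)) as [->|Hne]; [apply HN'; lia|].
          apply HN; [lia|lia|exact Hil].
        + exists N. intros n Hn i Hi Hil.
          destruct (Nat.eq_dec i (S k)) as [->|Hne]; [contradiction|].
          apply HN; [lia|lia|exact Hil]. }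
    destruct (nfloor_ex (l / del)) as [k Hk]; [apply Rdiv_le_0_compat; lra|].
    destruct (Hgrid k) as [N HN]. exists N. intros n Hn x Hx.
    destruct (nfloor_ex (x / del)) as [i Hi]; [apply Rdiv_le_0_compat; lra|].
    assert (Hxd : x / del * del = x) by (field; lra).
    assert (Hld : l / del * del = l) by (field; lra).
    assert (Hix : INR i * del <= x < INR i * del + del).
    { destruct Hi as [Hi1 Hi2]. split; [rewrite <- Hxd; apply Rmult_le_compat_r; lra|].
      rewrite <- Hxd at 1. nra. }
    assert (Hi0 : 0 <= INR i * del) by (apply Rmult_le_pos; [apply pos_INR|lra]).
    assert (Hik : (i <= k)%nat).
    { apply Nat.lt_succ_r, INR_lt. rewrite S_INR. nra. }
    specialize (HN n Hn i Hik ltac:(lra)).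
    pose proof (Hf n x (INR i * del) Hx ltac:(lra)) as H1.
    pose proof (Hg x (INR i * del) Hx ltac:(lra)) as H2.
    rewrite (Rabs_right (x - INR i * del)) in H1, H2 by lra.
    assert (H3 : Lam * (x - INR i * del) <= eps / 4) by nra.
    set (xi := INR i * del) in *.
    assert (Rabs (f n x - g x) <= Rabs (f n x - f n xi) + Rabs (f n xi - g xi)
       + Rabs (g x - g xi)).
    { unfold Rabs. repeat destruct (Rcase_abs _); lra. }
    lra.
  - destruct (Hpt 0 eps ltac:(lra) Heps) as [N HN]. exists N. intros n Hn x Hx.
    specialize (HN n Hn). pose proof (Hf n x 0 Hx ltac:(lra)) as H1.
    pose proof (Hg x 0 Hx ltac:(lra)) as H2. rewrite Rmult_0_l in H1, H2.
    assert (Rabs (f n x - g x) <= Rabs (f n x - f n 0) + Rabs (f n 0 - g 0)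
       + Rabs (g x - g 0)).
    { unfold Rabs. repeat destruct (Rcase_abs _); lra. }
    lra.
Qed.

Lemma parabolic_field_plus (A B S T : R) (z zx zt v vx vt : R -> R -> R) :
  parabolic_field A B S T z zx zt -> parabolic_field A B S T v vx vt ->
  parabolic_field A B S T (fun x t => z x t + v x t) (fun x t => zx x t + vx x t)
    (fun x t => zt x t + vt x t).
Proof.
  intros [Z1 [Z2 [Z3 Z4]]] [V1 [V2 [V3 V4]]]. split; [|split; [|split]].
  - apply cont2_on_plus; assumption.
  - apply cont2_on_plus; assumption.
  - apply cont2_on_plus; assumption.
  - intros x t Hx Ht. destruct (Z4 x t Hx Ht), (V4 x t Hx Ht). split.
    + apply (is_derive_plus (fun y => z y t) (fun y => v y t)); assumption.
    + apply (is_derive_plus (fun s => z x s) (fun s => v x s)); assumption.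
Qed.

Lemma parabolic_field_mult_space (A B S T : R) (g gx : R -> R) (z zx zt : R -> R -> R) :
  C1on A B g gx -> parabolic_field A B S T z zx zt ->
  parabolic_field A B S T (fun x t => g x * z x t)
    (fun x t => gx x * z x t + g x * zx x t) (fun x t => g x * zt x t).
Proof.
  intros [G1 [G2 G3]] [Z1 [Z2 [Z3 Z4]]].
  assert (Z1' : cont2_on (fun x t => A <= x <= B /\ S < t <= T) z).
  { restrict Z1. }
  split; [|split; [|split]].
  - apply cont2_on_mult; [|assumption].
    apply (cont2_on_fst _ (fun x => A <= x <= B)); [tauto|assumption].
  - apply cont2_on_plus; (apply cont2_on_mult; [|assumption]);
      apply (cont2_on_fst _ (fun x => A <= x <= B)); tauto.
  - apply cont2_on_mult; [|assumption].
    apply (cont2_on_fst _ (fun x => A <= x <= B)); [tauto|assumption].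
  - intros x t Hx Ht. destruct (Z4 x t Hx Ht). split.
    + apply (is_derive_mult_R g (fun y => z y t)); auto.
    + apply is_derive_scal; assumption.
Qed.

Lemma parabolic_field_scal (A B S T k : R) (z zx zt : R -> R -> R) :
  parabolic_field A B S T z zx zt ->
  parabolic_field A B S T (fun x t => k * z x t) (fun x t => k * zx x t)
    (fun x t => k * zt x t).
Proof.
  intros [Z1 [Z2 [Z3 Z4]]]. split; [|split; [|split]].
  - apply cont2_on_mult; [apply cont2_on_const|assumption].
  - apply cont2_on_mult; [apply cont2_on_const|assumption].
  - apply cont2_on_mult; [apply cont2_on_const|assumption].
  - intros x t Hx Ht. destruct (Z4 x t Hx Ht).
    split; apply is_derive_scal; assumption.
Qed.

Lemma parabolic_field_sep (A B S T : R) (g gx c ct : R -> R) :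
  C1on A B g gx -> (forall t, is_derive c t (ct t)) ->
  (forall t, continuity_pt ct t) ->
  parabolic_field A B S T (fun x t => g x * c t) (fun x t => gx x * c t)
    (fun x t => g x * ct t).
Proof.
  intros [G1 [G2 G3]] Hc Hct. split; [|split; [|split]].
  - apply cont2_on_mult.
    + apply (cont2_on_fst _ (fun x => A <= x <= B)); [tauto|assumption].
    + apply (cont2_on_snd _ (fun _ => True)); [tauto|].
      apply (is_derive_cont_on _ c ct Hc).
  - apply cont2_on_mult.
    + apply (cont2_on_fst _ (fun x => A <= x <= B)); [tauto|assumption].
    + apply (cont2_on_snd _ (fun _ => True)); [tauto|].
      apply (is_derive_cont_on _ c ct Hc).
  - apply cont2_on_mult.
    + apply (cont2_on_fst _ (fun x => A <= x <= B)); [tauto|assumption].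
    + apply (cont2_on_snd _ (fun _ => True)); [tauto|].
      apply continuity_cont_on; auto.
  - intros x t Hx Ht. split.
    + apply (is_derive_ext (fun y => c t * g y)); [intros; apply Rmult_comm|].
      rewrite (Rmult_comm (gx x)). apply is_derive_scal, G3, Hx.
    + apply is_derive_scal, Hc.
Qed.

Definition parabolic_robin (d b gam l c S T : R) (r v vx vt : R -> R -> R) : Prop :=
  parabolic_field 0 l S T v vx vt /\
  (forall t, S < t <= T -> vx 0 t = gam * v 0 t /\ vx l t = 0) /\
  forall x t, 0 < x < l -> x <> c -> S < t <= T ->
    exists vxx : R, is_derive (fun y => vx y t) x vxx /\
      vt x t = d * vxx + b * vx x t + r x t.

Lemma parabolic_robin_opp (d b gam l c S T : R) (r v vx vt : R -> R -> R) :
  parabolic_robin d b gam l c S T r v vx vt ->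
  parabolic_robin d b gam l c S T (fun x t => -1 * r x t) (fun x t => -1 * v x t)
    (fun x t => -1 * vx x t) (fun x t => -1 * vt x t).
Proof.
  intros [HP [HB HE]]. split; [|split].
  - apply parabolic_field_scal, HP.
  - intros t Ht. destruct (HB t Ht) as [E1 E2]. rewrite E1, E2. split; ring.
  - intros x t Hx Hxc Ht. destruct (HE x t Hx Hxc Ht) as [l' [D E]].
    exists (-1 * l'). split; [apply is_derive_scal, D|rewrite E; ring].
Qed.

Lemma robin_solution_opp (d b gam K l c : R) (f y yx : R -> R) :
  robin_solution d b gam K l c f y yx ->
  robin_solution d b gam K l c (fun x => -1 * f x) (fun x => -1 * y x) (fun x => -1 * yx x).
Proof.
  intros [HC [H0 [Hl HE]]]. split; [apply C1on_scal, HC|].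
  split; [rewrite H0; ring|]. split; [rewrite Hl; ring|].
  intros x Hx Hxc. destruct (HE x Hx Hxc) as [l' [D E]].
  exists (-1 * l'). split; [apply is_derive_scal, D|]. lra.
Qed.

Lemma exp_decay_small (M K eps : R) : 0 < K -> 0 < eps -> 0 <= M ->
  exists s0, 0 <= s0 /\ forall s, s0 <= s -> M * exp (- K * s) <= eps.
Proof.
  intros HK Heps HM.
  exists (M / (eps * K)). split; [apply Rdiv_le_0_compat; nra|]. intros s Hs.
  assert (Hs1 : M <= eps * (K * s)).
  { replace M with (eps * K * (M / (eps * K))) by (field; lra).
    rewrite <- Rmult_assoc. apply Rmult_le_compat_l; [nra|exact Hs]. }
  assert (Hexp : K * s <= exp (K * s)).
  { pose proof (exp_ineq1_le (K * s)). lra. }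
  assert (E : exp (- K * s) * exp (K * s) = 1).
  { rewrite <- exp_plus. replace (- K * s + K * s) with 0 by ring. apply exp_0. }
  pose proof (exp_pos (- K * s)).
  assert (M * exp (- K * s) <= eps * exp (K * s) * exp (- K * s)).
  { apply Rmult_le_compat_r; [lra|]. nra. }
  nra.
Qed.

Lemma robin_asymptotic_upper (d b gam K l c S eps : R) (f y yx : R -> R)
  (r v vx vt : R -> R -> R) :
  0 < d -> 0 <= gam -> 0 < K -> 0 < l -> 0 < eps ->
  robin_solution d b gam K l c f y yx ->
  (forall T, parabolic_robin d b gam l c S T r v vx vt) ->
  (forall x t, 0 < x < l -> x <> c -> S < t -> r x t + K * v x t <= f x + eps) ->
  exists S', S <= S' /\ forall t, S' <= t -> forall x, 0 <= x <= l ->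
    v x t <= y x + 2 * (eps / K).
Proof.
  intros Hd Hgam HK Hl Heps [Cy [Y0 [Yl Hy]]] Hv Hr.
  assert (HekK : K * (eps / K) = eps) by (field; lra).
  assert (Hek : 0 < eps / K) by (apply Rdiv_lt_0_compat; lra).
  destruct (Hv S) as [[Cv _] _].
  assert (HvS : cont_on (fun x => 0 <= x <= l) (fun x => v x S + -1 * y x)).
  { apply cont_on_plus.
    - apply (cont_on_subset _ (fun x => 0 <= x <= l /\ S <= S <= S)); [intros; lra|].
      exact (cont2_on_slice _ _ S Cv).
    - apply cont_on_mult; [apply cont_on_const|apply Cy]. }
  destruct (cont_on_bounded 0 l _ ltac:(lra) HvS) as [M [HM HvM]].
  pose (cc := fun t => eps / K + M * exp (- K * (t - S))).
  pose (cct := fun t => - K * (M * exp (- K * (t - S)))).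
  assert (Hcc : forall t, is_derive cc t (cct t)).
  { intros t. unfold cc, cct. auto_derive; [exact I|unfold Rminus; ring]. }
  assert (Hcct : forall t, continuity_pt cct t).
  { intros t. apply (is_derive_continuity_pt cct t (K * K * (M * exp (- K * (t - S))))).
    unfold cct. auto_derive; [exact I|unfold Rminus; ring]. }
  assert (Hcmp : forall t, S <= t -> forall x, 0 <= x <= l -> v x t <= y x + cc t).
  { intros T HT x Hx.
    pose proof (Hv T) as [Pv [Bv Ev]].
    pose proof (parabolic_minimum_principle 0 l S T c d b (- K)
      (fun x t => (y x * 1 + 1 * cc t) + -1 * v x t)
      (fun x t => (yx x * 1 + 0 * cc t) + -1 * vx x t)
      (fun x t => (y x * 0 + 1 * cct t) + -1 * vt x t)) as H. cbv beta in H.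
    enough (0 <= y x * 1 + 1 * cc T + -1 * v x T) by lra.
    apply H; auto; try lra.
    - apply (parabolic_field_plus 0 l S T (fun x t => y x * 1 + 1 * cc t)
        (fun x t => yx x * 1 + 0 * cc t) (fun x t => y x * 0 + 1 * cct t));
        [|apply parabolic_field_scal, Pv].
      apply (parabolic_field_plus 0 l S T (fun x t => y x * 1)
        (fun x t => yx x * 1) (fun x t => y x * 0)).
      + apply (parabolic_field_sep 0 l S T y yx (fun _ => 1) (fun _ => 0)); [exact Cy| |].
        * intros t. apply is_derive_const_R.
        * intros t. apply continuity_pt_const. intros ? ?; reflexivity.
      + apply (parabolic_field_sep 0 l S T (fun _ => 1) (fun _ => 0) cc cct);
          [apply C1on_const|exact Hcc|exact Hcct].
    - intros z Hz. specialize (HvM z Hz). apply Rabs_le_between in HvM.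
      unfold cc. rewrite Rminus_diag, Rmult_0_r, exp_0. lra.
    - intros t Ht Hneg. destruct (Bv t Ht) as [E1 E2]. rewrite Y0, E1.
      assert (0 < cc t).
      { unfold cc. pose proof (exp_pos (- K * (t - S))). nra. }
      nra.
    - intros t Ht Hneg. destruct (Bv t Ht) as [E1 E2]. rewrite Yl, E2. lra.
    - intros z t Hz Hzc Ht. destruct (Hy z Hz Hzc) as [yxx [Dy Ey]].
      destruct (Ev z t Hz Hzc Ht) as [vxx [Dv Evt]].
      exists ((yxx * 1 + 0 * cc t) + -1 * vxx). split.
      + apply (is_derive_plus (fun x => yx x * 1 + 0 * cc t) (fun x => -1 * vx x t));
          [|apply is_derive_scal, Dv].
        apply (is_derive_ext (fun x => 1 * yx x + 0)); [intros; simpl; ring|].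
        evar_last.
        * apply (is_derive_plus (fun x => 1 * yx x) (fun _ => 0)).
          -- apply is_derive_scal, Dy.
          -- apply is_derive_const_R.
        * unfold plus, zero; simpl. ring.
      + intros _. specialize (Hr z t Hz Hzc (proj1 Ht)). rewrite Evt.
        assert (K * cc t + cct t = eps) by (unfold cc, cct; lra).
        nra. }
  destruct (exp_decay_small M K (eps / K) HK Hek ltac:(lra)) as [s0 [Hs0 Hs]].
  exists (S + s0). split; [lra|]. intros t Ht x Hx.
  specialize (Hcmp t ltac:(lra) x Hx). specialize (Hs (t - S) ltac:(lra)).
  unfold cc in Hcmp. lra.
Qed.

Lemma robin_asymptotic_lower (d b gam K l c S eps : R) (f y yx : R -> R)
  (r v vx vt : R -> R -> R) :
  0 < d -> 0 <= gam -> 0 < K -> 0 < l -> 0 < eps ->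
  robin_solution d b gam K l c f y yx ->
  (forall T, parabolic_robin d b gam l c S T r v vx vt) ->
  (forall x t, 0 < x < l -> x <> c -> S < t -> f x - eps <= r x t + K * v x t) ->
  exists S', S <= S' /\ forall t, S' <= t -> forall x, 0 <= x <= l ->
    y x - 2 * (eps / K) <= v x t.
Proof.
  intros Hd Hgam HK Hl Heps Hy Hv Hr.
  destruct (robin_asymptotic_upper d b gam K l c S eps _ _ _ _ _ _ _ Hd Hgam HK Hl Heps
    (robin_solution_opp _ _ _ _ _ _ _ _ _ Hy)
    (fun T => parabolic_robin_opp _ _ _ _ _ _ _ _ _ _ _ (Hv T))) as [S' [HS H]].
  - intros x t Hx Hxc Ht. specialize (Hr x t Hx Hxc Ht). lra.
  - exists S'. split; [exact HS|]. intros t Ht x Hx. specialize (H t Ht x Hx). lra.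
Qed.

Lemma robin_solution_ext (d b gam K l c : R) (f g y yx : R -> R) :
  (forall x, 0 < x < l -> x <> c -> f x = g x) ->
  robin_solution d b gam K l c f y yx -> robin_solution d b gam K l c g y yx.
Proof.
  intros E [H1 [H2 [H3 H4]]]. refine (conj H1 (conj H2 (conj H3 _))).
  intros x Hx Hxc. destruct (H4 x Hx Hxc) as [l' [D Eq]].
  exists l'. split; [exact D|]. rewrite <- E; assumption.
Qed.

Lemma robin_sub_const (d b gam K l c k : R) (f : R -> R) :
  0 <= gam -> k <= 0 -> (forall x, 0 < x < l -> x <> c -> K * k <= f x) ->
  robin_sub d b gam K l c f (fun _ => k) (fun _ => 0).
Proof.
  intros Hgam Hk Hf. split; [apply C1on_const|]. split; [nra|]. split; [lra|].
  intros x Hx Hxc. exists 0. split.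
  - apply is_derive_const_R.
  - specialize (Hf x Hx Hxc). lra.
Qed.

Lemma robin_super_const (d b gam K l c k : R) (f : R -> R) :
  0 <= gam -> 0 <= k -> (forall x, 0 < x < l -> x <> c -> f x <= K * k) ->
  robin_super d b gam K l c f (fun _ => k) (fun _ => 0).
Proof.
  intros Hgam Hk Hf. split; [apply C1on_const|]. split; [nra|]. split; [lra|].
  intros x Hx Hxc. exists 0. split.
  - apply is_derive_const_R.
  - specialize (Hf x Hx Hxc). lra.
Qed.

Lemma robin_le (d b gam K l c : R) (f g y yx v vx : R -> R) :
  0 < d -> 0 <= gam -> 0 < K -> 0 < l ->
  robin_sub d b gam K l c f y yx -> robin_super d b gam K l c g v vx ->
  (forall x, 0 < x < l -> x <> c -> f x <= g x) ->
  forall x, 0 <= x <= l -> y x <= v x.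
Proof.
  intros Hd Hgam HK Hl Hy Hv Hfg x Hx.
  replace (v x) with (v x + 0 / K) by (field; lra).
  apply (robin_comparison d b gam K l c 0 f g y yx v vx); auto; [lra|].
  intros z Hz Hzc. specialize (Hfg z Hz Hzc). lra.
Qed.

Lemma robin_uniform_lipschitz (d b gam K l c M N : R) : 
  0 < d -> 0 < K -> 0 < l -> 0 <= M -> 0 <= N ->
  exists Lam, 0 <= Lam /\ forall f y yx,
    robin_solution d b gam K l c f y yx ->
    (forall x, 0 <= x <= l -> Rabs (y x) <= M) ->
    (forall x, 0 < x < l -> x <> c -> Rabs (f x) <= N) ->
    forall x z, 0 <= x <= l -> 0 <= z <= l -> Rabs (y x - y z) <= Lam * Rabs (x - z).
Proof.
  intros Hd HK Hl HM HN.
  exists (exp (Rabs (b / d) * l) * (exp (Rabs (b / d) * l) * ((K * M + N) / d) * l)).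
  assert (Hpos : 0 <= exp (Rabs (b / d) * l) * (exp (Rabs (b / d) * l) * ((K * M + N) / d) * l)).
  { pose proof (exp_pos (Rabs (b / d) * l)).
    assert (0 <= (K * M + N) / d) by (apply Rdiv_le_0_compat; nra).
    apply Rmult_le_pos; [lra|]. apply Rmult_le_pos; [apply Rmult_le_pos; lra|lra]. }
  split; [exact Hpos|]. intros f y yx Hs HyM HfN.
  assert (Hlt : forall x z, 0 <= x -> x <= z -> z <= l ->
    Rabs (y z - y x) <= exp (Rabs (b / d) * l) * (exp (Rabs (b / d) * l) * ((K * M + N) / d) * l) * (z - x)).
  { intros x z Hx Hxz Hz. destruct (Hs) as [[C1 [C2 C3]] _].
    apply lipschitz_of_derive; [exact Hxz| |].
    - restrict C1.
    - intros t Ht. exists (yx t). split; [apply C3; lra|].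
      apply (robin_gradient_bound d b gam K l c M N f y yx); auto; lra. }
  intros x z Hx Hz. destruct (Rle_dec x z) as [Hxz|Hxz].
  - rewrite Rabs_minus_sym, (Rabs_minus_sym x z), (Rabs_right (z - x)) by lra.
    apply Hlt; lra.
  - rewrite (Rabs_right (x - z)) by lra. apply Hlt; lra.
Qed.

Lemma lipschitz_cont_on (l Lam : R) (g : R -> R) :
  0 <= Lam ->
  (forall x y, 0 <= x <= l -> 0 <= y <= l -> Rabs (g x - g y) <= Lam * Rabs (x - y)) ->
  cont_on (fun x => 0 <= x <= l) g.
Proof.
  intros HLam Hg x Hx eps Heps. exists (eps / (Lam + 1)).
  split; [apply Rdiv_lt_0_compat; lra|]. intros y Hy Hyx.
  eapply Rle_lt_trans; [apply Hg; assumption|].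
  assert (E : (Lam + 1) * (eps / (Lam + 1)) = eps) by (field; lra).
  pose proof (Rabs_pos (y - x)). nra.
Qed.

Lemma unif_seq_shift (l : R) (f : nat -> R -> R) (g : R -> R) :
  unif_seq l (fun n => f (S n)) g -> unif_seq l f g.
Proof.
  intros H eps Heps. destruct (H eps Heps) as [N HN]. exists (S N). intros n Hn x Hx.
  destruct n as [|n]; [lia|]. apply HN; [lia|exact Hx].
Qed.

Lemma robin_solution_near (d b gam K l c eps : R) (f g y yx v vx : R -> R) :
  0 < d -> 0 <= gam -> 0 < K -> 0 < l -> 0 <= eps ->
  robin_solution d b gam K l c f y yx -> robin_solution d b gam K l c g v vx ->
  (forall x, 0 < x < l -> x <> c -> f x <= g x + eps /\ g x <= f x + eps) ->
  forall x, 0 <= x <= l -> Rabs (y x - v x) <= eps / K.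
Proof.
  intros Hd Hgam HK Hl Heps Hy Hv Hfg x Hx.
  assert (H1 : y x <= v x + eps / K).
  { apply (robin_comparison d b gam K l c eps f g y yx v vx);
      auto using robin_solution_sub, robin_solution_super. intros; apply Hfg; assumption. }
  assert (H2 : v x <= y x + eps / K).
  { apply (robin_comparison d b gam K l c eps g f v vx y yx);
      auto using robin_solution_sub, robin_solution_super. intros; apply Hfg; assumption. }
  apply Rabs_le. lra.
Qed.

Lemma Rle_of_eps (a C : R) : (forall eps, 0 < eps -> a <= C * eps) -> a <= 0.
Proof.
  intros H. apply Rnot_lt_le. intros Ha.
  pose proof (Rabs_pos C). pose proof (Rle_abs C).
  assert (Hpos : 0 < a / (2 * (Rabs C + 1))) by (apply Rdiv_lt_0_compat; lra).
  specialize (H _ Hpos).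
  assert (E : (Rabs C + 1) * (a / (2 * (Rabs C + 1))) = a / 2) by (field; lra).
  nra.
Qed.

Lemma unif_seq_bounds (l : R) (f : nat -> R -> R) (g : R -> R) (x a b : R) :
  unif_seq l f g -> 0 <= x <= l -> (forall n, a <= f n x <= b) -> a <= g x <= b.
Proof.
  intros Hu Hx Hf. split.
  - enough (a - g x <= 0) by lra. apply (Rle_of_eps _ 1). intros eps Heps.
    destruct (Hu eps Heps) as [N HN]. specialize (HN N (Nat.le_refl N) x Hx).
    specialize (Hf N). apply Rabs_le_between in HN. lra.
  - enough (g x - b <= 0) by lra. apply (Rle_of_eps _ 1). intros eps Heps.
    destruct (Hu eps Heps) as [N HN]. specialize (HN N (Nat.le_refl N) x Hx).
    specialize (Hf N). apply Rabs_le_between in HN. lra.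
Qed.

Definition ratio_flux (d b : R) (y yx v vx : R -> R) (x : R) : R :=
  (y x - v x) ^ 2 / (y x * v x) * (exp (b / d * x) * (d * (yx x * v x - vx x * y x))).

Lemma ratio_flux_cont_on (d b l : R) (y yx v vx : R -> R) :
  C1on 0 l y yx -> C1on 0 l v vx ->
  (forall x, 0 <= x <= l -> 0 < y x) -> (forall x, 0 <= x <= l -> 0 < v x) ->
  cont_on (fun x => 0 <= x <= l) (ratio_flux d b y yx v vx).
Proof.
  intros [Y1 [Y2 _]] [V1 [V2 _]] Py Pv. unfold ratio_flux.
  assert (Hdiff : cont_on (fun x => 0 <= x <= l) (fun x => y x + -1 * v x)).
  { apply cont_on_plus; [|apply cont_on_mult; [apply cont_on_const|]]; assumption. }
  apply cont_on_mult.
  - apply (cont_on_ext _ (fun x => (y x + -1 * v x) * (y x + -1 * v x) * / (y x * v x))).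
    + intros x _. unfold Rdiv. ring.
    + apply cont_on_mult; [apply cont_on_mult; assumption|].
      apply (cont_on_comp _ Rinv); [apply cont_on_mult; assumption|].
      intros x Hx. apply continuity_pt_filterlim.
      apply (ex_derive_continuous Rinv). specialize (Py x Hx). specialize (Pv x Hx).
      auto_derive. nra.
  - apply cont_on_mult.
    + apply (is_derive_cont_on _ _ (fun t => b / d * exp (b / d * t))). intros t.
      auto_derive; [exact I|ring].
    + apply cont_on_mult; [apply cont_on_const|].
      apply (cont_on_ext _ (fun x => yx x * v x + -1 * (vx x * y x))); [intros; ring|].
      apply cont_on_plus; [apply cont_on_mult; assumption|].
      apply cont_on_mult; [apply cont_on_const|apply cont_on_mult; assumption].
Qed.

(* The factor [(y - v)^2 / (y v)] is an increasing function of [y / v] for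
   [v <= y], so differentiating it contributes a nonnegative square. *)
Lemma ratio_flux_derive (d b x : R) (y yx v vx : R -> R) (yxx vxx : R) :
  0 < d -> 0 < v x -> v x <= y x ->
  is_derive y x (yx x) -> is_derive v x (vx x) ->
  is_derive yx x yxx -> is_derive vx x vxx ->
  exists l : R, is_derive (ratio_flux d b y yx v vx) x l /\
    (y x - v x) ^ 2 / (y x * v x) *
      (exp (b / d * x) * (v x * (d * yxx + b * yx x) - y x * (d * vxx + b * vx x))) <= l.
Proof.
  intros Hd Hv Hyv Dy Dv Dyx Dvx.
  set (D := yx x * v x - vx x * y x).
  exists (D * (/ v x ^ 2 - / y x ^ 2) * (exp (b / d * x) * (d * D))
    + (y x - v x) ^ 2 / (y x * v x) *
      (exp (b / d * x) * (v x * (d * yxx + b * yx x) - y x * (d * vxx + b * vx x)))).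
  split.
  - apply (is_derive_mult_R (fun x => (y x - v x) ^ 2 / (y x * v x))
      (fun x => exp (b / d * x) * (d * (yx x * v x - vx x * y x)))).
    + auto_derive.
      * repeat split; try (eexists; eassumption). nra.
      * replace (Derive (fun x0 => y x0) x) with (yx x)
          by (symmetry; apply is_derive_unique, Dy).
        replace (Derive (fun x0 => v x0) x) with (vx x)
          by (symmetry; apply is_derive_unique, Dv).
        unfold D. field. split; lra.
    + auto_derive.
      * repeat split; try (eexists; eassumption).
      * replace (Derive (fun x0 => y x0) x) with (yx x)
          by (symmetry; apply is_derive_unique, Dy).
        replace (Derive (fun x0 => v x0) x) with (vx x)
          by (symmetry; apply is_derive_unique, Dv).
        replace (Derive (fun x0 => yx x0) x) with yxx
          by (symmetry; apply is_derive_unique, Dyx).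
        replace (Derive (fun x0 => vx x0) x) with vxx
          by (symmetry; apply is_derive_unique, Dvx).
        field. lra.
  - enough (0 <= D * (/ v x ^ 2 - / y x ^ 2) * (exp (b / d * x) * (d * D))) by lra.
    replace (D * (/ v x ^ 2 - / y x ^ 2) * (exp (b / d * x) * (d * D)))
      with (D ^ 2 * ((/ v x ^ 2 - / y x ^ 2) * (exp (b / d * x) * d))) by ring.
    apply Rmult_le_pos; [apply pow2_ge_0|]. apply Rmult_le_pos.
    + assert (/ y x ^ 2 <= / v x ^ 2); [|lra].
      apply Rinv_le_contravar; [apply pow_lt; lra|]. apply pow_incr. lra.
    + apply Rmult_le_pos; [left; apply exp_pos|lra].
Qed.

Lemma cont_on_zero_extend (l c : R) (f : R -> R) :
  0 < l -> cont_on (fun x => 0 <= x <= l) f ->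
  (forall x, 0 < x < l -> x <> c -> f x = 0) -> forall x, 0 <= x <= l -> f x = 0.
Proof.
  intros Hl Hf H0 x Hx. destruct (Req_dec (f x) 0) as [E|Hne]; [exact E|exfalso].
  destruct (Hf x Hx (Rabs (f x)) (Rabs_pos_lt _ Hne)) as [del [Hdel H]].
  assert (Hy : exists y, 0 < y < l /\ y <> c /\ Rabs (y - x) < del).
  { assert (Hab : exists a b, 0 <= a < b /\ b <= l /\
       forall y, a < y < b -> Rabs (y - x) < del).
    { destruct (Rlt_dec x l) as [Hxl|Hxl].
      - exists x, (Rmin l (x + del)).
        repeat split; try (clear - Hx Hxl Hdel; minmax).
        intros y Hy. apply Rabs_def1; clear - Hx Hy Hdel; minmax.
      - exists (Rmax 0 (x - del)), x.
        repeat split; try (clear - Hl Hx Hxl Hdel; minmax).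
        intros y Hy. apply Rabs_def1; clear - Hx Hy Hdel; minmax. }
    destruct Hab as [a [b [Hab [Hb Hy]]]].
    destruct (Req_dec ((a + b) / 2) c) as [Ec|Ec].
    - exists ((2 * a + b) / 3). repeat split; try lra. apply Hy; lra.
    - exists ((a + b) / 2). repeat split; try lra. apply Hy; lra. }
  destruct Hy as [y [Hy [Hyc Hyx]]].
  specialize (H y ltac:(lra) Hyx). rewrite (H0 y Hy Hyc), Rminus_0_l, Rabs_Ropp in H. lra.
Qed.

Lemma const_of_nondecreasing (f : R -> R) (a b : R) :
  a < b -> cont_on (fun x => a <= x <= b) f ->
  (forall x, a < x < b -> exists l : R, is_derive f x l /\ 0 <= l) -> f b <= f a ->
  forall x l, a < x < b -> is_derive f x l -> l = 0.
Proof.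
  intros Hab Hc Hd Hba x l Hx Hl.
  assert (Hconst : forall y, a < y < b -> f y = f a).
  { intros y Hy.
    assert (f a <= f y).
    { apply nondecreasing_of_derive; [lra| |intros; apply Hd; lra].
      restrict Hc. }
    assert (f y <= f b).
    { apply nondecreasing_of_derive; [lra| |intros; apply Hd; lra].
      restrict Hc. }
    lra. }
  apply (is_derive_eq f x); [exact Hl|].
  apply (is_derive_ext_loc (fun _ => f a)).
  - apply (filter_imp (fun y => a < y < b)); [|apply locally_open_interval, Hx].
    intros y Hy. symmetry. apply Hconst, Hy.
  - apply is_derive_const_R.
Qed.

Lemma parabolic_field_restrict (A B A' B' S T : R) (z zx zt : R -> R -> R) :
  A <= A' -> B' <= B -> parabolic_field A B S T z zx zt ->
  parabolic_field A' B' S T z zx zt.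
Proof.
  intros HA HB [Z1 [Z2 [Z3 Z4]]]. split; [|split; [|split]].
  - restrict Z1.
  - restrict Z2.
  - restrict Z3.
  - intros x t Hx Ht. apply Z4; lra.
Qed.

Definition glue (c : R) (f g : R -> R) (x : R) : R :=
  f (Rmin x c) + (g (Rmax x c) - g c).

Lemma glue_left (c : R) (f g : R -> R) (x : R) : x <= c -> glue c f g x = f x.
Proof. intros Hx. unfold glue. rewrite Rmin_left, Rmax_right by exact Hx. ring. Qed.

Lemma glue_right (c : R) (f g : R -> R) (x : R) : f c = g c -> c <= x -> glue c f g x = g x.
Proof.
  intros E Hx. unfold glue. rewrite Rmin_right, Rmax_left by exact Hx. rewrite E. ring.
Qed.

Lemma Rmax_continuous (c x : R) : continuous (fun y => Rmax y c) x.
Proof.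
  apply continuity_pt_filterlim. intros eps Heps. exists eps; split; [exact Heps|].
  intros y [_ Hy]. simpl in *. unfold Rdist in *.
  eapply Rle_lt_trans; [|exact Hy].
  unfold Rmax. destruct (Rle_dec y c); destruct (Rle_dec x c);
    unfold Rabs; repeat destruct (Rcase_abs _); lra.
Qed.

Lemma glue_continuous (c : R) (f g : R -> R) :
  (forall x, continuous f x) -> (forall x, continuous g x) ->
  forall x, continuous (glue c f g) x.
Proof.
  intros Hf Hg x. unfold glue.
  apply (continuous_plus (fun x => f (Rmin x c)) (fun x => g (Rmax x c) - g c)).
  - apply (continuous_comp (fun x => Rmin x c) f); [apply Rmin_continuous|apply Hf].
  - apply (continuous_minus (fun x => g (Rmax x c)) (fun _ => g c)); [|apply continuous_const].
    apply (continuous_comp (fun x => Rmax x c) g); [apply Rmax_continuous|apply Hg].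
Qed.

Lemma glue_derive_left (c x l : R) (f g : R -> R) :
  x < c -> is_derive f x l -> is_derive (glue c f g) x l.
Proof.
  intros Hx D. apply (is_derive_ext_loc f); [|exact D].
  apply (filter_imp (fun y => x - 1 < y < c)); [|apply locally_open_interval; lra].
  intros y Hy. rewrite glue_left by lra. reflexivity.
Qed.

Lemma glue_derive_right (c x l : R) (f g : R -> R) :
  f c = g c -> c < x -> is_derive g x l -> is_derive (glue c f g) x l.
Proof.
  intros E Hx D. apply (is_derive_ext_loc g); [|exact D].
  apply (filter_imp (fun y => c < y < x + 1)); [|apply locally_open_interval; lra].
  intros y Hy. rewrite glue_right by (exact E || lra). reflexivity.
Qed.

Lemma glue_derive (c : R) (f fx g gx : R -> R) :
  (forall x, is_derive f x (fx x)) -> (forall x, is_derive g x (gx x)) ->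
  (forall x, continuous fx x) -> (forall x, continuous gx x) ->
  f c = g c -> fx c = gx c ->
  forall x, is_derive (glue c f g) x (glue c fx gx x).
Proof.
  intros Df Dg Cf Cg E Ex x.
  assert (Cfg : forall y, continuous (glue c f g) y).
  { apply glue_continuous; intros y.
    - apply (ex_derive_continuous f). exists (fx y). apply Df.
    - apply (ex_derive_continuous g). exists (gx y). apply Dg. }
  assert (Hne : forall y, y <> c -> is_derive (glue c f g) y (glue c fx gx y)).
  { intros y Hy. destruct (Rdichotomy _ _ Hy) as [Hlt|Hgt].
    - rewrite glue_left by lra. apply glue_derive_left; [exact Hlt|apply Df].
    - rewrite glue_right by (exact Ex || lra).
      apply glue_derive_right; [exact E|lra|apply Dg]. }
  destruct (Req_dec x c) as [->|Hx]; [|apply Hne, Hx].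
  apply (is_derive_removable _ _ c (c - 1) (c + 1)); [lra| | |].
  - intros y _. apply continuity_pt_filterlim, Cfg.
  - intros y _ Hy. apply Hne, Hy.
  - apply continuity_pt_filterlim, glue_continuous; assumption.
Qed.

Lemma sin_atan_cos (t : R) : sin (atan t) = t * cos (atan t).
Proof.
  assert (0 < cos (atan t)).
  { pose proof (atan_bound t). apply cos_gt_0; lra. }
  rewrite <- (tan_atan t) at 2. unfold tan. field. lra.
Qed.

(** * The monotone iteration *)

Section Model.

Variables d1 d2 r m p q h L a1 a2 x2 : R.
Hypotheses (Hd1 : 0 < d1) (Hd2 : 0 < d2) (Hr : 0 < r) (Hm : 0 < m) (Hp : 0 < p)
  (Hq : 0 < q) (Hh : 0 < h) (HL : 0 < L) (Ha1 : 0 < a1) (Ha2 : 0 <= a2)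
  (Hx2 : 0 < x2 <= L).

(* The substitution [w = ee * om] turns the zero-flux conditions for [w] into
   Neumann conditions for [om], and the drift [- a2] into [+ a2]. *)
Definition ee (x : R) : R := exp (a2 / d2 * x).
Definition src (x : R) : R := h * exp (- (a2 / d2) * x).
Definition ee_max : R := ee x2.
Definition om_max : R := h / q.

Definition Ombar : R -> R := robin_y d2 a2 0 q x2 x2 src (fun _ => 0).
Definition Ombarx : R -> R := robin_yx d2 a2 0 q x2 x2 src (fun _ => 0).

Definition KK : R := 2 * (r + 1) + m * ee_max * (om_max + 1) + q + p * (r + 1).

Definition Fu (x u om : R) : R := u * (KK + r - u - m * chi x2 x * ee x * om).
Definition Gw (x u om : R) : R := src x + (KK - q - p * u) * om.

Definition stepu (u om : R -> R) : R -> R :=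
  robin_y d1 (- a1) (a1 / d1) KK L x2 (fun x => u x * (KK + r - u x))
    (fun x => - m * u x * ee x * om x).
Definition stepux (u om : R -> R) : R -> R :=
  robin_yx d1 (- a1) (a1 / d1) KK L x2 (fun x => u x * (KK + r - u x))
    (fun x => - m * u x * ee x * om x).
Definition stepw (u om : R -> R) : R -> R :=
  robin_y d2 a2 0 KK x2 x2 (fun x => Gw x (u x) (om x)) (fun _ => 0).
Definition stepwx (u om : R -> R) : R -> R :=
  robin_yx d2 a2 0 KK x2 x2 (fun x => Gw x (u x) (om x)) (fun _ => 0).

Definition lipF : R := KK + r + m * ee_max * (r + 1) + p * (om_max + 1).

Lemma ee_pos (x : R) : 0 < ee x.
Proof. apply exp_pos. Qed.

Lemma drift_ratio_nonneg : 0 <= a2 / d2.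
Proof. apply Rdiv_le_0_compat; lra. Qed.

Lemma ee_ge1 (x : R) : 0 <= x -> 1 <= ee x.
Proof.
  intros Hx. unfold ee. rewrite <- exp_0. pose proof drift_ratio_nonneg.
  apply exp_le_compat. nra.
Qed.

Lemma ee_le_max (x : R) : x <= x2 -> ee x <= ee_max.
Proof.
  intros Hx. unfold ee_max, ee. pose proof drift_ratio_nonneg. apply exp_le_compat. nra.
Qed.

Lemma src_ee (x : R) : src x * ee x = h.
Proof.
  unfold src, ee. rewrite Rmult_assoc, <- exp_plus.
  replace (- (a2 / d2) * x + a2 / d2 * x) with 0 by ring. rewrite exp_0. ring.
Qed.

Lemma src_pos (x : R) : 0 < src x.
Proof. apply Rmult_lt_0_compat; [exact Hh|apply exp_pos]. Qed.

Lemma src_le (x : R) : 0 <= x -> src x <= h.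
Proof.
  intros Hx. pose proof (src_ee x). pose proof (ee_ge1 x Hx). pose proof (src_pos x). nra.
Qed.

Lemma src_continuous (x : R) : continuous src x.
Proof.
  apply (ex_derive_continuous src). unfold src. auto_derive. exact I.
Qed.

Lemma ee_derive (x : R) : is_derive ee x (a2 / d2 * ee x).
Proof. unfold ee. auto_derive; [exact I|ring]. Qed.

Lemma ee_continuous (x : R) : continuous ee x.
Proof. apply (ex_derive_continuous ee). eexists. apply ee_derive. Qed.

Lemma om_max_pos : 0 < om_max.
Proof. apply Rdiv_lt_0_compat; lra. Qed.

Lemma KK_pos : 0 < KK.
Proof.
  unfold KK. pose proof om_max_pos. pose proof (ee_pos x2). fold ee_max in *.
  assert (0 < m * ee_max * (om_max + 1)).
  { apply Rmult_lt_0_compat; [apply Rmult_lt_0_compat; lra|lra]. }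
  nra.
Qed.

Lemma lipF_pos : 0 < lipF.
Proof.
  unfold lipF. pose proof KK_pos. pose proof om_max_pos. pose proof (ee_pos x2).
  fold ee_max in *.
  assert (0 < m * ee_max * (r + 1)).
  { apply Rmult_lt_0_compat; [apply Rmult_lt_0_compat; lra|lra]. }
  nra.
Qed.

Lemma competition_bounds (x : R) : 0 <= m * chi x2 x * ee x <= m * ee_max.
Proof.
  pose proof (ee_pos x). unfold chi. destruct (Rlt_dec x x2).
  - pose proof (ee_le_max x ltac:(lra)). nra.
  - pose proof (ee_pos x2). fold ee_max in *. nra.
Qed.

(* With [eps = 0] this is the monotonicity of [Fu] in the competitive order. *)
Lemma Fu_compare (x u om v th eps : R) :
  0 <= u <= r + 1 -> 0 <= v <= r + 1 -> 0 <= eps -> u <= v + eps ->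
  (x < x2 -> 0 <= th <= om_max + 1 /\ th - eps <= om) ->
  Fu x u om <= Fu x v th + lipF * eps.
Proof.
  intros Hu Hv Heps Huv Hw. unfold Fu, lipF.
  pose proof (competition_bounds x) as Hc. pose proof om_max_pos as Hom.
  assert (Hcw : 0 <= m * chi x2 x * ee x * (om - (th - eps)) /\
    0 <= m * chi x2 x * ee x * th <= m * ee_max * (om_max + 1)).
  { destruct (Rlt_dec x x2) as [Hx|Hx].
    - destruct (Hw Hx). split; [apply Rmult_le_pos; lra|].
      split; [apply Rmult_le_pos; lra|apply Rmult_le_compat; lra].
    - rewrite chi_ge in * by lra. replace (m * 0 * ee x * th) with 0 by ring.
      split; [lra|]. split; [lra|apply Rmult_le_pos; lra]. }
  destruct Hcw as [Hcw Hct].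
  set (c := m * chi x2 x * ee x) in *.
  assert (HA : 0 <= KK + r - u - v - c * th <= KK + r) by (unfold KK; nra).
  assert (HB : 0 <= (KK + r - u - v - c * th) * (v + eps - u)) by (apply Rmult_le_pos; lra).
  assert (HC : 0 <= eps * (KK + r - (KK + r - u - v - c * th))) by (apply Rmult_le_pos; lra).
  assert (HD : 0 <= u * (c * (om - (th - eps)))) by (apply Rmult_le_pos; lra).
  assert (HE : u * c * eps <= m * ee_max * (r + 1) * eps).
  { apply Rmult_le_compat_r; [lra|]. rewrite (Rmult_comm u).
    apply Rmult_le_compat; lra. }
  assert (HF : 0 <= p * (om_max + 1) * eps).
  { pose proof om_max_pos. apply Rmult_le_pos; [apply Rmult_le_pos; lra|lra]. }
  nra.
Qed.

Lemma Gw_compare (x u om v th eps : R) :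
  0 <= u <= r + 1 -> 0 <= v <= r + 1 -> 0 <= om <= om_max + 1 -> 0 <= th ->
  0 <= eps -> v - eps <= u -> om <= th + eps ->
  Gw x u om <= Gw x v th + lipF * eps.
Proof.
  intros Hu Hv Hom Hth Heps Huv Hw. unfold Gw, lipF.
  pose proof (ee_pos x2). fold ee_max in *. pose proof om_max_pos.
  assert (HA : 0 <= KK - q - p * v <= KK).
  { assert (p * v <= p * (r + 1)) by (apply Rmult_le_compat_l; lra).
    assert (0 <= p * v) by (apply Rmult_le_pos; lra).
    assert (0 <= m * ee_max * (om_max + 1)).
    { apply Rmult_le_pos; [apply Rmult_le_pos; lra|lra]. }
    unfold KK. lra. }
  assert (HB : 0 <= (KK - q - p * v) * (th + eps - om)) by (apply Rmult_le_pos; lra).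
  assert (HC : 0 <= eps * (KK - (KK - q - p * v))) by (apply Rmult_le_pos; lra).
  assert (HD : 0 <= p * om * (u - (v - eps))).
  { apply Rmult_le_pos; [apply Rmult_le_pos; lra|lra]. }
  assert (HE : p * om * eps <= p * (om_max + 1) * eps).
  { apply Rmult_le_compat_r; [lra|]. apply Rmult_le_compat_l; lra. }
  assert (HF : 0 <= m * ee_max * (r + 1) * eps).
  { apply Rmult_le_pos; [|lra]. apply Rmult_le_pos; [apply Rmult_le_pos; lra|lra]. }
  assert (HG : 0 <= r * eps) by (apply Rmult_le_pos; lra).
  nra.
Qed.

Definition robin_solution_u (y yx f : R -> R) : Prop :=
  robin_solution d1 (- a1) (a1 / d1) KK L x2 f y yx.
Definition robin_solution_w (y yx f : R -> R) : Prop :=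
  robin_solution d2 a2 0 KK x2 x2 f y yx.

Lemma robin_coef_nonneg : 0 <= a1 / d1.
Proof. apply Rdiv_le_0_compat; lra. Qed.

Lemma stepu_solution (u om : R -> R) :
  (forall x, continuous u x) -> (forall x, continuous om x) ->
  (forall x, continuous (stepu u om) x) /\
  robin_solution_u (stepu u om) (stepux u om) (fun x => Fu x (u x) (om x)).
Proof.
  intros Hu Hom.
  assert (H1 : forall x, continuous (fun x => u x * (KK + r - u x)) x).
  { intros x. apply (continuous_mult u (fun x => KK + r - u x)); [apply Hu|].
    apply (continuous_minus (fun _ => KK + r) u); [apply continuous_const|apply Hu]. }
  assert (H2 : forall x, continuous (fun x => - m * u x * ee x * om x) x).
  { intros x. apply (continuous_mult (fun x => - m * u x * ee x) om); [|apply Hom].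
    apply (continuous_mult (fun x => - m * u x) ee); [|apply ee_continuous].
    apply (continuous_mult (fun _ => - m) u); [apply continuous_const|apply Hu]. }
  split.
  - intros x. apply robin_y_continuous; assumption.
  - eapply robin_solution_ext; [|apply robin_y_solution; auto using robin_coef_nonneg, KK_pos; lra].
    intros x _ _. unfold Fu. ring.
Qed.

Lemma stepw_solution (u om : R -> R) :
  (forall x, continuous u x) -> (forall x, continuous om x) ->
  (forall x, continuous (stepw u om) x) /\
  robin_solution_w (stepw u om) (stepwx u om) (fun x => Gw x (u x) (om x)).
Proof.
  intros Hu Hom.
  assert (H1 : forall x, continuous (fun x => Gw x (u x) (om x)) x).
  { intros x. unfold Gw.
    apply (continuous_plus src (fun x => (KK - q - p * u x) * om x));
      [apply src_continuous|].
    apply (continuous_mult (fun x => KK - q - p * u x) om); [|apply Hom].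
    apply (continuous_minus (fun _ => KK - q) (fun x => p * u x));
      [apply continuous_const|].
    apply (continuous_mult (fun _ => p) u); [apply continuous_const|apply Hu]. }
  assert (H2 : forall x : R, continuous (fun _ : R => 0) x)
    by (intros; apply continuous_const).
  split.
  - intros x. apply robin_y_continuous; assumption.
  - eapply robin_solution_ext; [|apply robin_y_solution; auto using KK_pos; lra].
    intros x _ _. simpl. ring.
Qed.

Lemma Ombar_continuous (x : R) : continuous Ombar x.
Proof.
  apply robin_y_continuous; [apply src_continuous|intros; apply continuous_const].
Qed.

Lemma Ombar_solution : robin_solution d2 a2 0 q x2 x2 src Ombar Ombarx.
Proof.
  eapply robin_solution_ext; [|apply robin_y_solution; auto; try lra].
  - intros x _ _. simpl. ring.
  - apply src_continuous.
  - intros; apply continuous_const.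
Qed.

Lemma Ombar_bounds (x : R) : 0 <= x <= x2 -> 0 <= Ombar x <= om_max.
Proof.
  intros Hx. split.
  - apply (robin_le d2 a2 0 q x2 x2 (fun _ => 0) src (fun _ => 0) (fun _ => 0) Ombar Ombarx);
      auto; try lra.
    + apply robin_sub_const; [lra|lra|intros; lra].
    + apply robin_solution_super, Ombar_solution.
    + intros z _ _. left. apply src_pos.
  - apply (robin_le d2 a2 0 q x2 x2 src (fun _ => h) Ombar Ombarx (fun _ => om_max) (fun _ => 0));
      auto; try lra.
    + apply robin_solution_sub, Ombar_solution.
    + apply robin_super_const; [lra|left; apply om_max_pos|].
      intros. unfold om_max. right. field. lra.
    + intros z Hz _. apply src_le. lra.
Qed.

Lemma Ombar_solution_KK :
  robin_solution_w Ombar Ombarx (fun x => Gw x 0 (Ombar x)).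
Proof.
  destruct Ombar_solution as [H1 [H2 [H3 H4]]]. refine (conj H1 (conj H2 (conj H3 _))).
  intros x Hx Hxc. destruct (H4 x Hx Hxc) as [l' [D Eq]].
  exists l'. split; [exact D|]. unfold Gw. lra.
Qed.

Definition cts2 (u om : R -> R) : Prop :=
  (forall x, continuous u x) /\ (forall x, continuous om x).

Definition box (u om : R -> R) : Prop :=
  (forall x, 0 <= x <= L -> 0 <= u x <= r) /\
  (forall x, 0 <= x <= x2 -> 0 <= om x <= Ombar x).

Definition cle (u om v th : R -> R) : Prop :=
  (forall x, 0 <= x <= L -> u x <= v x) /\ (forall x, 0 <= x <= x2 -> th x <= om x).

Lemma step_cts2 (u om : R -> R) : cts2 u om -> cts2 (stepu u om) (stepw u om).
Proof.
  intros [Hu Hom]. split; [apply stepu_solution|apply stepw_solution]; assumption.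
Qed.

Lemma Fu_outside (x u om v : R) : x2 <= x -> Fu x u om = Fu x u v.
Proof. intros Hx. unfold Fu. rewrite chi_ge by exact Hx. ring. Qed.

Lemma Fu_mono (x u om v th : R) :
  0 <= u <= r -> 0 <= v <= r ->
  (x < x2 -> 0 <= th <= om /\ om <= om_max) -> u <= v ->
  Fu x u om <= Fu x v th.
Proof.
  intros Hu Hv Hw Huv.
  assert (Fu x u om <= Fu x v th + lipF * 0); [|lra].
  apply Fu_compare; lra.
Qed.

Lemma Gw_mono (x u om v th : R) :
  0 <= u <= r -> 0 <= v <= r -> 0 <= om <= th -> th <= om_max -> v <= u ->
  Gw x u om <= Gw x v th.
Proof.
  intros Hu Hv Hom Hth Huv. pose proof om_max_pos.
  pose proof (Gw_compare x u om v th 0). lra.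
Qed.

Lemma step_box (u om : R -> R) :
  cts2 u om -> box u om -> box (stepu u om) (stepw u om).
Proof.
  intros [Hu Hom] [Bu Bom].
  destruct (stepu_solution u om Hu Hom) as [_ Su].
  destruct (stepw_solution u om Hu Hom) as [_ Sw].
  pose proof robin_coef_nonneg. pose proof KK_pos. pose proof om_max_pos.
  split; intros x Hx; split.
  - apply (robin_le d1 (- a1) (a1 / d1) KK L x2 (fun _ => 0) (fun x => Fu x (u x) (om x))
      (fun _ => 0) (fun _ => 0) (stepu u om) (stepux u om)); auto; try lra.
    + apply robin_sub_const; [lra|lra|intros; lra].
    + apply robin_solution_super, Su.
    + intros z Hz _. replace 0 with (Fu z 0 (om z)) by (unfold Fu; ring).
      apply Fu_mono; [lra|apply Bu; lra| |apply Bu; lra].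
      intros Hzx. specialize (Bom z ltac:(lra)). pose proof (Ombar_bounds z ltac:(lra)). lra.
  - apply (robin_le d1 (- a1) (a1 / d1) KK L x2 (fun x => Fu x (u x) (om x))
      (fun x => KK * r) (stepu u om) (stepux u om) (fun _ => r) (fun _ => 0)); auto; try lra.
    + apply robin_solution_sub, Su.
    + apply robin_super_const; [lra|lra|intros; lra].
    + intros z Hz _. replace (KK * r) with (Fu z r 0) by (unfold Fu; ring).
      apply Fu_mono; [apply Bu; lra|lra| |apply Bu; lra].
      intros Hzx. specialize (Bom z ltac:(lra)). pose proof (Ombar_bounds z ltac:(lra)). lra.
  - apply (robin_le d2 a2 0 KK x2 x2 (fun _ => 0) (fun x => Gw x (u x) (om x))
      (fun _ => 0) (fun _ => 0) (stepw u om) (stepwx u om)); auto; try lra.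
    + apply robin_sub_const; [lra|lra|intros; lra].
    + apply robin_solution_super, Sw.
    + intros z Hz _. specialize (Bom z ltac:(lra)). specialize (Bu z ltac:(lra)).
      pose proof (Ombar_bounds z ltac:(lra)).
      apply Rle_trans with (Gw z (u z) 0).
      * unfold Gw. pose proof (src_pos z). lra.
      * apply Gw_mono; lra.
  - apply (robin_le d2 a2 0 KK x2 x2 (fun x => Gw x (u x) (om x))
      (fun x => Gw x 0 (Ombar x)) (stepw u om) (stepwx u om) Ombar Ombarx); auto; try lra.
    + apply robin_solution_sub, Sw.
    + apply robin_solution_super, Ombar_solution_KK.
    + intros z Hz _. specialize (Bom z ltac:(lra)). specialize (Bu z ltac:(lra)).
      pose proof (Ombar_bounds z ltac:(lra)). apply Gw_mono; lra.
Qed.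

Lemma step_mono (u om v th : R -> R) :
  cts2 u om -> cts2 v th -> box u om -> box v th -> cle u om v th ->
  cle (stepu u om) (stepw u om) (stepu v th) (stepw v th).
Proof.
  intros [Hu Hom] [Hv Hth] [Bu Bom] [Bv Bth] [Huv Hw].
  destruct (stepu_solution u om Hu Hom) as [_ Su].
  destruct (stepw_solution u om Hu Hom) as [_ Sw].
  destruct (stepu_solution v th Hv Hth) as [_ Sv].
  destruct (stepw_solution v th Hv Hth) as [_ St].
  pose proof robin_coef_nonneg. pose proof KK_pos. pose proof om_max_pos.
  split; intros x Hx.
  - eapply (robin_le d1 (- a1) (a1 / d1) KK L x2); eauto; try lra.
    + apply robin_solution_sub, Su.
    + apply robin_solution_super, Sv.
    + intros z Hz _. apply Fu_mono; [apply Bu; lra|apply Bv; lra| |apply Huv; lra].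
      intros Hzx. specialize (Bom z ltac:(lra)). specialize (Bth z ltac:(lra)).
      specialize (Hw z ltac:(lra)). pose proof (Ombar_bounds z ltac:(lra)). lra.
  - eapply (robin_le d2 a2 0 KK x2 x2); eauto; try lra.
    + apply robin_solution_sub, St.
    + apply robin_solution_super, Sw.
    + intros z Hz _. specialize (Bom z ltac:(lra)). specialize (Bth z ltac:(lra)).
      specialize (Bu z ltac:(lra)). specialize (Bv z ltac:(lra)).
      specialize (Hw z ltac:(lra)). specialize (Huv z ltac:(lra)).
      pose proof (Ombar_bounds z ltac:(lra)). apply Gw_mono; lra.
Qed.

Fixpoint iter_state (u om : R -> R) (n : nat) : (R -> R) * (R -> R) :=
  match n with
  | O => (u, om)
  | S k => let s := iter_state u om k in (stepu (fst s) (snd s), stepw (fst s) (snd s))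
  end.

Definition iu (u om : R -> R) (n : nat) : R -> R := fst (iter_state u om n).
Definition iw (u om : R -> R) (n : nat) : R -> R := snd (iter_state u om n).

Lemma iter_invariant (u om : R -> R) (n : nat) :
  cts2 u om -> box u om ->
  cts2 (iu u om n) (iw u om n) /\ box (iu u om n) (iw u om n).
Proof.
  intros Hc Hb. induction n as [|n [IH1 IH2]]; [split; assumption|].
  split; [apply (step_cts2 (iu u om n) (iw u om n))|
          apply (step_box (iu u om n) (iw u om n))]; assumption.
Qed.

Lemma iter_cle (u om v th : R -> R) (n : nat) :
  cts2 u om -> cts2 v th -> box u om -> box v th -> cle u om v th ->
  cle (iu u om n) (iw u om n) (iu v th n) (iw v th n).
Proof.
  intros Hc Hc' Hb Hb' Hle. induction n as [|n IH]; [exact Hle|].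
  destruct (iter_invariant u om n Hc Hb), (iter_invariant v th n Hc' Hb').
  apply (step_mono (iu u om n) (iw u om n) (iu v th n) (iw v th n)); assumption.
Qed.

Lemma iter_increasing (u om : R -> R) (n : nat) :
  cts2 u om -> box u om -> cle u om (stepu u om) (stepw u om) ->
  cle (iu u om n) (iw u om n) (iu u om (S n)) (iw u om (S n)).
Proof.
  intros Hc Hb Hle. induction n as [|n IH]; [exact Hle|].
  destruct (iter_invariant u om n Hc Hb), (iter_invariant u om (S n) Hc Hb).
  apply (step_mono (iu u om n) (iw u om n) (iu u om (S n)) (iw u om (S n))); assumption.
Qed.

Lemma iter_decreasing (u om : R -> R) (n : nat) :
  cts2 u om -> box u om -> cle (stepu u om) (stepw u om) u om ->
  cle (iu u om (S n)) (iw u om (S n)) (iu u om n) (iw u om n).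
Proof.
  intros Hc Hb Hle. induction n as [|n IH]; [exact Hle|].
  destruct (iter_invariant u om n Hc Hb), (iter_invariant u om (S n) Hc Hb).
  apply (step_mono (iu u om (S n)) (iw u om (S n)) (iu u om n) (iw u om n)); assumption.
Qed.

Lemma Fu_bound (u om x : R) :
  0 <= u <= r -> (x < x2 -> 0 <= om <= om_max) -> Rabs (Fu x u om) <= KK * r.
Proof.
  intros Hu Hom. pose proof KK_pos. pose proof om_max_pos.
  assert (H1 : Fu x u om <= Fu x r 0) by (apply Fu_mono; [lra|lra| |lra]; intros Hx; specialize (Hom Hx); lra).
  assert (H2 : Fu x 0 om <= Fu x u om) by (apply Fu_mono; [lra|lra| |lra]; intros Hx; specialize (Hom Hx); lra).
  unfold Fu in H1 at 2. unfold Fu in H2 at 1. apply Rabs_le. nra.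
Qed.

Lemma Gw_bound (u om x : R) :
  0 <= x -> 0 <= u <= r -> 0 <= om <= om_max -> Rabs (Gw x u om) <= h + KK * om_max.
Proof.
  intros Hx Hu Hom. pose proof KK_pos. pose proof om_max_pos.
  assert (H1 : Gw x u om <= Gw x 0 om_max) by (apply Gw_mono; lra).
  assert (H2 : Gw x u 0 <= Gw x u om) by (apply Gw_mono; lra).
  unfold Gw in H1 at 2. unfold Gw in H2 at 1. pose proof (src_le x Hx).
  pose proof (src_pos x). apply Rabs_le. nra.
Qed.

Lemma box_bounds_w (u om : R -> R) (x : R) :
  box u om -> 0 <= x <= x2 -> 0 <= om x <= om_max.
Proof.
  intros [_ B] Hx. specialize (B x Hx). pose proof (Ombar_bounds x Hx). lra.
Qed.

Definition coexistence_pair (U Ux Om Omx : R -> R) : Prop :=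
  robin_solution_u U Ux (fun x => Fu x (U x) (Om x)) /\
  robin_solution_w Om Omx (fun x => Gw x (U x) (Om x)) /\ box U Om.

Lemma iter_limit (u om : R -> R) :
  cts2 u om -> box u om ->
  (forall x, 0 <= x <= L -> ex_finite_lim_seq (fun n => iu u om n x)) ->
  (forall x, 0 <= x <= x2 -> ex_finite_lim_seq (fun n => iw u om n x)) ->
  exists U Ux Om Omx, unif_seq L (iu u om) U /\ unif_seq x2 (iw u om) Om /\
    coexistence_pair U Ux Om Omx.
Proof.
  intros Hc Hb Lu Lw.
  pose proof robin_coef_nonneg as Hgam. pose proof KK_pos as HK. pose proof om_max_pos as Hom.
  pose proof lipF_pos as HlF.
  pose (ul := fun x => real (Lim_seq (fun n => iu u om n x))).
  pose (wl := fun x => real (Lim_seq (fun n => iw u om n x))).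
  assert (Hul : forall x, 0 <= x <= L -> is_lim_seq (fun n => iu u om (S n) x) (ul x)).
  { intros x Hx. apply (is_lim_seq_incr_1 (fun n => iu u om n x)).
    apply Lim_seq_correct', Lu, Hx. }
  assert (Hwl : forall x, 0 <= x <= x2 -> is_lim_seq (fun n => iw u om (S n) x) (wl x)).
  { intros x Hx. apply (is_lim_seq_incr_1 (fun n => iw u om n x)).
    apply Lim_seq_correct', Lw, Hx. }
  assert (Hinv : forall n, cts2 (iu u om n) (iw u om n) /\ box (iu u om n) (iw u om n))
    by (intros n; apply iter_invariant; assumption).
  assert (Su : forall n, robin_solution_u (iu u om (S n))
     (stepux (iu u om n) (iw u om n)) (fun x => Fu x (iu u om n x) (iw u om n x))).
  { intros n. destruct (Hinv n) as [[C1 C2] _]. apply stepu_solution; assumption. }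
  assert (Sw : forall n, robin_solution_w (iw u om (S n))
     (stepwx (iu u om n) (iw u om n)) (fun x => Gw x (iu u om n x) (iw u om n x))).
  { intros n. destruct (Hinv n) as [[C1 C2] _]. apply stepw_solution; assumption. }
  destruct (robin_uniform_lipschitz d1 (- a1) (a1 / d1) KK L x2 r (KK * r))
    as [Lam1 [HLam1 Hlip1]]; try lra; [nra|].
  destruct (robin_uniform_lipschitz d2 a2 0 KK x2 x2 om_max (h + KK * om_max))
    as [Lam2 [HLam2 Hlip2]]; try lra; [nra|].
  destruct (lipschitz_pointwise_uniform L Lam1 (fun n => iu u om (S n)) ul HL HLam1)
    as [Lipu Uu]; [| exact Hul|].
  { intros n. apply (Hlip1 _ _ _ (Su n)).
    - intros x Hx. destruct (Hinv (S n)) as [_ [B _]]. specialize (B x Hx).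
      apply Rabs_le. lra.
    - intros x Hx _. destruct (Hinv n) as [_ B]. apply Fu_bound; [apply B; lra|].
      intros Hxx. apply (box_bounds_w _ _ x B). lra. }
  destruct (lipschitz_pointwise_uniform x2 Lam2 (fun n => iw u om (S n)) wl) as [Lipw Uw];
    [lra|exact HLam2| |exact Hwl|].
  { intros n. apply (Hlip2 _ _ _ (Sw n)).
    - intros x Hx. destruct (Hinv (S n)) as [_ B].
      pose proof (box_bounds_w _ _ x B Hx). apply Rabs_le. lra.
    - intros x Hx _. destruct (Hinv n) as [_ B].
      apply Gw_bound; [lra|apply B; lra|apply (box_bounds_w _ _ x B); lra]. }
  apply (unif_seq_shift L (iu u om)) in Uu. apply (unif_seq_shift x2 (iw u om)) in Uw.
  assert (Bul : forall x, 0 <= x <= L -> 0 <= ul x <= r).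
  { intros x Hx. apply (unif_seq_bounds L (iu u om) ul x 0 r Uu Hx).
    intros n. apply (Hinv n). exact Hx. }
  assert (Bwl : forall x, 0 <= x <= x2 -> 0 <= wl x <= Ombar x).
  { intros x Hx. apply (unif_seq_bounds x2 (iw u om) wl x 0 _ Uw Hx).
    intros n. apply (Hinv n). exact Hx. }
  pose (uc := fun x => ul (clamp 0 L x)). pose (wc := fun x => wl (clamp 0 x2 x)).
  assert (Euc : forall x, 0 <= x <= L -> uc x = ul x)
    by (intros x Hx; unfold uc; rewrite clamp_id; auto).
  assert (Ewc : forall x, 0 <= x <= x2 -> wc x = wl x)
    by (intros x Hx; unfold wc; rewrite clamp_id; auto).
  assert (Huc : forall x, continuous uc x).
  { apply continuous_clamp; [lra|]. apply (lipschitz_cont_on L Lam1); assumption. }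
  assert (Hwc : forall x, continuous wc x).
  { apply continuous_clamp; [lra|]. apply (lipschitz_cont_on x2 Lam2); assumption. }
  destruct (stepu_solution uc wc Huc Hwc) as [CU SU].
  destruct (stepw_solution uc wc Huc Hwc) as [CW SW].
  set (U := stepu uc wc) in *. set (Om := stepw uc wc) in *.
  assert (Hnear : forall eps, 0 < eps -> exists N : nat, forall n, (N <= n)%nat ->
    (forall x, 0 <= x <= L -> Rabs (iu u om n x - ul x) <= eps) /\
    (forall x, 0 <= x <= x2 -> Rabs (iw u om n x - wl x) <= eps)).
  { intros eps Heps. destruct (Uu eps Heps) as [N1 H1]. destruct (Uw eps Heps) as [N2 H2].
    exists (N1 + N2)%nat. intros n Hn. split; intros x Hx; [apply H1|apply H2]; auto; lia. }
  assert (EU : forall x, 0 <= x <= L -> U x = ul x).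
  { intros x Hx. enough (Rabs (U x - ul x) <= 0).
    { pose proof (Rabs_pos (U x - ul x)).
      assert (Rabs (U x - ul x) = 0) as E by lra. apply Rabs_eq_0 in E. lra. }
    apply (Rle_of_eps _ (lipF / KK + 1)). intros eps Heps.
    destruct (Hnear eps Heps) as [N HN].
    assert (H1 : Rabs (U x - iu u om (S N) x) <= lipF * eps / KK).
    { eapply (robin_solution_near d1 (- a1) (a1 / d1) KK L x2 (lipF * eps));
        [lra|lra|lra|lra|nra|exact SU|exact (Su N)| |exact Hx].
      intros z Hz Hzc. cbv beta. rewrite (Euc z) by lra.
      destruct (HN N (Nat.le_refl N)) as [N1 N2]. specialize (N1 z ltac:(lra)).
      apply Rabs_le_between in N1.
      destruct (Hinv N) as [_ BN]. pose proof (Bul z ltac:(lra)).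
      destruct (BN) as [BN1 _]. specialize (BN1 z ltac:(lra)).
      split; (apply Fu_compare; try lra); intros Hzx; rewrite (Ewc z) by lra;
        specialize (N2 z ltac:(lra)); apply Rabs_le_between in N2;
        pose proof (box_bounds_w _ _ z BN ltac:(lra));
        pose proof (Bwl z ltac:(lra)); pose proof (Ombar_bounds z ltac:(lra)); lra. }
    destruct (HN (S N) ltac:(lia)) as [N1 _]. specialize (N1 x Hx).
    replace (U x - ul x) with ((U x - iu u om (S N) x) + (iu u om (S N) x - ul x)) by ring.
    eapply Rle_trans; [apply Rabs_triang|]. unfold Rdiv in *. lra. }
  assert (EW : forall x, 0 <= x <= x2 -> Om x = wl x).
  { intros x Hx. enough (Rabs (Om x - wl x) <= 0).
    { pose proof (Rabs_pos (Om x - wl x)).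
      assert (Rabs (Om x - wl x) = 0) as E by lra. apply Rabs_eq_0 in E. lra. }
    apply (Rle_of_eps _ (lipF / KK + 1)). intros eps Heps.
    destruct (Hnear eps Heps) as [N HN].
    assert (H1 : Rabs (Om x - iw u om (S N) x) <= lipF * eps / KK).
    { eapply (robin_solution_near d2 a2 0 KK x2 x2 (lipF * eps));
        [lra|lra|lra|lra|nra|exact SW|exact (Sw N)| |exact Hx].
      intros z Hz Hzc. cbv beta. rewrite (Euc z), (Ewc z) by lra.
      destruct (HN N (Nat.le_refl N)) as [N1 N2]. specialize (N1 z ltac:(lra)).
      specialize (N2 z ltac:(lra)). apply Rabs_le_between in N1, N2.
      destruct (Hinv N) as [_ BN]. pose proof (Bul z ltac:(lra)).
      pose proof (box_bounds_w _ _ z BN ltac:(lra)).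
      destruct (BN) as [BN1 _]. specialize (BN1 z ltac:(lra)).
      pose proof (Bwl z ltac:(lra)). pose proof (Ombar_bounds z ltac:(lra)).
      split; apply Gw_compare; lra. }
    destruct (HN (S N) ltac:(lia)) as [_ N2]. specialize (N2 x Hx).
    replace (Om x - wl x) with ((Om x - iw u om (S N) x) + (iw u om (S N) x - wl x)) by ring.
    eapply Rle_trans; [apply Rabs_triang|]. unfold Rdiv in *. lra. }
  exists U, (stepux uc wc), Om, (stepwx uc wc).
  split; [|split; [|split; [|split]]].
  - intros eps Heps. destruct (Uu eps Heps) as [N HN]. exists N. intros n Hn x Hx.
    rewrite (EU x Hx). apply HN; assumption.
  - intros eps Heps. destruct (Uw eps Heps) as [N HN]. exists N. intros n Hn x Hx.
    rewrite (EW x Hx). apply HN; assumption.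
  - eapply robin_solution_ext; [|exact SU]. intros z Hz _. cbv beta.
    rewrite (EU z), (Euc z) by lra. destruct (Rlt_dec z x2) as [Hzx|Hzx].
    + rewrite (EW z), (Ewc z) by lra. reflexivity.
    + apply Fu_outside. lra.
  - eapply robin_solution_ext; [|exact SW]. intros z Hz _. cbv beta.
    rewrite (EU z), (Euc z), (EW z), (Ewc z) by lra. reflexivity.
  - split; intros x Hx; [rewrite EU by exact Hx; auto|rewrite EW by exact Hx; auto].
Qed.

Lemma monotone_iter_limit (u om : R -> R) :
  cts2 u om -> box u om ->
  cle u om (stepu u om) (stepw u om) \/ cle (stepu u om) (stepw u om) u om ->
  exists U Ux Om Omx, unif_seq L (iu u om) U /\ unif_seq x2 (iw u om) Om /\
    coexistence_pair U Ux Om Omx.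
Proof.
  intros Hc Hb Hmono. apply iter_limit; auto; intros x Hx.
  - destruct Hmono as [Hi|Hd].
    + apply (ex_finite_lim_seq_incr _ r); intros n.
      * apply (iter_increasing u om n Hc Hb Hi), Hx.
      * apply (iter_invariant u om n Hc Hb), Hx.
    + apply (ex_finite_lim_seq_decr _ 0); intros n.
      * apply (iter_decreasing u om n Hc Hb Hd), Hx.
      * apply (iter_invariant u om n Hc Hb), Hx.
  - destruct Hmono as [Hi|Hd].
    + apply (ex_finite_lim_seq_decr _ 0); intros n.
      * apply (iter_increasing u om n Hc Hb Hi), Hx.
      * apply (iter_invariant u om n Hc Hb), Hx.
    + apply (ex_finite_lim_seq_incr _ (Ombar x)); intros n.
      * apply (iter_decreasing u om n Hc Hb Hd), Hx.
      * apply (iter_invariant u om n Hc Hb), Hx.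
Qed.

(** * Coincidence of ordered coexistence states *)

(* With [t = s * ze] the form dominates [(ph - t)^2 * (ph + t)]. *)
Lemma cubic_form_nonneg (s eta ph ze : R) :
  0 <= ph -> 0 <= ze -> m <= s -> p * s <= 1 -> (0 < ze -> 1 < eta) ->
  0 <= ph ^ 3 - m * ph ^ 2 * ze + s ^ 3 * (eta * ze ^ 3 - p * ph * ze ^ 2) /\
  (ph ^ 3 - m * ph ^ 2 * ze + s ^ 3 * (eta * ze ^ 3 - p * ph * ze ^ 2) <= 0 ->
   ph = 0 /\ ze = 0).
Proof.
  intros Hph Hze Hms Hps Heta.
  assert (Hs : 0 < s) by lra.
  assert (E : ph ^ 3 - m * ph ^ 2 * ze + s ^ 3 * (eta * ze ^ 3 - p * ph * ze ^ 2) =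
    (ph - s * ze) ^ 2 * (ph + s * ze) + (s - m) * (ph ^ 2 * ze)
    + (1 - p * s) * (s ^ 2 * (ph * ze ^ 2)) + s ^ 3 * ((eta - 1) * ze ^ 3)) by ring.
  rewrite E.
  assert (T1 : 0 <= (ph - s * ze) ^ 2 * (ph + s * ze)).
  { apply Rmult_le_pos; [apply pow2_ge_0|nra]. }
  assert (T2 : 0 <= (s - m) * (ph ^ 2 * ze)).
  { apply Rmult_le_pos; [lra|]. apply Rmult_le_pos; [apply pow2_ge_0|lra]. }
  assert (T3 : 0 <= (1 - p * s) * (s ^ 2 * (ph * ze ^ 2))).
  { apply Rmult_le_pos; [lra|]. apply Rmult_le_pos; [apply pow2_ge_0|].
    apply Rmult_le_pos; [lra|apply pow2_ge_0]. }
  destruct (Rle_lt_or_eq_dec 0 ze Hze) as [Hz|<-].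
  - specialize (Heta Hz).
    assert (T4 : 0 < s ^ 3 * ((eta - 1) * ze ^ 3)).
    { apply Rmult_lt_0_compat; [apply pow_lt, Hs|].
      apply Rmult_lt_0_compat; [lra|apply pow_lt, Hz]. }
    split; [lra|]. intros. lra.
  - replace (s ^ 3 * ((eta - 1) * 0 ^ 3)) with 0 by ring. split; [lra|]. intros H.
    split; [|reflexivity]. destruct (Rle_lt_or_eq_dec 0 ph Hph) as [Hp0|<-]; [|reflexivity].
    exfalso. assert (0 < ph ^ 3) by (apply pow_lt, Hp0).
    assert ((ph - s * 0) ^ 2 * (ph + s * 0) = ph ^ 3) by ring. lra.
Qed.

Lemma weight_exists :
  m <= / p * exp (- Rabs (a1 / d1 - a2 / d2) * x2) ->
  exists s0, 0 < s0 /\ forall x, 0 <= x <= x2 ->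
    m <= s0 * exp ((a1 / d1 - a2 / d2) / 3 * x) /\
    p * (s0 * exp ((a1 / d1 - a2 / d2) / 3 * x)) <= 1.
Proof.
  intros Hmp. set (th := a1 / d1 - a2 / d2) in *.
  assert (Hmp' : p * m * exp (Rabs th * x2) <= 1).
  { apply Rmult_le_compat_l with (r := p) in Hmp; [|lra].
    rewrite <- Rmult_assoc, Rinv_r, Rmult_1_l in Hmp by lra.
    apply Rmult_le_compat_r with (r := exp (Rabs th * x2)) in Hmp; [|left; apply exp_pos].
    rewrite <- exp_plus in Hmp.
    replace (- Rabs th * x2 + Rabs th * x2) with 0 in Hmp by ring.
    rewrite exp_0 in Hmp. exact Hmp. }
  assert (Hmul : forall e, 0 <= e -> e <= Rabs th * x2 -> p * (m * exp e) <= 1).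
  { intros e He0 He. apply Rle_trans with (2 := Hmp').
    rewrite <- Rmult_assoc. apply Rmult_le_compat_l; [nra|]. apply exp_le_compat, He. }
  destruct (Rle_dec 0 th) as [Hth|Hth].
  - exists m. split; [exact Hm|]. intros x Hx. rewrite (Rabs_right th) in * by lra.
    assert (Hge : 0 <= th / 3 * x) by nra.
    split; [|apply Hmul; nra].
    rewrite <- (Rmult_1_r m) at 1. apply Rmult_le_compat_l; [lra|].
    rewrite <- exp_0. apply exp_le_compat. exact Hge.
  - exists (m * exp (- th / 3 * x2)).
    split; [apply Rmult_lt_0_compat; [exact Hm|apply exp_pos]|]. intros x Hx.
    rewrite (Rabs_left th) in * by lra.
    rewrite Rmult_assoc, <- exp_plus.
    assert (Hge : 0 <= - th / 3 * x2 + th / 3 * x) by nra.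
    split; [|apply Hmul; nra].
    rewrite <- (Rmult_1_r m) at 1. apply Rmult_le_compat_l; [lra|].
    rewrite <- exp_0. apply exp_le_compat. exact Hge.
Qed.

Lemma ordered_pairs_equal (U1 U1x O1 O1x U2 U2x O2 O2x : R -> R) :
  m <= / p * exp (- Rabs (a1 / d1 - a2 / d2) * x2) ->
  (forall x, 0 <= x <= x2 -> (ee x * Ombar x) ^ 2 <= h) ->
  coexistence_pair U1 U1x O1 O1x -> coexistence_pair U2 U2x O2 O2x ->
  cle U2 O2 U1 O1 ->
  (forall x, 0 <= x <= L -> 0 < U2 x) -> (forall x, 0 <= x <= x2 -> 0 < O1 x) ->
  (forall x, 0 <= x <= L -> U1 x = U2 x) /\ (forall x, 0 <= x <= x2 -> O1 x = O2 x).
Proof.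
  intros Hmp Hwh [[CU1 [U10 [U1L EU1]]] [[CO1 [O10 [O1l EO1]]] [BU1 BO1]]]
    [[CU2 [U20 [U2L EU2]]] [[CO2 [O20 [O2l EO2]]] [BU2 BO2]]] [HU HO] PU2 PO1.
  destruct (weight_exists Hmp) as [s0 [Hs0 Hs]].
  assert (PU1 : forall x, 0 <= x <= L -> 0 < U1 x).
  { intros x Hx. specialize (PU2 x Hx). specialize (HU x Hx). lra. }
  assert (PO2 : forall x, 0 <= x <= x2 -> 0 < O2 x).
  { intros x Hx. specialize (PO1 x Hx). specialize (HO x Hx). lra. }
  pose (H := ratio_flux d1 (- a1) U1 U1x U2 U2x).
  pose (J := ratio_flux d2 a2 O2 O2x O1 O1x).
  assert (CH : cont_on (fun x => 0 <= x <= L) H) by (apply ratio_flux_cont_on; assumption).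
  assert (CJ : cont_on (fun x => 0 <= x <= x2) J) by (apply ratio_flux_cont_on; assumption).
  assert (H0 : H 0 = 0).
  { unfold H, ratio_flux. rewrite U10, U20. ring. }
  assert (HLz : H L = 0).
  { unfold H, ratio_flux. rewrite U1L, U2L. ring. }
  assert (J0 : J 0 = 0).
  { unfold J, ratio_flux. rewrite O10, O20. ring. }
  assert (Jx2 : J x2 = 0).
  { unfold J, ratio_flux. rewrite O1l, O2l. ring. }
  pose (rho := fun x => exp (- a1 / d1 * x)).
  assert (DH : forall x, 0 < x < L -> x <> x2 -> exists l : R, is_derive H x l /\
    rho x * ((U1 x - U2 x) ^ 2 * (U1 x - U2 x - m * chi x2 x * ee x * (O2 x - O1 x))) <= l).
  { intros x Hx Hxc. destruct (EU1 x Hx Hxc) as [y1 [D1 E1]].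
    destruct (EU2 x Hx Hxc) as [y2 [D2 E2]].
    pose proof (PU1 x ltac:(lra)). pose proof (PU2 x ltac:(lra)).
    destruct (ratio_flux_derive d1 (- a1) x U1 U1x U2 U2x y1 y2) as [l [Dl Hl]]; auto.
    - apply HU; lra.
    - apply CU1; lra.
    - apply CU2; lra.
    - exists l. split; [exact Dl|]. eapply Rle_trans; [|exact Hl]. right.
      unfold Fu in E1, E2. unfold rho.
      replace (d1 * y1 + - a1 * U1x x)
        with (- U1 x * (r - U1 x - m * chi x2 x * ee x * O1 x)) by lra.
      replace (d1 * y2 + - a1 * U2x x)
        with (- U2 x * (r - U2 x - m * chi x2 x * ee x * O2 x)) by lra.
      field. lra. }
  assert (DJ : forall x, 0 < x < x2 -> exists l : R, is_derive J x l /\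
    (O2 x - O1 x) ^ 2 * (h * (O2 x - O1 x) / (O1 x * O2 x) - p * ee x * (U1 x - U2 x)) <= l).
  { intros x Hx. destruct (EO1 x Hx ltac:(lra)) as [y1 [D1 E1]].
    destruct (EO2 x Hx ltac:(lra)) as [y2 [D2 E2]].
    pose proof (PO1 x ltac:(lra)). pose proof (PO2 x ltac:(lra)).
    destruct (ratio_flux_derive d2 a2 x O2 O2x O1 O1x y2 y1) as [l [Dl Hl]]; auto.
    - apply HO; lra.
    - apply CO2; lra.
    - apply CO1; lra.
    - exists l. split; [exact Dl|]. eapply Rle_trans; [|exact Hl]. right.
      unfold Gw in E1, E2. fold (ee x).
      replace (d2 * y2 + a2 * O2x x) with ((q + p * U2 x) * O2 x - src x) by lra.
      replace (d2 * y1 + a2 * O1x x) with ((q + p * U1 x) * O1 x - src x) by lra.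
      rewrite <- (src_ee x). field. lra. }
  pose (c0 := s0 ^ 3). pose (N := fun x => H x + c0 * J x).
  assert (Hc0 : 0 < c0) by (apply pow_lt, Hs0).
  assert (DN : forall x, 0 < x < x2 -> exists l : R, is_derive N x l /\ 0 <= l /\
    (l <= 0 -> U1 x - U2 x = 0 /\ O2 x - O1 x = 0)).
  { intros x Hx. destruct (DH x ltac:(lra) ltac:(lra)) as [lH [DlH BH]].
    destruct (DJ x Hx) as [lJ [DlJ BJ]].
    exists (lH + c0 * lJ).
    assert (DNx : is_derive N x (lH + c0 * lJ)).
    { apply (is_derive_plus H (fun x => c0 * J x)); [exact DlH|].
      apply is_derive_scal, DlJ. }
    refine (conj DNx _).
    rewrite chi_lt, Rmult_1_r in BH by lra.
    pose proof (PO1 x ltac:(lra)) as P1. pose proof (PO2 x ltac:(lra)) as P2.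
    pose proof (ee_pos x) as Pe.
    pose (ze := ee x * (O2 x - O1 x)). pose (ph := U1 x - U2 x).
    pose (eta := h / (ee x * O1 x * (ee x * O2 x))).
    pose (s := s0 * exp ((a1 / d1 - a2 / d2) / 3 * x)).
    destruct (Hs x ltac:(lra)) as [Hs1 Hs2]. fold s in Hs1, Hs2.
    destruct (cubic_form_nonneg s eta ph ze) as [Q0 Q1]; auto.
    - unfold ph. specialize (HU x ltac:(lra)). lra.
    - unfold ze. apply Rmult_le_pos; [lra|]. specialize (HO x ltac:(lra)). lra.
    - intros Hze. unfold ze in Hze.
      assert (O1 x < O2 x) by nra.
      assert (Hprod : ee x * O1 x * (ee x * O2 x) < h).
      { apply Rlt_le_trans with (2 := Hwh x ltac:(lra)).
        specialize (BO2 x ltac:(lra)).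
        assert (ee x * O1 x < ee x * O2 x) by nra.
        assert (ee x * O2 x <= ee x * Ombar x) by nra.
        assert (0 < ee x * O1 x) by nra. nra. }
      assert (Hpp : 0 < ee x * O1 x * (ee x * O2 x)).
      { repeat apply Rmult_lt_0_compat; assumption. }
      unfold eta. apply Rmult_lt_reg_r with (1 := Hpp).
      set (P := ee x * O1 x * (ee x * O2 x)) in *.
      replace (h / P * P) with h by (field; lra). lra.
    - assert (Hrho : 0 < rho x) by apply exp_pos.
      assert (Es3 : rho x * s ^ 3 * ee x = c0).
      { unfold rho, s, c0, ee. rewrite Rpow_mult_distr.
        replace (exp ((a1 / d1 - a2 / d2) / 3 * x) ^ 3)
          with (exp ((a1 / d1 - a2 / d2) * x)).
        - replace (exp (- a1 / d1 * x) * (s0 ^ 3 * exp ((a1 / d1 - a2 / d2) * x))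
             * exp (a2 / d2 * x))
            with (s0 ^ 3 * (exp (- a1 / d1 * x) * exp ((a1 / d1 - a2 / d2) * x)
             * exp (a2 / d2 * x))) by ring.
          rewrite <- !exp_plus.
          replace (- a1 / d1 * x + (a1 / d1 - a2 / d2) * x + a2 / d2 * x)
            with 0 by (field; lra). rewrite exp_0. ring.
        - simpl. rewrite Rmult_1_r, <- !exp_plus. f_equal. field. lra. }
      assert (Hlow : rho x * (ph ^ 3 - m * ph ^ 2 * ze
          + s ^ 3 * (eta * ze ^ 3 - p * ph * ze ^ 2)) <= lH + c0 * lJ).
      { apply Rle_trans with
          (rho x * ((U1 x - U2 x) ^ 2 * (U1 x - U2 x - m * ee x * (O2 x - O1 x)))
           + c0 * ((O2 x - O1 x) ^ 2 * (h * (O2 x - O1 x) / (O1 x * O2 x)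
                     - p * ee x * (U1 x - U2 x)))).
        - right. rewrite <- Es3. unfold ph, ze, eta. field. lra.
        - apply Rplus_le_compat; [exact BH|]. apply Rmult_le_compat_l; lra. }
      split.
      + apply Rle_trans with (2 := Hlow). apply Rmult_le_pos; lra.
      + intros Hle. destruct Q1 as [E1 E2].
        * apply Rmult_le_reg_l with (rho x); [exact Hrho|]. lra.
        * split; [exact E1|]. unfold ze in E2.
          apply Rmult_integral in E2. destruct E2; lra. }
  assert (CN : cont_on (fun x => 0 <= x <= x2) N).
  { apply cont_on_plus; [|apply cont_on_mult; [apply cont_on_const|exact CJ]].
    restrict CH. }
  assert (CHr : cont_on (fun x => x2 <= x <= L) H).
  { restrict CH. }
  assert (DHr : forall x, x2 < x < L -> exists l : R, is_derive H x l /\ 0 <= l /\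
    (l <= 0 -> U1 x - U2 x = 0)).
  { intros x Hx. destruct (DH x ltac:(lra) ltac:(lra)) as [l [Dl Bl]].
    rewrite chi_ge in Bl by lra.
    assert (Hph : 0 <= U1 x - U2 x) by (specialize (HU x ltac:(lra)); lra).
    assert (Hrho : 0 < rho x) by apply exp_pos.
    replace (rho x * ((U1 x - U2 x) ^ 2 * (U1 x - U2 x - m * 0 * ee x * (O2 x - O1 x))))
      with (rho x * (U1 x - U2 x) ^ 3) in Bl by ring.
    exists l. refine (conj Dl _). split.
    - apply Rle_trans with (2 := Bl). apply Rmult_le_pos; [lra|apply pow_le, Hph].
    - intros Hle. destruct (Rle_lt_or_eq_dec _ _ Hph) as [Hlt|E]; [exfalso|lra].
      assert (0 < rho x * (U1 x - U2 x) ^ 3)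
        by (apply Rmult_lt_0_compat; [exact Hrho|apply pow_lt, Hlt]). lra. }
  assert (HHx2 : H x2 <= 0).
  { rewrite <- HLz. apply nondecreasing_of_derive; [lra|exact CHr|].
    intros x Hx. destruct (DHr x Hx) as [l [Dl [Pl _]]]. exists l. split; assumption. }
  assert (DN' : forall x, 0 < x < x2 -> exists l : R, is_derive N x l /\ 0 <= l).
  { intros x Hx. destruct (DN x Hx) as [l [Dl [Pl _]]]. exists l. split; assumption. }
  assert (N0 : N 0 = 0) by (unfold N; rewrite H0, J0; ring).
  assert (Nx2 : N x2 = H x2) by (unfold N; rewrite Jx2; ring).
  assert (Hleft : forall x, 0 < x < x2 -> U1 x - U2 x = 0 /\ O2 x - O1 x = 0).
  { intros x Hx. destruct (DN x Hx) as [l [Dl [_ Hz]]]. apply Hz. right.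
    apply (const_of_nondecreasing N 0 x2) with (x := x); auto; lra. }
  assert (Hx2z : 0 <= H x2).
  { rewrite <- Nx2, <- N0. apply nondecreasing_of_derive; [lra|exact CN|exact DN']. }
  assert (Hright : forall x, x2 < x < L -> U1 x - U2 x = 0).
  { intros x Hx. destruct (DHr x Hx) as [l [Dl [_ Hz]]]. apply Hz. right.
    apply (const_of_nondecreasing H x2 L) with (x := x); auto; try lra.
    intros y Hy. destruct (DHr y Hy) as [l' [Dl' [Pl' _]]]. exists l'. split; assumption. }
  split; intros x Hx.
  - enough (U1 x + -1 * U2 x = 0) by lra.
    apply (cont_on_zero_extend L x2 (fun x => U1 x + -1 * U2 x)); auto.
    + apply cont_on_plus; [apply CU1|apply cont_on_mult; [apply cont_on_const|apply CU2]].
    + intros y Hy Hyc. destruct (Rlt_dec y x2).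
      * pose proof (Hleft y ltac:(lra)). lra.
      * pose proof (Hright y ltac:(lra)). lra.
  - enough (O1 x + -1 * O2 x = 0) by lra.
    apply (cont_on_zero_extend x2 x2 (fun x => O1 x + -1 * O2 x)); auto; [lra| |].
    + apply cont_on_plus; [apply CO1|apply cont_on_mult; [apply cont_on_const|apply CO2]].
    + intros y Hy Hyc. pose proof (Hleft y ltac:(lra)). lra.
Qed.

(** * Long-time behaviour of solutions *)

Definition om_of (w : R -> R -> R) (x t : R) : R := exp (- (a2 / d2) * x) * w x t.

Lemma om_of_ee (w : R -> R -> R) (x t : R) : ee x * om_of w x t = w x t.
Proof.
  unfold om_of, ee. rewrite <- Rmult_assoc, <- exp_plus.
  replace (a2 / d2 * x + - (a2 / d2) * x) with 0 by ring. rewrite exp_0. ring.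
Qed.

Definition react_u (u om : R -> R -> R) (x t : R) : R :=
  u x t * (r - u x t - m * chi x2 x * ee x * om x t).
Definition react_w (u om : R -> R -> R) (x t : R) : R :=
  src x - q * om x t - p * u x t * om x t.

Definition transformed_solution (u ux ut om omx omt : R -> R -> R) : Prop :=
  forall S T, 0 <= S ->
    parabolic_robin d1 (- a1) (a1 / d1) L x2 S T (react_u u om) u ux ut /\
    parabolic_robin d2 a2 0 x2 x2 S T (react_w u om) om omx omt.

Lemma solution_transform (u w : R -> R -> R) :
  is_solution d1 d2 r m p q h L a1 a2 x2 u w ->
  exists ux ut omx omt, transformed_solution u ux ut (om_of w) omx omt.
Proof.
  intros [ux [ut [wx [wt [Cu [Cw [Cux [Cut [Cwx [Cwt [Du [Eu [Ew Bc]]]]]]]]]]]]].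
  pose (be := a2 / d2). pose (g := fun x => exp (- be * x)).
  pose (gx := fun x => - be * g x).
  assert (Dg : forall x, is_derive g x (gx x)).
  { intros x. unfold g, gx. auto_derive; [exact I|unfold g; ring]. }
  assert (Dgx : forall x, is_derive gx x (- be * gx x)).
  { intros x. apply is_derive_scal, Dg. }
  assert (Cg : C1on 0 x2 g gx).
  { exact (C1on_of_derive _ _ _ _ _ Dg Dgx). }
  exists ux, ut, (fun x t => gx x * w x t + g x * wx x t), (fun x t => g x * wt x t).
  intros S T HS. split.
  - split; [split; [|split; [|split]]|split].
    + restrict Cu.
    + restrict Cux.
    + restrict Cut.
    + intros x t Hx Ht. apply Du; lra.
    + intros t Ht. destruct (Bc t ltac:(lra)) as [B1 [B2 _]]. split; [|exact B2].
      field_simplify_eq; lra.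
    + intros x t Hx Hxc Ht. destruct (Eu x t Hx Hxc ltac:(lra)) as [uxx [D E]].
      exists uxx. split; [exact D|]. rewrite E. unfold react_u.
      rewrite <- (om_of_ee w x t). ring.
  - split; [|split].
    + apply (parabolic_field_mult_space 0 x2 S T g gx w wx wt Cg).
      split; [|split; [|split]].
      * restrict Cw.
      * restrict Cwx.
      * restrict Cwt.
      * intros x t Hx Ht. destruct (Ew x t Hx ltac:(lra)) as [D1 [D2 _]]. split; assumption.
    + intros t Ht. destruct (Bc t ltac:(lra)) as [_ [_ [B1 B2]]]. unfold gx.
      assert (Hbe : d2 * be = a2) by (unfold be; field; lra).
      assert (F1 : wx 0 t = be * w 0 t) by (apply Rmult_eq_reg_l with d2; [nra|lra]).
      assert (F2 : wx x2 t = be * w x2 t) by (apply Rmult_eq_reg_l with d2; [nra|lra]).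
      rewrite F1, F2. split; ring.
    + intros x t Hx Hxc Ht. destruct (Ew x t Hx ltac:(lra)) as [D1 [_ [wxx [D2 E]]]].
      exists ((- be * gx x * w x t + gx x * wx x t) + (gx x * wx x t + g x * wxx)). split.
      * apply (is_derive_plus (fun y => gx y * w y t) (fun y => g y * wx y t)).
        -- apply (is_derive_mult_R gx (fun y => w y t)); [apply Dgx|exact D1].
        -- apply (is_derive_mult_R g (fun y => wx y t)); [apply Dg|exact D2].
      * rewrite E. unfold react_w, src, om_of. fold be. fold (g x). unfold gx.
        assert (Hbe : a2 = d2 * be) by (unfold be; field; lra).
        rewrite Hbe. ring.
Qed.

Section Solution.

Variables u ux ut om omx omt : R -> R -> R.
Hypothesis Hsol : transformed_solution u ux ut om omx omt.
Hypothesis Hu0 : forall x, 0 <= x <= L -> 0 <= u x 0.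
Hypothesis Hom0 : forall x, 0 <= x <= x2 -> 0 <= om x 0.

Lemma solution_bounded (S T : R) : 0 <= S -> S <= T -> exists M, 0 < M /\
  (forall x t, 0 <= x <= L -> S <= t <= T -> Rabs (u x t) <= M) /\
  (forall x t, 0 <= x <= x2 -> S <= t <= T -> Rabs (om x t) <= M).
Proof.
  intros HS HT. destruct (Hsol S T HS) as [[[Cu _] _] [[Co _] _]].
  destruct (cont2_on_bounded 0 L S T u ltac:(lra) HT Cu) as [M1 [HM1 H1]].
  destruct (cont2_on_bounded 0 x2 S T om ltac:(lra) HT Co) as [M2 [HM2 H2]].
  exists (M1 + M2). split; [lra|]. split; intros x t Hx Ht.
  - specialize (H1 x t Hx Ht). lra.
  - specialize (H2 x t Hx Ht). lra.
Qed.

Lemma competition_term_bound (M x t : R) :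
  0 <= M -> 0 <= x -> (0 <= x <= x2 -> Rabs (om x t) <= M) ->
  Rabs (m * chi x2 x * ee x * om x t) <= m * ee_max * M.
Proof.
  intros HM Hx Hom. pose proof (competition_bounds x) as Hc.
  rewrite Rabs_mult, (Rabs_right (m * chi x2 x * ee x)) by lra.
  destruct (Rlt_dec x x2) as [Hlt|Hge].
  - apply Rmult_le_compat; [lra|apply Rabs_pos|lra|apply Hom; lra].
  - rewrite chi_ge by lra. rewrite Rmult_0_r, !Rmult_0_l.
    apply Rmult_le_pos; [lra|exact HM].
Qed.

Lemma solution_u_nonneg (x t : R) : 0 <= x <= L -> 0 <= t -> 0 <= u x t.
Proof.
  intros Hx Ht. destruct (Hsol 0 t ltac:(lra)) as [[Pu [Bu Eu]] _].
  destruct (solution_bounded 0 t ltac:(lra) Ht) as [M [HM [M1 M2]]].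
  apply (parabolic_minimum_principle 0 L 0 t x2 d1 (- a1) (r + M + m * ee_max * M) u ux ut);
    auto; try lra.
  - intros s Hs Hneg. destruct (Bu s Hs) as [E _]. rewrite E.
    pose proof robin_coef_nonneg. nra.
  - intros s Hs Hneg. destruct (Bu s Hs) as [_ E]. lra.
  - intros y s Hy Hyc Hs. destruct (Eu y s Hy Hyc Hs) as [uxx [D E]].
    exists uxx. split; [exact D|]. intros Hneg. rewrite E. unfold react_u.
    assert (Hb := M1 y s ltac:(lra) ltac:(lra)).
    assert (Hc := competition_term_bound M y s ltac:(lra) ltac:(lra)
      (fun Hy' => M2 y s Hy' ltac:(lra))).
    apply Rabs_le_between in Hb, Hc.
    set (c := m * chi x2 y * ee y * om y s) in *. nra.
Qed.

Lemma solution_om_nonneg (x t : R) : 0 <= x <= x2 -> 0 <= t -> 0 <= om x t.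
Proof.
  intros Hx Ht. destruct (Hsol 0 t ltac:(lra)) as [_ [Pw [Bw Ew]]].
  apply (parabolic_minimum_principle 0 x2 0 t x2 d2 a2 0 om omx omt); auto; try lra.
  - intros s Hs Hneg. destruct (Bw s Hs) as [E _]. lra.
  - intros s Hs Hneg. destruct (Bw s Hs) as [_ E]. lra.
  - intros y s Hy Hyc Hs. destruct (Ew y s Hy Hyc Hs) as [oxx [D E]].
    exists oxx. split; [exact D|]. intros Hneg. rewrite E. unfold react_w.
    pose proof (src_pos y). pose proof (solution_u_nonneg y s ltac:(lra) ltac:(lra)).
    assert (0 <= p * u y s * (- om y s)).
    { apply Rmult_le_pos; [apply Rmult_le_pos; lra|lra]. }
    nra.
Qed.

Lemma solution_u_upper (eps : R) : 0 < eps ->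
  exists T, 0 <= T /\ forall t, T <= t -> forall x, 0 <= x <= L -> u x t <= r + eps.
Proof.
  intros Heps. destruct (solution_bounded 0 0 ltac:(lra) ltac:(lra)) as [M [HM [M1 _]]].
  pose (cc := fun t => r + M * exp (- r * t)).
  pose (cct := fun t => - r * (M * exp (- r * t))).
  assert (Hcmp : forall t, 0 <= t -> forall x, 0 <= x <= L -> u x t <= cc t).
  { intros T HT x Hx. destruct (Hsol 0 T ltac:(lra)) as [[Pu [Bu Eu]] _].
    pose proof (parabolic_minimum_principle 0 L 0 T x2 d1 (- a1) 0
      (fun x t => 1 * cc t + -1 * u x t) (fun x t => 0 * cc t + -1 * ux x t)
      (fun x t => 1 * cct t + -1 * ut x t)) as H. cbv beta in H.
    enough (0 <= 1 * cc T + -1 * u x T) by lra. apply H; auto; try lra.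
    - apply (parabolic_field_plus 0 L 0 T (fun x t => 1 * cc t) (fun x t => 0 * cc t)
        (fun x t => 1 * cct t)); [|apply parabolic_field_scal, Pu].
      apply (parabolic_field_sep 0 L 0 T (fun _ => 1) (fun _ => 0) cc cct);
        [apply C1on_const| |].
      + intros t. unfold cc, cct. auto_derive; [exact I|ring].
      + intros t. apply (is_derive_continuity_pt cct t (r * r * (M * exp (- r * t)))).
        unfold cct. auto_derive; [exact I|ring].
    - intros y Hy. specialize (M1 y 0 Hy ltac:(lra)). apply Rabs_le_between in M1.
      unfold cc. rewrite Rmult_0_r, exp_0. lra.
    - intros t Ht Hneg. destruct (Bu t Ht) as [E _]. rewrite E.
      pose proof robin_coef_nonneg. pose proof (solution_u_nonneg 0 t ltac:(lra) ltac:(lra)).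
      nra.
    - intros t Ht Hneg. destruct (Bu t Ht) as [_ E]. rewrite E. lra.
    - intros y t Hy Hyc Ht. destruct (Eu y t Hy Hyc Ht) as [uxx [D E]].
      exists (0 + -1 * uxx). split.
      + apply (is_derive_plus (fun y => 0 * cc t) (fun y => -1 * ux y t)).
        * apply is_derive_const_R.
        * apply is_derive_scal, D.
      + intros Hneg. rewrite E. unfold react_u.
        pose proof (solution_u_nonneg y t ltac:(lra) ltac:(lra)) as Hun.
        assert (Hcw : 0 <= m * chi x2 y * ee y * om y t).
        { pose proof (competition_bounds y). destruct (Rlt_dec y x2).
          - apply Rmult_le_pos; [lra|]. apply solution_om_nonneg; lra.
          - rewrite chi_ge by lra. lra. }
        set (c := m * chi x2 y * ee y * om y t) in *.
        assert (Hme : 0 < M * exp (- r * t)) by (apply Rmult_lt_0_compat; [lra|apply exp_pos]).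
        assert (Hgap : M * exp (- r * t) <= u y t - r) by (unfold cc in Hneg; lra).
        assert (0 <= u y t * c) by (apply Rmult_le_pos; lra).
        unfold cct. nra. }
  destruct (exp_decay_small M r eps Hr Heps ltac:(lra)) as [s0 [Hs0 Hs]].
  exists s0. split; [exact Hs0|]. intros t Ht x Hx.
  specialize (Hcmp t ltac:(lra) x Hx). specialize (Hs t Ht). unfold cc in Hcmp. lra.
Qed.

Lemma solution_om_upper (eps : R) : 0 < eps ->
  exists T, 0 <= T /\ forall t, T <= t -> forall x, 0 <= x <= x2 ->
    om x t <= Ombar x + eps.
Proof.
  intros Heps.
  destruct (robin_asymptotic_upper d2 a2 0 q x2 x2 0 (q * eps / 2) src Ombar Ombarx
    (react_w u om) om omx omt) as [T [HT H]]; auto; try lra; [nra|apply Ombar_solution| | |].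
  - intros T. apply Hsol. lra.
  - intros x t Hx _ Ht. unfold react_w.
    pose proof (solution_u_nonneg x t ltac:(lra) ltac:(lra)).
    pose proof (solution_om_nonneg x t ltac:(lra) ltac:(lra)).
    assert (0 <= p * u x t * om x t) by (apply Rmult_le_pos; [apply Rmult_le_pos; lra|lra]).
    nra.
  - exists T. split; [exact HT|]. intros t Ht x Hx. specialize (H t Ht x Hx).
    replace (2 * (q * eps / 2 / q)) with eps in H by (field; lra). exact H.
Qed.

(* The travelling exponential [exp (k t + sg kap (x - x0)) - 1] is negative at
   time 0 and spreads positivity from [x0] over [A, B] before time [tau]. *)
Lemma solution_barrier (A B sg x0 del tau M kap k e : R) :
  (A = 0 /\ B = x0 /\ sg = 1) \/ (A = x0 /\ B = L /\ sg = -1) ->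
  A < B -> 0 <= x0 <= L -> 0 < tau -> 0 < e -> 0 <= k -> a1 / d1 <= kap -> 0 <= M ->
  e * exp (k * tau) <= del ->
  (forall t, 0 <= t <= tau -> del <= u x0 t) ->
  (forall x t, 0 <= x <= L -> 0 <= t <= tau -> Rabs (u x t) <= M) ->
  (forall x t, 0 <= x <= x2 -> 0 <= t <= tau -> Rabs (om x t) <= M) ->
  k = d1 * kap ^ 2 - a1 * kap - (M + m * ee_max * M) ->
  forall x, A <= x <= B -> e * (exp (k * tau + sg * kap * (x - x0)) - 1) <= u x tau.
Proof.
  intros Hcase HAB Hx0 Htau He Hk Hkap HM Hdel Hux0 M1 M2 Ek x Hx.
  destruct (Hsol 0 tau ltac:(lra)) as [[Pu [Bu Eu]] _].
  pose proof robin_coef_nonneg as Hgam.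
  assert (Hsg : sg ^ 2 = 1) by (destruct Hcase as [[_ [_ ->]]|[_ [_ ->]]]; ring).
  assert (Hsx : forall y, A <= y <= B -> sg * (y - x0) <= 0).
  { intros y Hy. destruct Hcase as [[-> [-> ->]]|[-> [-> ->]]]; lra. }
  assert (HABL : 0 <= A /\ B <= L) by (destruct Hcase as [[-> [-> _]]|[-> [-> _]]]; lra).
  pose (g := fun y => - e * exp (sg * kap * (y - x0))).
  pose (gx := fun y => sg * kap * g y).
  pose (c := fun t => exp (k * t)). pose (ct := fun t => k * exp (k * t)).
  assert (Dg : forall y, is_derive g y (gx y)).
  { intros y. unfold gx, g. auto_derive; [exact I|unfold Rminus; ring]. }
  assert (Dgx : forall y, is_derive gx y (sg * kap * gx y)).
  { intros y. apply is_derive_scal, Dg. }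
  assert (Cg : C1on A B g gx).
  { exact (C1on_of_derive _ _ _ _ _ Dg Dgx). }
  assert (Hgc : forall y t, g y * c t = - e * exp (k * t + sg * kap * (y - x0))).
  { intros y t. unfold g, c. rewrite exp_plus. ring. }
  assert (HgV : forall y t, g y * c t < 0).
  { intros y t. rewrite Hgc. pose proof (exp_pos (k * t + sg * kap * (y - x0))). nra. }
  pose proof (parabolic_minimum_principle A B 0 tau x2 d1 (- a1) 0
    (fun y t => u y t + (g y * c t + e * 1)) (fun y t => ux y t + (gx y * c t + 0 * 1))
    (fun y t => ut y t + (g y * ct t + e * 0))) as H. cbv beta in H.
  enough (0 <= u x tau + (g x * c tau + e * 1)) as Hfin.
  { rewrite Hgc in Hfin. lra. }
  apply H; auto; try lra.
  - apply (parabolic_field_plus A B 0 tau u ux ut (fun y t => g y * c t + e * 1)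
      (fun y t => gx y * c t + 0 * 1) (fun y t => g y * ct t + e * 0)).
    + apply (parabolic_field_restrict 0 L); [lra|lra|exact Pu].
    + apply (parabolic_field_plus A B 0 tau (fun y t => g y * c t)
        (fun y t => gx y * c t) (fun y t => g y * ct t)).
      * apply parabolic_field_sep; [exact Cg| |].
        -- intros t. unfold c, ct. auto_derive; [exact I|ring].
        -- intros t. apply (is_derive_continuity_pt ct t (k * k * exp (k * t))).
           unfold ct. auto_derive; [exact I|ring].
      * apply (parabolic_field_sep A B 0 tau (fun _ => e) (fun _ => 0) (fun _ => 1) (fun _ => 0));
          [apply C1on_const| |].
        -- intros t. apply is_derive_const_R.
        -- intros t. apply continuity_pt_const. intros ? ?; reflexivity.
  - intros y Hy. rewrite Hgc. rewrite Rmult_0_r, Rplus_0_l.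
    assert (exp (sg * kap * (y - x0)) <= 1).
    { rewrite <- exp_0. apply exp_le_compat. specialize (Hsx y Hy). nra. }
    specialize (Hu0 y ltac:(lra)). nra.
  - intros t Ht Hneg. destruct Hcase as [[EA [EB Es]]|[EA [EB Es]]].
    + destruct (Bu t Ht) as [E _]. unfold gx. rewrite EA, E, Es in *.
      pose proof (solution_u_nonneg 0 t ltac:(lra) ltac:(lra)) as Hun.
      specialize (HgV 0 t).
      replace (1 * kap * g 0 * c t) with (kap * (g 0 * c t)) by ring.
      set (V := g 0 * c t) in *. nra.
    + exfalso. rewrite EA in Hneg. specialize (Hux0 t ltac:(lra)).
      rewrite Hgc, Rminus_diag, Rmult_0_r, Rplus_0_r in Hneg.
      assert (exp (k * t) <= exp (k * tau)) by (apply exp_le_compat; nra). nra.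
  - intros t Ht Hneg. destruct Hcase as [[EA [EB Es]]|[EA [EB Es]]].
    + exfalso. rewrite EB in Hneg. specialize (Hux0 t ltac:(lra)).
      rewrite Hgc, Rminus_diag, Rmult_0_r, Rplus_0_r in Hneg.
      assert (exp (k * t) <= exp (k * tau)) by (apply exp_le_compat; nra). nra.
    + destruct (Bu t Ht) as [_ E]. unfold gx. rewrite EB, E, Es.
      specialize (HgV L t).
      replace (-1 * kap * g L * c t) with (- kap * (g L * c t)) by ring.
      set (V := g L * c t) in *. nra.
  - intros y t Hy Hyc Ht. destruct (Eu y t ltac:(lra) Hyc Ht) as [uxx [D E]].
    exists (uxx + (sg * kap * gx y * c t + 0)). split.
    + apply (is_derive_plus (fun y => ux y t) (fun y => gx y * c t + 0 * 1)); [exact D|].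
      apply (is_derive_plus (fun y => gx y * c t) (fun y => 0 * 1)).
      * apply (is_derive_ext (fun z => c t * gx z)); [intros; apply Rmult_comm|].
        rewrite (Rmult_comm _ (c t)). apply is_derive_scal, Dgx.
      * apply is_derive_const_R.
    + intros Hneg. rewrite E. unfold react_u, gx.
      pose proof (solution_u_nonneg y t ltac:(lra) ltac:(lra)) as Hun.
      assert (Hb := M1 y t ltac:(lra) ltac:(lra)).
      assert (Hc := competition_term_bound M y t HM ltac:(lra)
        (fun Hy' => M2 y t Hy' ltac:(lra))).
      apply Rabs_le_between in Hb, Hc.
      set (w := m * chi x2 y * ee y * om y t) in *.
      assert (HV : 0 < - (g y * c t)).
      { specialize (HgV y t). lra. }
      assert (Hct : g y * ct t = k * (g y * c t)) by (unfold ct, c; ring).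
      rewrite Hct. set (V := g y * c t) in *.
      set (MM := M + m * ee_max * M) in *.
      assert (HMM : 0 <= MM).
      { unfold MM. pose proof (ee_pos x2). fold ee_max in *.
        assert (0 <= m * ee_max * M) by (apply Rmult_le_pos; [nra|lra]). lra. }
      assert (Hreac : - MM * u y t <= u y t * (r - u y t - w)) by (unfold MM; nra).
      assert (HuV : MM * u y t <= MM * - V) by (apply Rmult_le_compat_l; lra).
      replace (sg * kap * (sg * kap * g y) * c t) with (sg ^ 2 * kap ^ 2 * V)
        by (unfold V; ring).
      replace (sg * kap * g y * c t) with (sg * kap * V) by (unfold V; ring).
      rewrite Hsg, Ek.
      assert (Hkp : 0 <= kap) by lra.
      assert (Hsk : a1 * kap * V <= sg * (a1 * (kap * V)) ).
      { assert (0 <= a1 * kap * - V) by (repeat apply Rmult_le_pos; lra).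
        destruct Hcase as [[_ [_ ->]]|[_ [_ ->]]]; lra. }
      nra.
Qed.

Lemma solution_becomes_positive (x0 : R) : 0 <= x0 <= L -> 0 < u x0 0 ->
  exists tau, 0 < tau /\ forall x, 0 <= x <= L -> 0 < u x tau.
Proof.
  intros Hx0 Hpos. destruct (Hsol 0 1 ltac:(lra)) as [[[Cu _] _] _].
  pose (del := u x0 0 / 2).
  destruct (Cu x0 0 ltac:(lra) del ltac:(unfold del; lra)) as [t0 [Ht0 Hc]].
  pose (tau := Rmin (t0 / 2) 1).
  assert (Htau : 0 < tau /\ tau < t0 /\ tau <= 1).
  { unfold tau. clear - Ht0. minmax. }
  destruct Htau as [Htau [Htau0 Htau1]].
  assert (Hux0 : forall t, 0 <= t <= tau -> del <= u x0 t).
  { intros t Ht. assert (Hx : Rabs (x0 - x0) < t0) by (rewrite Rminus_diag, Rabs_R0; lra).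
    assert (Ht' : Rabs (t - 0) < t0) by (apply Rabs_def1; lra).
    specialize (Hc x0 t ltac:(lra) Hx Ht'). apply Rabs_lt_between in Hc.
    unfold del in *. lra. }
  assert (Hdel : 0 < del) by (unfold del; lra).
  clearbody tau del.
  destruct (solution_bounded 0 tau ltac:(lra) ltac:(lra)) as [M [HM [M1 M2]]].
  pose (MM := M + m * ee_max * M).
  assert (HMM : 0 <= MM).
  { unfold MM. pose proof (ee_pos x2). fold ee_max in *.
    assert (0 <= m * ee_max * M) by (apply Rmult_le_pos; [nra|lra]). lra. }
  pose (kap := (a1 * tau + L + MM * tau + 1) / (d1 * tau) + 1).
  assert (Hdt : 0 < d1 * tau) by nra.
  assert (Hkt : d1 * tau * kap = a1 * tau + L + MM * tau + 1 + d1 * tau).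
  { unfold kap. field. lra. }
  assert (HMt : 0 <= MM * tau) by nra.
  assert (Hkap1 : 1 <= kap).
  { unfold kap. enough (0 <= (a1 * tau + L + MM * tau + 1) / (d1 * tau)) by lra.
    apply Rdiv_le_0_compat; nra. }
  assert (Hkapg : a1 / d1 <= kap).
  { apply Rmult_le_reg_l with (d1 * tau); [exact Hdt|].
    replace (d1 * tau * (a1 / d1)) with (a1 * tau) by (field; lra). lra. }
  pose (k := d1 * kap ^ 2 - a1 * kap - MM).
  assert (Hktau : kap * L < k * tau).
  { unfold k.
    replace ((d1 * kap ^ 2 - a1 * kap - MM) * tau)
      with (kap * (d1 * tau * kap) - a1 * tau * kap - MM * tau) by ring.
    rewrite Hkt. nra. }
  assert (Hk : 0 <= k) by nra.
  pose (e := del / exp (k * tau)).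
  assert (He : 0 < e) by (apply Rdiv_lt_0_compat; [exact Hdel|apply exp_pos]).
  assert (Hee : e * exp (k * tau) <= del).
  { right. unfold e. field. pose proof (exp_pos (k * tau)). lra. }
  exists tau. split; [exact Htau|]. intros x Hx.
  assert (Hfin : forall sg, -1 <= sg <= 1 -> 0 <= L - sg * (x - x0) * -1 ->
    e * (exp (k * tau + sg * kap * (x - x0)) - 1) <= u x tau -> 0 < u x tau).
  { intros sg Hsg HLx Hle. apply Rlt_le_trans with (2 := Hle).
    apply Rmult_lt_0_compat; [exact He|].
    assert (1 < exp (k * tau + sg * kap * (x - x0))); [|lra].
    rewrite <- exp_0. apply exp_increasing. nra. }
  destruct (Rtotal_order x x0) as [Hlt|[Heq|Hgt]].
  - apply (Hfin 1); [lra|lra|].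
    apply (solution_barrier 0 x0 1 x0 del tau M kap k e); auto; lra.
  - subst x. specialize (Hux0 tau ltac:(lra)). lra.
  - apply (Hfin (-1)); [lra|lra|].
    apply (solution_barrier x0 L (-1) x0 del tau M kap k e); auto; lra.
Qed.


Definition strict_subsolution (psi psix : R -> R) (del : R) : Prop :=
  C1on 0 L psi psix /\ (forall x, 0 <= x <= L -> 0 < psi x) /\ 0 < del /\
  a1 / d1 * psi 0 <= psix 0 /\ psix L <= 0 /\
  forall x, 0 < x < L -> x <> x2 -> exists pxx : R, is_derive psix x pxx /\
    del * psi x <= d1 * pxx - a1 * psix x + psi x * (r - m * chi x2 x * ee x * Ombar x).

Lemma solution_above_subsolution (psi psix : R -> R) (del P e c mu S T : R) :
  strict_subsolution psi psix del ->
  (forall x, 0 <= x <= L -> psi x <= P) ->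
  0 <= S -> S <= T -> 0 < c -> 0 <= mu -> 0 <= e ->
  c * P + m * ee_max * e <= mu + del ->
  (forall x t, 0 <= x <= x2 -> S <= t <= T -> om x t <= Ombar x + e) ->
  (forall x, 0 <= x <= L -> c * psi x <= u x S) ->
  forall x, 0 <= x <= L -> c * exp (- mu * (T - S)) * psi x <= u x T.
Proof.
  intros [Cp [Pp [Hdel [B0 [BL Ep]]]]] HP HS HST Hc Hmu He Hsmall Hom HuS x Hx.
  destruct (Hsol S T HS) as [[Pu [Bu Eu]] _].
  pose proof robin_coef_nonneg as Hgam.
  pose (cc := fun t => - c * exp (- mu * (t - S))).
  pose (cct := fun t => mu * (c * exp (- mu * (t - S)))).
  assert (Hcc : forall t, cc t < 0).
  { intros t. unfold cc. pose proof (exp_pos (- mu * (t - S))). nra. }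
  pose proof (parabolic_minimum_principle 0 L S T x2 d1 (- a1) r
    (fun y t => u y t + psi y * cc t) (fun y t => ux y t + psix y * cc t)
    (fun y t => ut y t + psi y * cct t)) as H. cbv beta in H.
  enough (0 <= u x T + psi x * cc T) as Hfin by (unfold cc in Hfin; lra).
  apply H; auto; try lra.
  - apply parabolic_field_plus; [exact Pu|]. apply parabolic_field_sep; [exact Cp| |].
    + intros t. unfold cc, cct. auto_derive; [exact I|unfold Rminus; ring].
    + intros t. apply (is_derive_continuity_pt cct t (- mu * mu * (c * exp (- mu * (t - S))))).
      unfold cct. auto_derive; [exact I|unfold Rminus; ring].
  - intros y Hy. unfold cc. rewrite Rminus_diag, Rmult_0_r, exp_0.
    specialize (HuS y Hy). lra.
  - intros t Ht Hneg. destruct (Bu t Ht) as [E _]. rewrite E. specialize (Hcc t). nra.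
  - intros t Ht Hneg. destruct (Bu t Ht) as [_ E]. rewrite E. specialize (Hcc t). nra.
  - intros y t Hy Hyc Ht. destruct (Eu y t Hy Hyc Ht) as [uxx [D E]].
    destruct (Ep y Hy Hyc) as [pxx [Dp Epp]].
    exists (uxx + pxx * cc t). split.
    + apply (is_derive_plus (fun y => ux y t) (fun y => psix y * cc t)); [exact D|].
      apply (is_derive_ext (fun z => cc t * psix z)); [intros; apply Rmult_comm|].
      rewrite (Rmult_comm _ (cc t)). apply is_derive_scal, Dp.
    + intros Hneg. rewrite E. unfold react_u.
      pose proof (solution_u_nonneg y t ltac:(lra) ltac:(lra)) as Hun.
      pose proof (Pp y ltac:(lra)) as Hpy. pose proof (HP y ltac:(lra)) as HPy.
      assert (Hcct : cct t = - mu * cc t) by (unfold cct, cc; ring). rewrite Hcct.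
      assert (Hccb : - c <= cc t).
      { unfold cc. assert (exp (- mu * (t - S)) <= 1).
        { rewrite <- exp_0. apply exp_le_compat. nra. } nra. }
      specialize (Hcc t).
      pose proof (competition_bounds y) as Hk. set (k := m * chi x2 y * ee y) in *.
      assert (Hko : k * om y t <= k * Ombar y + m * ee_max * e /\ 0 <= k * Ombar y).
      { destruct (Rlt_dec y x2) as [Hlt|Hge].
        - specialize (Hom y t ltac:(lra) ltac:(lra)).
          pose proof (Ombar_bounds y ltac:(lra)). split; [|apply Rmult_le_pos; lra].
          assert (k * om y t <= k * (Ombar y + e)) by (apply Rmult_le_compat_l; lra).
          assert (k * e <= m * ee_max * e) by (apply Rmult_le_compat_r; lra). lra.
        - assert (k = 0) as -> by (unfold k; rewrite chi_ge by lra; ring).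
          pose proof (ee_pos x2). fold ee_max in *. nra. }
      destruct Hko as [Hko1 Hko2].
      set (w := k * om y t) in *. set (ob := k * Ombar y) in *.
      set (E0 := m * ee_max * e) in *. set (v := - (psi y * cc t)) in *.
      assert (Hv : 0 < v) by (unfold v; nra).
      assert (Huv : u y t < v) by (unfold v; lra).
      assert (HvP : v <= c * P).
      { unfold v. assert (psi y * - cc t <= P * c) by (apply Rmult_le_compat; lra). lra. }
      assert (HE0 : 0 <= E0).
      { unfold E0. pose proof (ee_pos x2). fold ee_max in *. apply Rmult_le_pos; nra. }
      assert (Hdiff : - cc t * (d1 * pxx - a1 * psix y) >= del * v - v * (r - ob)).
      { assert (- cc t * (del * psi y) <= - cc t * (d1 * pxx - a1 * psix y + psi y * (r - ob)))
          by (apply Rmult_le_compat_l; lra). unfold v. lra. }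
      assert (Hre : u y t * (r - v - ob - E0) <= u y t * (r - u y t - w))
        by (apply Rmult_le_compat_l; lra).
      assert (H1 : 0 <= (v - u y t) * ob) by (apply Rmult_le_pos; lra).
      assert (H2 : 0 <= v * (mu + del - v - E0)) by (apply Rmult_le_pos; lra).
      assert (H3 : 0 <= (v - u y t) * (v + E0)) by (apply Rmult_le_pos; lra).
      replace (psi y * (- mu * cc t)) with (mu * v) by (unfold v; ring).
      replace (psi y * cc t) with (- v) by (unfold v; ring).
      nra.
Qed.

Lemma solution_eventually_above (psi psix : R -> R) (del emax : R) :
  strict_subsolution psi psix del -> 0 < emax ->
  (exists x, 0 <= x <= L /\ u x 0 <> 0) ->
  exists c T, 0 < c <= emax /\ 0 <= T /\
    forall t, T <= t -> forall x, 0 <= x <= L -> c * psi x <= u x t.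
Proof.
  intros Hpsi Hemax [x0 [Hx0 Hne]]. pose proof Hpsi as [Cp [Pp [Hdel _]]].
  assert (Hpos : 0 < u x0 0) by (specialize (Hu0 x0 Hx0); lra).
  destruct (solution_becomes_positive x0 Hx0 Hpos) as [tau [Htau Hut]].
  destruct (cont_on_bounded 0 L psi ltac:(lra) (proj1 Cp)) as [P [HP HpP]].
  assert (HpP' : forall x, 0 <= x <= L -> psi x <= P).
  { intros x Hx. specialize (HpP x Hx). apply Rabs_le_between in HpP. lra. }
  destruct (Hsol tau tau ltac:(lra)) as [[[Cu _] _] _].
  destruct (cont_on_attains_min 0 L (fun x => u x tau)) as [xm [Hxm Hmin]]; [lra| |].
  { apply (cont_on_subset _ (fun x => 0 <= x <= L /\ tau <= tau <= tau)); [intros; lra|].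
    exact (cont2_on_slice _ _ tau Cu). }
  pose proof (Hut xm Hxm) as Hum.
  pose (c1 := u xm tau / P). assert (Hc1 : 0 < c1) by (apply Rdiv_lt_0_compat; lra).
  assert (HcP : c1 * P = u xm tau) by (unfold c1; field; lra).
  pose proof (ee_pos x2) as Hem. fold ee_max in Hem.
  assert (Hme : 0 < m * ee_max) by nra.
  pose (e := del / 2 / (m * ee_max)).
  assert (He : 0 < e) by (unfold e; apply Rdiv_lt_0_compat; lra).
  assert (Hee : m * ee_max * e = del / 2) by (unfold e; field; lra).
  destruct (solution_om_upper e He) as [T0 [HT0 Hom]].
  pose (T1 := Rmax tau T0).
  assert (HT1 : tau <= T1 /\ T0 <= T1) by (split; [apply Rmax_l|apply Rmax_r]).
  clearbody T1.
  destruct (solution_bounded tau T1 ltac:(lra) ltac:(lra)) as [M [HM [_ M2]]].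
  pose (mu := c1 * P + m * ee_max * M).
  assert (Hmu : 0 <= mu) by (unfold mu; nra).
  assert (Hstep : forall x, 0 <= x <= L -> c1 * exp (- mu * (T1 - tau)) * psi x <= u x T1).
  { apply (solution_above_subsolution psi psix del P M); auto; try lra.
    - unfold mu. lra.
    - intros x t Hx Ht. specialize (M2 x t Hx Ht). apply Rabs_le_between in M2.
      pose proof (Ombar_bounds x Hx). lra.
    - intros x Hx. specialize (Hmin x Hx). specialize (HpP' x Hx). nra. }
  pose (c2 := c1 * exp (- mu * (T1 - tau))).
  assert (Hc2 : 0 < c2) by (apply Rmult_lt_0_compat; [exact Hc1|apply exp_pos]).
  fold c2 in Hstep. clearbody c2.
  pose (c := Rmin c2 (Rmin emax (del / 2 / P))).
  assert (Hdp : 0 < del / 2 / P) by (apply Rdiv_lt_0_compat; lra).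
  assert (Hc : 0 < c /\ c <= c2 /\ c <= emax /\ c <= del / 2 / P).
  { unfold c. clear - Hc2 Hemax Hdp. minmax. }
  clearbody c. destruct Hc as [Hc0 [Hcc2 [Hce Hcd]]].
  exists c, T1. split; [lra|]. split; [lra|]. intros t Ht x Hx.
  replace (c * psi x) with (c * exp (- 0 * (t - T1)) * psi x)
    by (rewrite Ropp_0, Rmult_0_l, exp_0; ring).
  apply (solution_above_subsolution psi psix del P e); auto; try lra.
  - assert (c * P <= del / 2 / P * P) by (apply Rmult_le_compat_r; lra).
    replace (del / 2 / P * P) with (del / 2) in H by (field; lra). lra.
  - intros y s Hy Hs. apply Hom; lra.
  - intros y Hy. specialize (Hstep y Hy). specialize (Pp y Hy). nra.
Qed.

Lemma Fu_react (x t : R) : react_u u om x t + KK * u x t = Fu x (u x t) (om x t).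
Proof. unfold react_u, Fu. ring. Qed.

Lemma Gw_react (x t : R) : react_w u om x t + KK * om x t = Gw x (u x t) (om x t).
Proof. unfold react_w, Gw. ring. Qed.

Lemma solution_eventually_in_box : exists T, 0 <= T /\ forall t, T <= t ->
  (forall x, 0 <= x <= L -> 0 <= u x t <= r + 1) /\
  (forall x, 0 <= x <= x2 -> 0 <= om x t <= om_max + 1).
Proof.
  destruct (solution_u_upper 1 ltac:(lra)) as [T1 [HT1 H1]].
  destruct (solution_om_upper 1 ltac:(lra)) as [T2 [HT2 H2]].
  exists (T1 + T2). split; [lra|]. intros t Ht. split; intros x Hx.
  - split; [apply solution_u_nonneg; lra|apply H1; lra].
  - split; [apply solution_om_nonneg; lra|].
    specialize (H2 t ltac:(lra) x Hx). pose proof (Ombar_bounds x Hx). lra.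
Qed.

Definition eventually_between (v th v' th' : R -> R) : Prop :=
  forall eps, 0 < eps -> exists T, 0 <= T /\ forall t, T <= t ->
    (forall x, 0 <= x <= L -> v x - eps <= u x t <= v' x + eps) /\
    (forall x, 0 <= x <= x2 -> th' x - eps <= om x t <= th x + eps).

Lemma eventually_between_step (v th v' th' : R -> R) :
  cts2 v th -> box v th -> cts2 v' th' -> box v' th' ->
  eventually_between v th v' th' ->
  eventually_between (stepu v th) (stepw v th) (stepu v' th') (stepw v' th').
Proof.
  intros [Cv Cth] [Bv Bth] [Cv' Cth'] [Bv' Bth'] Hev eps Heps.
  pose proof KK_pos as HK. pose proof lipF_pos as HlF. pose proof robin_coef_nonneg as Hgam.
  destruct (stepu_solution v th Cv Cth) as [_ Su].
  destruct (stepw_solution v th Cv Cth) as [_ Sw].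
  destruct (stepu_solution v' th' Cv' Cth') as [_ Su'].
  destruct (stepw_solution v' th' Cv' Cth') as [_ Sw'].
  pose (e := eps * KK / 2 / lipF).
  assert (He : 0 < e) by (unfold e; apply Rdiv_lt_0_compat; [nra|lra]).
  assert (Hle : lipF * e = eps * KK / 2) by (unfold e; field; lra).
  assert (Hle0 : 0 < lipF * e) by nra.
  destruct (Hev e He) as [T0 [HT0 H0]].
  destruct solution_eventually_in_box as [T1 [HT1 H1]].
  assert (HF : forall x t, 0 < x < L -> T0 + T1 < t ->
    Fu x (v x) (th x) - lipF * e <= react_u u om x t + KK * u x t
      <= Fu x (v' x) (th' x) + lipF * e).
  { intros x t Hx Ht. rewrite Fu_react.
    destruct (H0 t ltac:(lra)) as [A1 A2]. destruct (H1 t ltac:(lra)) as [B1 B2].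
    specialize (A1 x ltac:(lra)). specialize (B1 x ltac:(lra)).
    specialize (Bv x ltac:(lra)). specialize (Bv' x ltac:(lra)).
    assert (Hw : x < x2 -> th' x - e <= om x t <= th x + e /\ 0 <= om x t <= om_max + 1 /\
      0 <= th' x <= om_max).
    { intros Hlt. specialize (Bth' x ltac:(lra)). pose proof (Ombar_bounds x ltac:(lra)).
      split; [apply A2; lra|]. split; [apply B2; lra|lra]. }
    split.
    - enough (Fu x (v x) (th x) <= Fu x (u x t) (om x t) + lipF * e) by lra.
      apply Fu_compare; lra.
    - apply Fu_compare; lra. }
  assert (HG : forall x t, 0 < x < x2 -> T0 + T1 < t ->
    Gw x (v' x) (th' x) - lipF * e <= react_w u om x t + KK * om x t
      <= Gw x (v x) (th x) + lipF * e).
  { intros x t Hx Ht. rewrite Gw_react.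
    destruct (H0 t ltac:(lra)) as [A1 A2]. destruct (H1 t ltac:(lra)) as [B1 B2].
    specialize (A1 x ltac:(lra)). specialize (B1 x ltac:(lra)).
    specialize (A2 x ltac:(lra)). specialize (B2 x ltac:(lra)).
    specialize (Bv x ltac:(lra)). specialize (Bv' x ltac:(lra)).
    specialize (Bth x ltac:(lra)). specialize (Bth' x ltac:(lra)).
    pose proof (Ombar_bounds x ltac:(lra)).
    split.
    - enough (Gw x (v' x) (th' x) <= Gw x (u x t) (om x t) + lipF * e) by lra.
      apply Gw_compare; lra.
    - apply Gw_compare; lra. }
  assert (HT : 0 <= T0 + T1) by lra. assert (H00 : 0 <= 0) by lra.
  destruct (robin_asymptotic_lower _ _ _ _ _ _ (T0 + T1) (lipF * e) _ _ _ _ u ux ut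
    Hd1 Hgam HK HL Hle0 Su (fun T => proj1 (Hsol _ T HT))
    (fun x t Hx _ Ht => proj1 (HF x t Hx Ht))) as [S1 [HS1 U1]].
  destruct (robin_asymptotic_upper _ _ _ _ _ _ (T0 + T1) (lipF * e) _ _ _ _ u ux ut
    Hd1 Hgam HK HL Hle0 Su' (fun T => proj1 (Hsol _ T HT))
    (fun x t Hx _ Ht => proj2 (HF x t Hx Ht))) as [S2 [HS2 U2]].
  destruct (robin_asymptotic_lower _ _ _ _ _ _ (T0 + T1) (lipF * e) _ _ _ _ om omx omt
    Hd2 H00 HK (proj1 Hx2) Hle0 Sw' (fun T => proj2 (Hsol _ T HT))
    (fun x t Hx _ Ht => proj1 (HG x t Hx Ht))) as [S3 [HS3 U3]].
  destruct (robin_asymptotic_upper _ _ _ _ _ _ (T0 + T1) (lipF * e) _ _ _ _ om omx omt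
    Hd2 H00 HK (proj1 Hx2) Hle0 Sw (fun T => proj2 (Hsol _ T HT))
    (fun x t Hx _ Ht => proj2 (HG x t Hx Ht))) as [S4 [HS4 U4]].
  assert (E : 2 * (lipF * e / KK) = eps) by (rewrite Hle; field; lra).
  exists (S1 + S2 + S3 + S4). split; [lra|]. intros t Ht. split; intros x Hx.
  - specialize (U1 t ltac:(lra) x Hx). specialize (U2 t ltac:(lra) x Hx). lra.
  - specialize (U3 t ltac:(lra) x Hx). specialize (U4 t ltac:(lra) x Hx). lra.
Qed.

Lemma eventually_between_iter (v th v' th' : R -> R) (n : nat) :
  cts2 v th -> box v th -> cts2 v' th' -> box v' th' ->
  eventually_between v th v' th' ->
  eventually_between (iu v th n) (iw v th n) (iu v' th' n) (iw v' th' n).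
Proof.
  intros Hc Hb Hc' Hb' Hev. induction n as [|n IH]; [exact Hev|].
  destruct (iter_invariant v th n Hc Hb), (iter_invariant v' th' n Hc' Hb').
  apply (eventually_between_step (iu v th n) (iw v th n) (iu v' th' n) (iw v' th' n));
    assumption.
Qed.

End Solution.

Lemma coexistence_om_pos (U Ux Om Omx : R -> R) :
  coexistence_pair U Ux Om Omx -> forall x, 0 <= x <= x2 -> 0 < Om x.
Proof.
  intros [_ [SO B]] x Hx. pose proof KK_pos as HK. pose proof (ee_pos x2) as He.
  fold ee_max in He. pose proof om_max_pos.
  pose (k := h / (ee_max * KK)).
  assert (Hk : 0 < k) by (apply Rdiv_lt_0_compat; nra).
  apply Rlt_le_trans with k; [exact Hk|].
  apply (robin_le d2 a2 0 KK x2 x2 (fun _ => KK * k) (fun x => Gw x (U x) (Om x))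
    (fun _ => k) (fun _ => 0) Om Omx); auto; try lra.
  - split; [apply C1on_const|]. split; [lra|]. split; [lra|].
    intros y Hy Hyc. exists 0. split; [|lra].
    apply is_derive_const_R.
  - apply robin_solution_super, SO.
  - intros y Hy _. pose proof (box_bounds_w U Om y B ltac:(lra)). destruct B as [BU _].
    specialize (BU y ltac:(lra)).
    apply Rle_trans with (Gw y (U y) 0); [|apply Gw_mono; lra].
    unfold Gw. rewrite Rmult_0_r, Rplus_0_r.
    replace (KK * k) with (h / ee_max) by (unfold k; field; lra).
    pose proof (src_ee y) as Es. pose proof (ee_le_max y ltac:(lra)).
    pose proof (src_pos y). apply Rmult_le_reg_r with ee_max; [exact He|].
    replace (h / ee_max * ee_max) with h by (field; lra). nra.
Qed.

Lemma coexistence_pair_steady (U Ux Om Omx : R -> R) :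
  coexistence_pair U Ux Om Omx -> (forall x, 0 <= x <= L -> 0 < U x) ->
  is_coexistence_steady_state d1 d2 r m p q h L a1 a2 x2 U (fun x => ee x * Om x).
Proof.
  intros Hpair HU. pose proof (coexistence_om_pos _ _ _ _ Hpair) as HO.
  destruct Hpair as [[CU [U0 [UL EU]]] [[CO [O0 [Ol EO]]] _]].
  assert (Hbe : d2 * (a2 / d2) = a2) by (field; lra).
  assert (Hga : d1 * (a1 / d1) = a1) by (field; lra).
  assert (Cee : C1on 0 x2 ee (fun x => a2 / d2 * ee x)).
  { apply (C1on_of_derive 0 x2 ee _ (fun x => a2 / d2 * (a2 / d2 * ee x)) ee_derive). intros x.
    apply is_derive_scal, ee_derive. }
  pose proof (C1on_mult 0 x2 _ _ _ _ Cee CO) as CW.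
  split; [|split; [exact HU|]].
  2:{ intros x Hx. apply Rmult_lt_0_compat; [apply ee_pos|apply HO, Hx]. }
  exists (fun x _ => Ux x), (fun _ _ => 0),
    (fun x _ => a2 / d2 * ee x * Om x + ee x * Omx x), (fun _ _ => 0).
  assert (F : forall l (f : R -> R) D, cont_on (fun x => 0 <= x <= l) f ->
    cont2_on (fun x t => 0 <= x <= l /\ D t) (fun x _ => f x)).
  { intros l f D Hf. apply (cont2_on_fst _ (fun x => 0 <= x <= l)); [tauto|exact Hf]. }
  split; [apply F, CU|]. split; [apply F, CW|]. split; [apply F, CU|].
  split; [apply cont2_on_const|]. split; [apply F, CW|]. split; [apply cont2_on_const|].
  assert (Dc : forall (k t : R), is_derive (fun _ : R => k) t 0)
    by (intros; apply is_derive_const_R).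
  split; [|split; [|split]].
  - intros x t Hx Ht. split; [apply CU, Hx|apply Dc].
  - intros x t Hx Hxc Ht. destruct (EU x Hx Hxc) as [uxx [D E]].
    exists uxx. split; [exact D|]. unfold Fu in E. lra.
  - intros x t Hx Ht. split; [apply CW, Hx|]. split; [apply Dc|].
    destruct (EO x Hx ltac:(lra)) as [oxx [D E]].
    assert (DO : is_derive Om x (Omx x)) by apply CO, Hx.
    exists (a2 / d2 * (a2 / d2 * ee x * Om x + ee x * Omx x)
            + (a2 / d2 * ee x * Omx x + ee x * oxx)). split.
    + apply (is_derive_plus (fun y => a2 / d2 * ee y * Om y) (fun y => ee y * Omx y)).
      * apply (is_derive_ext (fun y => a2 / d2 * (ee y * Om y))); [intros; symmetry; apply Rmult_assoc|].
        apply is_derive_scal, is_derive_mult_R; [apply ee_derive|exact DO].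
      * apply is_derive_mult_R; [apply ee_derive|exact D].
    + unfold Gw in E. rewrite <- (src_ee x).
      transitivity (ee x * (d2 * oxx + a2 * Omx x - KK * Om x
        + (src x + (KK - q - p * U x) * Om x))).
      * rewrite E. ring.
      * field. lra.
  - intros t Ht. rewrite U0, UL, O0, Ol. repeat split.
    + field. lra.
    + field. lra.
    + field. lra.
Qed.

Lemma coexistence_of_subsolution (psi psix : R -> R) (del : R) :
  m <= / p * exp (- Rabs (a1 / d1 - a2 / d2) * x2) ->
  (forall x, 0 <= x <= x2 -> (ee x * Ombar x) ^ 2 <= h) ->
  strict_subsolution psi psix del ->
  unique_GAS_coexistence d1 d2 r m p q h L a1 a2 x2.
Proof.
  intros Hmp Hwh Hpsi.
  pose proof Hpsi as [Cp [Pp [Hdel [Bp0 [BpL Ep]]]]].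
  pose proof om_max_pos as Hom. pose proof KK_pos as HK. pose proof robin_coef_nonneg as Hgam.
  pose proof (ee_pos x2) as Hem. fold ee_max in Hem.
  destruct (cont_on_bounded 0 L psi ltac:(lra) (proj1 Cp)) as [P [HP HpP]].
  assert (HpP' : forall x, 0 <= x <= L -> psi x <= P).
  { intros x Hx. specialize (HpP x Hx). apply Rabs_le_between in HpP. lra. }
  assert (Hcu : cts2 (fun _ => r) (fun _ => 0)) by (split; intros; apply continuous_const).
  assert (Hbu : box (fun _ => r) (fun _ => 0)).
  { split; intros x Hx; [lra|]. pose proof (Ombar_bounds x Hx). lra. }
  assert (Hsu : cle (stepu (fun _ => r) (fun _ => 0)) (stepw (fun _ => r) (fun _ => 0))
                  (fun _ => r) (fun _ => 0)).
  { destruct (step_box _ _ Hcu Hbu) as [B1 B2]. split; intros x Hx; [apply B1|apply B2]; exact Hx. }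
  destruct (monotone_iter_limit _ _ Hcu Hbu (or_intror Hsu))
    as [U [Ux [Om [Omx [UU [UO Hpair]]]]]].
  pose (emax := Rmin (r / P) (del / P)).
  assert (Hemax : 0 < emax) by (apply Rmin_glb_lt; apply Rdiv_lt_0_compat; lra).
  assert (HeP : emax * P <= r /\ emax * P <= del).
  { pose proof (Rmin_l (r / P) (del / P)). pose proof (Rmin_r (r / P) (del / P)).
    fold emax in H, H0.
    replace r with (r / P * P) at 1 by (field; lra).
    replace del with (del / P * P) at 1 by (field; lra).
    split; apply Rmult_le_compat_r; lra. }
  clearbody emax.
  pose (low := fun c x => c * psi (clamp 0 L x)).
  assert (Elow : forall c x, 0 <= x <= L -> low c x = c * psi x)
    by (intros c x Hx; unfold low; rewrite clamp_id; auto).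
  assert (Hlow : forall c, 0 < c <= emax ->
    cts2 (low c) Ombar /\ box (low c) Ombar /\
    cle (low c) Ombar (stepu (low c) Ombar) (stepw (low c) Ombar)).
  { intros c Hc.
    assert (Hcl : cts2 (low c) Ombar).
    { split; [|apply Ombar_continuous]. intros x.
      apply (continuous_mult (fun _ => c) (fun x => psi (clamp 0 L x)));
        [apply continuous_const|]. apply continuous_clamp; [lra|apply Cp]. }
    assert (HcP : forall x, 0 <= x <= L -> 0 < c * psi x <= emax * P).
    { intros x Hx. specialize (Pp x Hx). specialize (HpP' x Hx). nra. }
    assert (Hbl : box (low c) Ombar).
    { split; intros x Hx.
      - rewrite Elow by exact Hx. specialize (HcP x Hx). lra.
      - pose proof (Ombar_bounds x Hx). lra. }
    split; [exact Hcl|]. split; [exact Hbl|].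
    split; intros x Hx.
    - rewrite Elow by exact Hx.
      destruct (stepu_solution (low c) Ombar (proj1 Hcl) (proj2 Hcl)) as [_ Su].
      apply (robin_le d1 (- a1) (a1 / d1) KK L x2
        (fun x => Fu x (low c x) (Ombar x)) (fun x => Fu x (low c x) (Ombar x))
        (fun x => c * psi x) (fun x => c * psix x) (stepu (low c) Ombar) (stepux (low c) Ombar));
        auto; try lra.
      + split; [apply C1on_scal, Cp|]. split; [nra|]. split; [nra|].
        intros y Hy Hyc. destruct (Ep y Hy Hyc) as [pxx [D E]].
        exists (c * pxx). split; [apply is_derive_scal, D|].
        rewrite Elow by lra. unfold Fu. specialize (HcP y ltac:(lra)).
        set (w := m * chi x2 y * ee y * Ombar y) in *.
        assert (E' : c * (del * psi y)
           <= c * (d1 * pxx - a1 * psix y + psi y * (r - w)))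
          by (apply Rmult_le_compat_l; lra).
        nra.
      + apply robin_solution_super, Su.
      + intros; lra.
    - apply (step_box _ _ Hcl Hbl). exact Hx. }
  assert (Hlim : forall c, 0 < c <= emax -> (forall x, 0 <= x <= L -> 0 < U x) /\
    unif_seq L (iu (low c) Ombar) U /\ unif_seq x2 (iw (low c) Ombar) Om).
  { intros c Hc. destruct (Hlow c Hc) as [Hcl [Hbl Hsl]].
    destruct (monotone_iter_limit _ _ Hcl Hbl (or_introl Hsl))
      as [V [Vx [Th [Thx [UV [UT Hpair']]]]]].
    assert (Hle0 : cle (low c) Ombar (fun _ => r) (fun _ => 0)).
    { destruct Hbl as [B1 _]. split; intros x Hx; [apply B1, Hx|].
      pose proof (Ombar_bounds x Hx). lra. }
    assert (Hmono : forall n, cle (low c) Ombar (iu (low c) Ombar n) (iw (low c) Ombar n)).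
    { induction n as [|n [I1 I2]]; [split; intros; unfold iu, iw; simpl; lra|].
      destruct (iter_increasing _ _ n Hcl Hbl Hsl) as [J1 J2].
      split; intros x Hx.
      - specialize (I1 x Hx). specialize (J1 x Hx). lra.
      - specialize (I2 x Hx). specialize (J2 x Hx). lra. }
    assert (HV : forall x, 0 <= x <= L -> 0 < V x).
    { intros x Hx.
      assert (low c x <= V x <= r).
      { apply (unif_seq_bounds L (iu (low c) Ombar) V x); auto. intros n.
        split; [apply Hmono, Hx|]. apply (iter_invariant _ _ n Hcl Hbl), Hx. }
      rewrite Elow in H by exact Hx. specialize (Pp x Hx). nra. }
    assert (HVU : cle V Th U Om).
    { split; intros x Hx.
      - enough (V x - U x <= 0) by lra. apply (Rle_of_eps _ 2). intros eps Heps.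
        destruct (UV eps Heps) as [N1 H1]. destruct (UU eps Heps) as [N2 H2].
        specialize (H1 (N1 + N2)%nat ltac:(lia) x Hx).
        specialize (H2 (N1 + N2)%nat ltac:(lia) x Hx).
        destruct (iter_cle _ _ _ _ (N1 + N2)%nat Hcl Hcu Hbl Hbu Hle0) as [I1 _].
        specialize (I1 x Hx). apply Rabs_le_between in H1, H2. lra.
      - enough (Om x - Th x <= 0) by lra. apply (Rle_of_eps _ 2). intros eps Heps.
        destruct (UT eps Heps) as [N1 H1]. destruct (UO eps Heps) as [N2 H2].
        specialize (H1 (N1 + N2)%nat ltac:(lia) x Hx).
        specialize (H2 (N1 + N2)%nat ltac:(lia) x Hx).
        destruct (iter_cle _ _ _ _ (N1 + N2)%nat Hcl Hcu Hbl Hbu Hle0) as [_ I2].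
        specialize (I2 x Hx). apply Rabs_le_between in H1, H2. lra. }
    destruct (ordered_pairs_equal U Ux Om Omx V Vx Th Thx Hmp Hwh Hpair Hpair' HVU HV
      (coexistence_om_pos _ _ _ _ Hpair)) as [EU EO].
    split; [|split].
    - intros x Hx. rewrite EU by exact Hx. apply HV, Hx.
    - intros eps Heps. destruct (UV eps Heps) as [N HN]. exists N. intros n Hn x Hx.
      rewrite EU by exact Hx. apply HN; assumption.
    - intros eps Heps. destruct (UT eps Heps) as [N HN]. exists N. intros n Hn x Hx.
      rewrite EO by exact Hx. apply HN; assumption. }
  destruct (Hlim emax ltac:(lra)) as [HUpos _].
  assert (Hgas : forall u w, is_solution d1 d2 r m p q h L a1 a2 x2 u w ->
    admissible_initial L x2 u w ->
    unif_conv 0 L u U /\ unif_conv 0 x2 w (fun x => ee x * Om x)).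
  { intros u w Hs [I1 [I2 [I3 _]]].
    destruct (solution_transform u w Hs) as [ux [ut [omx [omt Ht]]]].
    assert (I3' : forall x, 0 <= x <= x2 -> 0 <= om_of w x 0).
    { intros x Hx. apply Rmult_le_pos; [left; apply exp_pos|apply I3, Hx]. }
    destruct (solution_eventually_above u ux ut (om_of w) omx omt Ht I1 I3' psi psix del
      emax Hpsi Hemax I2) as [c [T0 [Hc [HT0 HuT0]]]].
    destruct (Hlow c Hc) as [Hcl [Hbl Hsl]]. destruct (Hlim c Hc) as [_ [LU LO]].
    assert (Hbetween : eventually_between u (om_of w) (low c) Ombar (fun _ => r) (fun _ => 0)).
    { intros eps Heps.
      destruct (solution_u_upper u ux ut (om_of w) omx omt Ht I1 I3' eps Heps)
        as [T1 [HT1 H1]].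
      destruct (solution_om_upper u ux ut (om_of w) omx omt Ht I1 I3' eps Heps)
        as [T2 [HT2 H2]].
      exists (T0 + T1 + T2). split; [lra|]. intros t Htt. split; intros x Hx.
      - rewrite Elow by exact Hx. specialize (HuT0 t ltac:(lra) x Hx).
        specialize (H1 t ltac:(lra) x Hx). lra.
      - pose proof (solution_om_nonneg u ux ut (om_of w) omx omt Ht I1 I3' x t Hx ltac:(lra)).
        specialize (H2 t ltac:(lra) x Hx). lra. }
    assert (Hconv : forall eps, 0 < eps -> exists T, forall t, T <= t ->
      (forall x, 0 <= x <= L -> Rabs (u x t - U x) <= 2 * eps) /\
      (forall x, 0 <= x <= x2 -> Rabs (om_of w x t - Om x) <= 2 * eps)).
    { intros eps Heps.
      destruct (UU eps Heps) as [N1 H1]. destruct (UO eps Heps) as [N2 H2].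
      destruct (LU eps Heps) as [N3 H3]. destruct (LO eps Heps) as [N4 H4].
      pose (n := (N1 + N2 + N3 + N4)%nat).
      destruct (eventually_between_iter u ux ut (om_of w) omx omt Ht I1 I3' _ _ _ _ n
        Hcl Hbl Hcu Hbu Hbetween eps Heps) as [T [_ K]].
      exists T. intros t Htt. destruct (K t Htt) as [A B]. split; intros x Hx.
      - specialize (A x Hx). specialize (H1 n ltac:(unfold n; lia) x Hx).
        specialize (H3 n ltac:(unfold n; lia) x Hx).
        apply Rabs_le_between in H1, H3. apply Rabs_le. lra.
      - specialize (B x Hx). specialize (H2 n ltac:(unfold n; lia) x Hx).
        specialize (H4 n ltac:(unfold n; lia) x Hx).
        apply Rabs_le_between in H2, H4. apply Rabs_le. lra. }
    split; intros eps Heps.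
    - destruct (Hconv (eps / 3) ltac:(lra)) as [T HT]. exists T. intros t Htt x Hx.
      destruct (HT t Htt) as [H1 _]. specialize (H1 x Hx). lra.
    - assert (He : 0 < eps / (3 * ee_max)) by (apply Rdiv_lt_0_compat; lra).
      destruct (Hconv _ He) as [T HT]. exists T. intros t Htt x Hx.
      destruct (HT t Htt) as [_ H2]. specialize (H2 x Hx).
      rewrite <- (om_of_ee w x t).
      replace (ee x * om_of w x t - ee x * Om x) with (ee x * (om_of w x t - Om x)) by ring.
      rewrite Rabs_mult, (Rabs_right (ee x)) by (left; apply ee_pos).
      apply Rle_lt_trans with (ee_max * (2 * (eps / (3 * ee_max)))).
      + apply Rmult_le_compat; [left; apply ee_pos|apply Rabs_pos|apply ee_le_max; lra|exact H2].
      + replace (ee_max * (2 * (eps / (3 * ee_max)))) with (2 * eps / 3) by (field; lra). lra. }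
  exists U, (fun x => ee x * Om x).
  split; [apply (coexistence_pair_steady U Ux Om Omx); assumption|]. split; [|exact Hgas].
  intros U' W' [Hst [PU PW]].
  destruct (Hgas (fun x _ => U' x) (fun x _ => W' x) Hst) as [G1 G2].
  { split; [intros x Hx; left; apply PU, Hx|]. split.
    - exists 0. split; [lra|]. specialize (PU 0 ltac:(lra)). lra.
    - split; [intros x Hx; left; apply PW, Hx|].
      exists 0. split; [lra|]. specialize (PW 0 ltac:(lra)). lra. }
  assert (Heq : forall a b, (forall eps, 0 < eps -> Rabs (a - b) < eps) -> a = b).
  { intros a b H. enough (Rabs (a - b) <= 0) as H0.
    - pose proof (Rabs_pos (a - b)).
      assert (E : Rabs (a - b) = 0) by lra. apply Rabs_eq_0 in E. lra.
    - apply (Rle_of_eps _ 1). intros eps Heps. specialize (H eps Heps). lra. }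
  split; intros x Hx; apply Heq; intros eps Heps.
  - destruct (G1 eps Heps) as [T HT]. apply (HT T); [lra|exact Hx].
  - destruct (G2 eps Heps) as [T HT]. apply (HT T); [lra|exact Hx].
Qed.

Lemma wbar_nondecreasing (W : R -> R) :
  is_wbar d2 q h a2 x2 W -> forall x, 0 <= x <= x2 -> W x <= W x2.
Proof.
  intros [Wx [CW [CWx [E [B0 [B1 PW]]]]]] x Hx.
  assert (HWx : forall y, 0 <= y <= x2 -> 0 <= Wx y).
  { pose (Wxx := fun y => (a2 * Wx y + -1 * h + q * W y) * / d2).
    assert (Hbd : forall y, d2 * Wx y - a2 * W y = 0 -> 0 < W y -> 0 <= Wx y).
    { intros y Ey Py. apply Rmult_le_reg_l with d2; [exact Hd2|]. nra. }
    apply (elliptic_minimum_principle 0 x2 x2 d2 (- a2) q Wx Wxx); auto; try lra.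
    - split; [exact CWx|]. split.
      + unfold Wxx. apply cont_on_mult; [|apply cont_on_const].
        apply cont_on_plus; [apply cont_on_plus|].
        * apply cont_on_mult; [apply cont_on_const|exact CWx].
        * apply cont_on_const.
        * apply cont_on_mult; [apply cont_on_const|exact CW].
      + intros y Hy. destruct (E y Hy) as [_ [l [Dl El]]].
        replace (Wxx y) with l; [exact Dl|]. unfold Wxx.
        apply Rmult_eq_reg_l with d2; [|lra]. field_simplify_eq; lra.
    - intros Hneg. specialize (Hbd 0 B0 (PW 0 ltac:(lra))). lra.
    - intros Hneg. specialize (Hbd x2 B1 (PW x2 ltac:(lra))). lra.
    - intros y Hy _. destruct (E y Hy) as [D [l [Dl El]]].
      exists ((a2 * Wxx y + q * Wx y) / d2). split.
      + assert (Wxx y = l) as ->.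
        { unfold Wxx. apply Rmult_eq_reg_l with d2; [|lra]. field_simplify_eq; lra. }
        unfold Wxx. evar_last.
        * apply (is_derive_ext (fun y => / d2 * (a2 * Wx y + -1 * h + q * W y)));
            [intros; apply Rmult_comm|].
          apply is_derive_scal.
          apply (is_derive_plus (fun y => a2 * Wx y + -1 * h) (fun y => q * W y)).
          -- apply (is_derive_plus (fun y => a2 * Wx y) (fun y => -1 * h)).
             ++ apply is_derive_scal, Dl.
             ++ apply is_derive_const_R.
          -- apply is_derive_scal, D.
        * unfold plus, zero; simpl. field. lra.
      + intros _. right. field. lra. }
  apply nondecreasing_of_derive; [lra| |].
  - restrict CW.
  - intros y Hy. exists (Wx y). split; [apply E; lra|apply HWx; lra].
Qed.

Lemma wbar_eq (W : R -> R) :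
  is_wbar d2 q h a2 x2 W -> forall x, 0 <= x <= x2 -> ee x * Ombar x = W x.
Proof.
  intros [Wx [CW [CWx [E [B0 [B1 _]]]]]] x Hx.
  pose (be := a2 / d2). pose (g := fun x => exp (- be * x)).
  assert (Hbe : a2 = d2 * be) by (unfold be; field; lra).
  assert (Dg : forall x, is_derive g x (- be * g x)).
  { intros y. unfold g. auto_derive; [exact I|ring]. }
  assert (Cg : C1on 0 x2 g (fun x => - be * g x)).
  { apply (C1on_of_derive 0 x2 g _ (fun x => - be * (- be * g x)) Dg). intros y. apply is_derive_scal, Dg. }
  assert (F : forall y, d2 * Wx y - a2 * W y = 0 -> Wx y = be * W y).
  { intros y Ey. apply Rmult_eq_reg_l with d2; [|lra]. rewrite Hbe in Ey. lra. }
  assert (Hs : robin_solution d2 a2 0 q x2 x2 src (fun x => g x * W x)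
                 (fun x => - be * g x * W x + g x * Wx x)).
  { split; [|split; [|split]].
    - apply (C1on_mult 0 x2 g (fun x => - be * g x) W Wx Cg).
      split; [exact CW|]. split; [exact CWx|]. intros y Hy. apply E, Hy.
    - rewrite (F 0 B0). ring.
    - rewrite (F x2 B1). ring.
    - intros y Hy _. destruct (E y Hy) as [D [l [Dl El]]].
      exists (- be * (- be * g y * W y + g y * Wx y) + (- be * g y * Wx y + g y * l)). split.
      + apply (is_derive_plus (fun x => - be * g x * W x) (fun x => g x * Wx x)).
        * apply (is_derive_ext (fun x => - be * (g x * W x)));
            [intros; symmetry; apply Rmult_assoc|].
          apply is_derive_scal, is_derive_mult_R; [apply Dg|exact D].
        * apply is_derive_mult_R; [apply Dg|exact Dl].
      + unfold src. fold be. fold (g y).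
        transitivity (g y * (d2 * l - a2 * Wx y + h - q * W y)).
        * rewrite Hbe. ring.
        * rewrite El. ring. }
  assert (H1 : Ombar x <= g x * W x).
  { apply (robin_le d2 a2 0 q x2 x2 src src Ombar Ombarx (fun x => g x * W x)
      (fun x => - be * g x * W x + g x * Wx x)); auto; try lra.
    - apply robin_solution_sub, Ombar_solution.
    - apply robin_solution_super, Hs.
    - intros; lra. }
  assert (H2 : g x * W x <= Ombar x).
  { apply (robin_le d2 a2 0 q x2 x2 src src (fun x => g x * W x)
      (fun x => - be * g x * W x + g x * Wx x) Ombar Ombarx); auto; try lra.
    - apply robin_solution_sub, Hs.
    - apply robin_solution_super, Ombar_solution.
    - intros; lra. }
  replace (Ombar x) with (g x * W x) by lra.
  unfold g, ee. fold be. rewrite <- Rmult_assoc, <- exp_plus.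
  replace (be * x + - be * x) with 0 by ring. rewrite exp_0. ring.
Qed.

(** * Strict subsolutions *)

(* The eigenfunction for [mbar] is only a weak subsolution on (x2, L); the factor
   [exp (eta * g)] makes it strict there, at the expense of the room that
   [m < mbar] leaves on (0, x2). *)
Lemma strict_subsolution_small_zone (wbar : R -> R) (mbar : R) :
  is_wbar d2 q h a2 x2 wbar -> m < mbar ->
  principal_eigenvalue d1 a1 (fun x => r - mbar * chi x2 x * wbar x) 0 L 0 ->
  exists psi psix del, strict_subsolution psi psix del.
Proof.
  intros Hw Hmm [phi [phix [Cf [Cfx [Pf [Df [Ef [B0 BL]]]]]]]].
  pose proof (wbar_eq wbar Hw) as Eqw.
  destruct Hw as [Wx [CW [_ [EW [_ [_ PW]]]]]].
  assert (Ef' : forall x, 0 < x < L -> x <> x2 -> exists l : R, is_derive phix x l /\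
     d1 * l - a1 * phix x + (r - mbar * chi x2 x * wbar x) * phi x = 0).
  { intros x Hx Hxc. destruct (Ef x Hx) as [l [Dl El]].
    - destruct (Rlt_dec x x2) as [Hlt|Hge].
      + apply (continuity_pt_ext_loc (fun x => r - mbar * wbar x)).
        * apply (filter_imp (fun y => 0 < y < x2)); [|apply locally_open_interval; lra].
          intros y Hy. rewrite chi_lt by lra. ring.
        * destruct (EW x ltac:(lra)) as [D _].
          apply (is_derive_continuity_pt _ x (0 - mbar * Wx x)).
          apply (is_derive_minus (fun _ => r) (fun x => mbar * wbar x)).
          -- apply is_derive_const_R.
          -- apply is_derive_scal, D.
      + apply (continuity_pt_ext_loc (fun _ => r)).
        * apply (filter_imp (fun y => x2 < y < L)); [|apply locally_open_interval; lra].
          intros y Hy. rewrite chi_ge by lra. ring.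
        * apply continuity_pt_const. intros ? ?; reflexivity.
    - exists l. split; [exact Dl|]. lra. }
  destruct (cont_on_attains_min 0 L phi ltac:(lra) Cf) as [xm [Hxm Hmin]].
  pose proof (Pf xm Hxm) as Hf0. set (f0 := phi xm) in *.
  destruct (cont_on_bounded 0 L phix ltac:(lra) Cfx) as [M1 [HM1 Hfx]].
  destruct (cont_on_attains_min 0 x2 wbar ltac:(lra) CW) as [xw [Hxw Hminw]].
  pose proof (PW xw Hxw) as Hw0. set (w0 := wbar xw) in *.
  pose (be := 2 * M1 / f0 + a1 / d1).
  assert (Hbe : 0 < be).
  { unfold be. apply Rplus_lt_0_compat; apply Rdiv_lt_0_compat; lra. }
  pose (G := (2 + be * L) / x2).
  assert (HG : G * x2 = 2 + be * L) by (unfold G; field; lra).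
  assert (HG0 : 0 < G) by (unfold G; apply Rdiv_lt_0_compat; nra).
  clearbody G.
  pose (E := fun x => exp (G * (L - x))).
  pose (g := fun x => (x / G + / G ^ 2) * E x + x ^ 2 / 2).
  pose (k := fun x => x - x * E x).
  pose (kx := fun x => 1 - E x + G * x * E x).
  assert (DE : forall x, is_derive E x (- G * E x)).
  { intros x. unfold E. auto_derive; [exact I|unfold Rminus; ring]. }
  assert (Dg : forall x, is_derive g x (k x)).
  { intros x. unfold g, k. evar_last.
    - apply (is_derive_plus (fun x => (x / G + / G ^ 2) * E x) (fun x => x ^ 2 / 2)).
      + apply (is_derive_mult_R (fun x => x / G + / G ^ 2) E x (/ G)); [|apply DE].
        auto_derive; [exact I|]. field. lra.
      + auto_derive; [exact I|reflexivity].
    - unfold plus; simpl. field. lra. }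
  assert (Dk : forall x, is_derive k x (kx x)).
  { intros x. unfold k, kx. evar_last.
    - apply (is_derive_minus (fun x => x) (fun x => x * E x)).
      + apply (is_derive_id (K := R_AbsRing)).
      + apply (is_derive_mult_R (fun x => x) E x 1); [|apply DE].
        apply (is_derive_id (K := R_AbsRing)).
    - unfold minus, plus, opp, one; simpl. ring. }
  assert (Ckx : cont_on (fun x => 0 <= x <= L) kx).
  { apply (is_derive_cont_on _ kx (fun x => G * E x + (G * E x - G * x * (G * E x)))).
    intros x. unfold kx, E. auto_derive; [exact I|unfold Rminus; ring]. }
  destruct (cont_on_bounded 0 L k ltac:(lra) (is_derive_cont_on _ k kx Dk)) as [G1 [HG1 Hk1]].
  destruct (cont_on_bounded 0 L kx ltac:(lra) Ckx) as [G2 [HG2 Hk2]].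
  pose (BB := d1 * G2 + G1 * (d1 * be)).
  assert (Hdbe : 0 < d1 * be) by nra.
  assert (HBB : 0 < BB) by (unfold BB; nra).
  pose (room := (mbar - m) * w0). assert (Hroom : 0 < room) by (unfold room; nra).
  pose (eta := room / 2 / BB).
  assert (Heta : 0 < eta) by (unfold eta; apply Rdiv_lt_0_compat; lra).
  assert (HetaB : eta * BB = room / 2) by (unfold eta; field; lra).
  clearbody eta.
  pose (ex := fun x => exp (eta * g x)).
  assert (Dex : forall x, is_derive ex x (eta * k x * ex x)).
  { intros x. unfold ex. evar_last.
    - apply (is_derive_comp exp (fun x => eta * g x)); [apply is_derive_exp|].
      apply is_derive_scal, Dg.
    - unfold scal, mult; simpl. unfold mult; simpl. ring. }
  assert (Dex2 : forall x, is_derive (fun x => eta * k x * ex x) x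
            (eta * kx x * ex x + eta * k x * (eta * k x * ex x))).
  { intros x. apply (is_derive_mult_R (fun x => eta * k x) ex); [|apply Dex].
    apply is_derive_scal, Dk. }
  assert (Pex : forall x, 0 < ex x) by (intros; apply exp_pos).
  assert (Cex : C1on 0 L ex (fun x => eta * k x * ex x)).
  { exact (C1on_of_derive _ _ _ _ _ Dex Dex2). }
  pose (del := Rmin (eta * d1) (room / 2)).
  assert (Hdel : 0 < del /\ del <= eta * d1 /\ del <= room / 2).
  { unfold del. split; [apply Rmin_glb_lt; nra|]. split; [apply Rmin_l|apply Rmin_r]. }
  clearbody del.
  exists (fun x => ex x * phi x), (fun x => eta * k x * ex x * phi x + ex x * phix x), del.
  split; [|split; [|split; [|split; [|split]]]].
  - apply (C1on_mult 0 L ex (fun x => eta * k x * ex x) phi phix Cex).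
    split; [exact Cf|]. split; [exact Cfx|exact Df].
  - intros x Hx. apply Rmult_lt_0_compat; [apply Pex|apply Pf, Hx].
  - apply Hdel.
  - right. assert (phix 0 = a1 / d1 * phi 0) as ->.
    { apply Rmult_eq_reg_l with d1; [|lra]. field_simplify_eq; lra. }
    unfold k. ring.
  - right. rewrite BL. unfold k, E. rewrite Rminus_diag, Rmult_0_r, exp_0. ring.
  - intros x Hx Hxc. destruct (Ef' x Hx Hxc) as [l [Dl El]].
    exists ((eta * kx x * ex x + eta * k x * (eta * k x * ex x)) * phi x
            + eta * k x * ex x * phix x + (eta * k x * ex x * phix x + ex x * l)). split.
    { apply (is_derive_plus (fun x => eta * k x * ex x * phi x) (fun x => ex x * phix x)).
      - apply (is_derive_mult_R (fun x => eta * k x * ex x) phi); [apply Dex2|apply Df, Hx].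
      - apply is_derive_mult_R; [apply Dex|exact Dl]. }
    assert (Echi : m * chi x2 x * ee x * Ombar x = m * (chi x2 x * wbar x)).
    { destruct (Rlt_dec x x2).
      - rewrite <- (Eqw x) by lra. ring.
      - rewrite chi_ge by lra. ring. }
    rewrite Echi. set (c := chi x2 x * wbar x) in *.
    replace (mbar * chi x2 x * wbar x) with (mbar * c) in El by (unfold c; ring).
    pose proof (Pex x) as Px. pose proof (Pf x ltac:(lra)) as Pfx.
    assert (Hlb : del * phi x <= (mbar - m) * c * phi x
       + eta * (d1 * kx x * phi x + k x * (2 * d1 * phix x - a1 * phi x))).
    { assert (Hb : Rabs (2 * d1 * phix x - a1 * phi x) <= d1 * be * phi x).
      { assert (Hfx0 := Hfx x ltac:(lra)). apply Rabs_le_between in Hfx0.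
        assert (Hm0 := Hmin x ltac:(lra)). fold f0 in Hm0.
        assert (M1 <= M1 / f0 * phi x).
        { replace M1 with (M1 / f0 * f0) at 1 by (field; lra).
          apply Rmult_le_compat_l; [left; apply Rdiv_lt_0_compat; lra|exact Hm0]. }
        assert (Eb : d1 * be * phi x = 2 * d1 * (M1 / f0 * phi x) + a1 * phi x)
          by (unfold be; field; lra).
        rewrite Eb. apply Rabs_le. nra. }
      apply Rabs_le_between in Hb. set (Bx := 2 * d1 * phix x - a1 * phi x) in *.
      destruct (Rlt_dec x x2) as [Hlt|Hge].
      - assert (Hc : w0 <= c).
        { unfold c. rewrite chi_lt by exact Hlt. rewrite Rmult_1_l. apply Hminw. lra. }
        assert (A1 := Hk1 x ltac:(lra)). assert (A2 := Hk2 x ltac:(lra)).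
        assert (Hkb : Rabs (k x * Bx) <= G1 * (d1 * be * phi x)).
        { rewrite Rabs_mult. apply Rmult_le_compat; try apply Rabs_pos; [exact A1|].
          apply Rabs_le. lra. }
        apply Rabs_le_between in A2, Hkb.
        assert (Hkxb : - G2 * (d1 * phi x) <= kx x * (d1 * phi x))
          by (apply Rmult_le_compat_r; [nra|lra]).
        assert (Hsum : - BB * phi x <= d1 * kx x * phi x + k x * Bx)
          by (unfold BB; lra).
        assert (Hes : eta * (- BB * phi x) <= eta * (d1 * kx x * phi x + k x * Bx))
          by (apply Rmult_le_compat_l; lra).
        replace (eta * (- BB * phi x)) with (- (room / 2) * phi x) in Hes
          by (rewrite <- HetaB; ring).
        assert (Hr1 : room * phi x <= (mbar - m) * c * phi x).
        { apply Rmult_le_compat_r; [lra|]. unfold room. apply Rmult_le_compat_l; lra. }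
        assert (del * phi x <= room / 2 * phi x) by (apply Rmult_le_compat_r; lra).
        lra.
      - assert (Hc : c = 0) by (unfold c; rewrite chi_ge by lra; ring).
        rewrite Hc.
        assert (HE : 1 <= E x).
        { unfold E. rewrite <- exp_0. apply exp_le_compat. nra. }
        assert (Hk : k x * Bx >= - (x * (E x - 1)) * (d1 * be * phi x)).
        { unfold k. assert (0 <= x * (E x - 1)) by (apply Rmult_le_pos; lra). nra. }
        assert (Hxl : x * (E x - 1) <= L * E x) by nra.
        assert (Hkk : x * (E x - 1) * (d1 * be * phi x) <= L * E x * (d1 * be * phi x))
          by (apply Rmult_le_compat_r; [nra|exact Hxl]).
        assert (Hx2x : G * x2 * E x <= G * x * E x).
        { apply Rmult_le_compat_r; [lra|]. apply Rmult_le_compat_l; lra. }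
        assert (Hkx : 1 + (1 + be * L) * E x <= kx x).
        { unfold kx. rewrite HG in Hx2x. lra. }
        assert (Hkx' : (1 + (1 + be * L) * E x) * (d1 * phi x) <= kx x * (d1 * phi x))
          by (apply Rmult_le_compat_r; [nra|exact Hkx]).
        assert (Hmain : d1 * phi x <= d1 * kx x * phi x + k x * Bx).
        { assert (0 <= E x * (d1 * phi x)) by (apply Rmult_le_pos; [lra|nra]). lra. }
        assert (eta * (d1 * phi x) <= eta * (d1 * kx x * phi x + k x * Bx))
          by (apply Rmult_le_compat_l; lra).
        assert (del * phi x <= eta * d1 * phi x) by (apply Rmult_le_compat_r; lra).
        lra. }
    assert (Hsq : 0 <= d1 * (eta * k x) ^ 2 * phi x).
    { apply Rmult_le_pos; [|lra]. apply Rmult_le_pos; [lra|apply pow2_ge_0]. }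
    assert (Hmul : ex x * (del * phi x) <= ex x * ((mbar - m) * c * phi x
       + eta * (d1 * kx x * phi x + k x * (2 * d1 * phix x - a1 * phi x))
       + d1 * (eta * k x) ^ 2 * phi x)) by (apply Rmult_le_compat_l; lra).
    eapply Rle_trans; [|eapply Rle_trans; [exact Hmul|]]; [right; ring|]. right.
    transitivity (ex x * ((mbar - m) * c * phi x
       + eta * (d1 * kx x * phi x + k x * (2 * d1 * phix x - a1 * phi x))
       + d1 * (eta * k x) ^ 2 * phi x
       + (d1 * l - a1 * phix x + (r - mbar * c) * phi x))); [rewrite El; ring|ring].
Qed.

(* The equation in [w] is the matching condition for a C^1 gluing at [x2] together
   with the Neumann condition at [L]; it has a solution strictly below the
   critical frequency because [L - x2 >= Lstar]. *)
Lemma frequency_exists (l k w0 : R) :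
  0 < k -> 0 < w0 -> PI - atan (w0 / (a1 / (2 * d1))) <= w0 * l ->
  exists w, 0 < w < w0 /\ w * l + atan (w / k) = PI - atan (w / (a1 / (2 * d1))).
Proof.
  intros Hk Hw0 Hl. set (al := a1 / (2 * d1)) in *.
  assert (Hal : 0 < al) by (unfold al; apply Rdiv_lt_0_compat; lra).
  pose (f := fun w => w * l + atan (w / k) - PI + atan (w / al)).
  assert (Cf : continuity f).
  { intros w. apply (is_derive_continuity_pt f w
      (l + / k / (1 + (w / k) ^ 2) + / al / (1 + (w / al) ^ 2))).
    unfold f. auto_derive; [exact I|].
    field. repeat split; nra. }
  assert (F0 : f 0 < 0).
  { unfold f. rewrite Rmult_0_l, !Rdiv_0_l, atan_0. pose proof PI_RGT_0. lra. }
  assert (F1 : 0 < f w0).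
  { unfold f. assert (0 < atan (w0 / k)).
    { rewrite <- atan_0. apply atan_increasing. apply Rdiv_lt_0_compat; lra. }
    lra. }
  destruct (IVT f 0 w0 Cf Hw0 F0 F1) as [w [Hw E]].
  exists w. split.
  - split.
    + destruct (proj1 Hw) as [H|H]; [exact H|]. rewrite <- H in E. lra.
    + destruct (proj2 Hw) as [H|H]; [exact H|]. rewrite H in E. lra.
  - unfold f in E. lra.
Qed.

Lemma strict_subsolution_large_zone :
  a1 ^ 2 < 4 * d1 * r -> Lstar d1 r a1 <= L - x2 ->
  exists psi psix del, strict_subsolution psi psix del.
Proof.
  intros Hdisc HLs.
  pose proof om_max_pos as Hom. pose proof (ee_pos x2) as Hem. fold ee_max in Hem.
  pose (M := m * ee_max * om_max).
  assert (HM : 0 < M) by (unfold M; apply Rmult_lt_0_compat; [nra|exact Hom]).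
  pose (kap := a1 / d1 + M / d1 + 1). pose (al := a1 / (2 * d1)).
  assert (Had : 0 < a1 / d1) by (apply Rdiv_lt_0_compat; lra).
  assert (HMd : 0 < M / d1) by (apply Rdiv_lt_0_compat; lra).
  assert (Hal : 0 < al) by (unfold al; apply Rdiv_lt_0_compat; lra).
  assert (Hal2 : a1 = 2 * d1 * al) by (unfold al; field; lra).
  assert (Hkal : 0 < kap - al).
  { unfold kap. replace (a1 / d1) with (2 * al) by (unfold al; field; lra). lra. }
  assert (Hkap : M + d1 <= d1 * kap ^ 2 - a1 * kap).
  { replace (d1 * kap ^ 2 - a1 * kap) with (kap * (M + d1)) by (unfold kap; field; lra).
    assert (1 <= kap) by (unfold kap; lra). nra. }
  pose (D := 4 * d1 * r - a1 ^ 2). assert (HD : 0 < D) by (unfold D; lra).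
  pose (w0 := sqrt D / (2 * d1)).
  assert (HsD : 0 < sqrt D) by (apply sqrt_lt_R0, HD).
  assert (Hw0 : 0 < w0) by (unfold w0; apply Rdiv_lt_0_compat; lra).
  assert (Hw0sq : d1 * w0 ^ 2 = r - a1 ^ 2 / (4 * d1)).
  { unfold w0. replace (d1 * (sqrt D / (2 * d1)) ^ 2) with (sqrt D * sqrt D / (4 * d1))
      by (field; lra). rewrite sqrt_sqrt by lra. unfold D. field. lra. }
  destruct (frequency_exists (L - x2) (kap - al) w0 Hkal Hw0) as [w [Hw Ew]].
  { replace (w0 / (a1 / (2 * d1))) with (sqrt D / a1) by (unfold w0; field; lra).
    apply Rle_trans with (w0 * Lstar d1 r a1).
    - right. unfold Lstar. fold D. unfold w0. field. lra.
    - apply Rmult_le_compat_l; lra. }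
  fold al in Ew. set (th := atan (w / (kap - al))) in *.
  assert (Hth : 0 < th < PI / 2).
  { unfold th. split; [|apply atan_bound].
    rewrite <- atan_0. apply atan_increasing, Rdiv_lt_0_compat; lra. }
  assert (Hsc : sin th = w / (kap - al) * cos th) by apply sin_atan_cos.
  pose (f := fun x => sin th * exp (kap * (x - x2))).
  pose (fx := fun x => kap * f x).
  pose (g := fun x => exp (al * (x - x2)) * sin (w * (x - x2) + th)).
  pose (gc := fun x => exp (al * (x - x2)) * cos (w * (x - x2) + th)).
  pose (gx := fun x => al * g x + w * gc x).
  assert (Df : forall x, is_derive f x (fx x)).
  { intros x. unfold fx, f. auto_derive; [exact I|unfold Rminus; ring]. }
  assert (Dg : forall x, is_derive g x (gx x)).
  { intros x. unfold gx, g, gc. auto_derive; [exact I|unfold Rminus; ring]. }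
  assert (Dgc : forall x, is_derive gc x (al * gc x - w * g x)).
  { intros x. unfold g, gc. auto_derive; [exact I|unfold Rminus; ring]. }
  assert (Dfx : forall x, is_derive fx x (kap * fx x)).
  { intros x. apply is_derive_scal, Df. }
  assert (Dgx : forall x, is_derive gx x (al * gx x + w * (al * gc x - w * g x))).
  { intros x. apply (is_derive_plus (fun x => al * g x) (fun x => w * gc x)).
    - apply is_derive_scal, Dg.
    - apply is_derive_scal, Dgc. }
  assert (Cfx : forall x, continuous fx x).
  { intros x. apply (ex_derive_continuous fx). eexists. apply Dfx. }
  assert (Cgx : forall x, continuous gx x).
  { intros x. apply (ex_derive_continuous gx). eexists. apply Dgx. }
  assert (Efg : f x2 = g x2).
  { unfold f, g. rewrite Rminus_diag, !Rmult_0_r, exp_0, Rplus_0_l. ring. }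
  assert (Efgx : fx x2 = gx x2).
  { unfold fx, gx, gc. rewrite <- Efg. unfold f.
    rewrite Rminus_diag, !Rmult_0_r, exp_0, Rplus_0_l, Hsc. field. lra. }
  assert (Dglue := glue_derive x2 f fx g gx Df Dg Cfx Cgx Efg Efgx).
  assert (Patan : 0 < atan (w / al) < PI / 2).
  { split; [|apply atan_bound].
    rewrite <- atan_0. apply atan_increasing, Rdiv_lt_0_compat; lra. }
  pose (del := Rmin r (d1 * (w0 ^ 2 - w ^ 2))).
  assert (Hw2 : 0 < d1 * (w0 ^ 2 - w ^ 2)) by (apply Rmult_lt_0_compat; nra).
  assert (Hdel : 0 < del /\ del <= r /\ del <= d1 * (w0 ^ 2 - w ^ 2)).
  { unfold del. split; [apply Rmin_glb_lt; lra|]. split; [apply Rmin_l|apply Rmin_r]. }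
  clearbody del.
  assert (Pf : forall x, 0 < f x).
  { intros x. apply Rmult_lt_0_compat; [apply sin_gt_0; lra|apply exp_pos]. }
  assert (Pg : forall x, x2 <= x <= L -> 0 < g x).
  { intros x Hx. apply Rmult_lt_0_compat; [apply exp_pos|]. apply sin_gt_0.
    - nra.
    - assert (w * (x - x2) <= w * (L - x2)) by (apply Rmult_le_compat_l; lra). lra. }
  exists (glue x2 f g), (glue x2 fx gx), del.
  split; [|split; [|split; [|split; [|split]]]].
  - split; [|split].
    + apply (is_derive_cont_on _ _ _ Dglue).
    + apply continuous_cont_on, glue_continuous; assumption.
    + intros x _. apply Dglue.
  - intros x Hx. destruct (Rle_dec x x2).
    + rewrite glue_left by lra. apply Pf.
    + rewrite glue_right by (exact Efg || lra). apply Pg. lra.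
  - apply Hdel.
  - rewrite !glue_left by lra. unfold fx. apply Rmult_le_compat_r; [left; apply Pf|].
    unfold kap. lra.
  - right. rewrite glue_right by (exact Efgx || lra). unfold gx, g, gc. rewrite Ew.
    rewrite sin_PI_x, Rtrigo_facts.cos_pi_minus, sin_atan_cos. field. lra.
  - intros x Hx Hxc. destruct (Rdichotomy _ _ Hxc) as [Hlt|Hgt].
    + exists (kap * fx x). split; [apply glue_derive_left; [exact Hlt|apply Dfx]|].
      rewrite !glue_left by lra. rewrite chi_lt by exact Hlt.
      pose proof (Pf x) as Pfx. unfold fx.
      assert (Hmo : m * 1 * ee x * Ombar x <= M).
      { unfold M. rewrite Rmult_1_r. pose proof (Ombar_bounds x ltac:(lra)).
        pose proof (ee_le_max x ltac:(lra)). pose proof (ee_pos x).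
        apply Rmult_le_compat; [nra|lra|apply Rmult_le_compat_l; lra|lra]. }
      set (c := m * 1 * ee x * Ombar x) in *.
      replace (d1 * (kap * (kap * f x)) - a1 * (kap * f x) + f x * (r - c))
        with ((d1 * kap ^ 2 - a1 * kap + r - c) * f x) by ring.
      apply Rmult_le_compat_r; lra.
    + exists (al * gx x + w * (al * gc x - w * g x)).
      split; [apply glue_derive_right; [exact Efgx|lra|apply Dgx]|].
      rewrite (glue_right x2 f g) by (exact Efg || lra).
      rewrite (glue_right x2 fx gx) by (exact Efgx || lra).
      rewrite chi_ge by lra. pose proof (Pg x ltac:(lra)) as Pgx.
      apply Rle_trans with (d1 * (w0 ^ 2 - w ^ 2) * g x); [apply Rmult_le_compat_r; lra|].
      right.
      replace (d1 * (w0 ^ 2 - w ^ 2)) with (d1 * w0 ^ 2 - d1 * w ^ 2) by ring.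
      rewrite Hw0sq. unfold gx. rewrite Hal2. field. lra.
Qed.

End Model.

Theorem theorem2p7 (d1 d2 r m p q h L a1 a2 x2 : R)
  (Hd1 : 0 < d1) (Hd2 : 0 < d2) (Hr : 0 < r) (Hm : 0 < m) (Hp : 0 < p)
  (Hq : 0 < q) (Hh : 0 < h) (HL : 0 < L) (Ha1 : 0 < a1) (Ha2 : 0 <= a2)
  (Hx2 : 0 < x2 <= L)
  (wbar : R -> R) (Hwbar : is_wbar d2 q h a2 x2 wbar)
  (Ha1r : a1 < sqrt (4 * d1 * r))
  (HL1 : L > L1star d1 r a1) :
  ((L - x2 >= Lstar d1 r a1 ->
    m <= / p * exp (- Rabs (a1 / d1 - a2 / d2) * x2) ->
    (wbar x2) ^ 2 <= h ->
    unique_GAS_coexistence d1 d2 r m p q h L a1 a2 x2) /\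
   (L - x2 < Lstar d1 r a1 ->
    (exists mbar, 0 < mbar /\
       principal_eigenvalue d1 a1 (fun x => r - mbar * chi x2 x * wbar x) 0 L 0 /\
       m < Rmin mbar (/ p * exp (- Rabs (a1 / d1 - a2 / d2) * x2))) ->
    (wbar x2) ^ 2 <= h ->
    unique_GAS_coexistence d1 d2 r m p q h L a1 a2 x2)).
Proof.
  assert (Hdisc : a1 ^ 2 < 4 * d1 * r).
  { assert (H4 : 0 <= 4 * d1 * r) by nra.
    pose proof (sqrt_sqrt _ H4). nra. }
  assert (Hwh : wbar x2 ^ 2 <= h -> forall x, 0 <= x <= x2 ->
    (ee d2 a2 x * Ombar d2 q h a2 x2 x) ^ 2 <= h).
  { intros Hh2 x Hx. rewrite (wbar_eq d2 q h L a2 x2 Hd2 Hq Hx2 wbar Hwbar x Hx).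
    apply Rle_trans with (2 := Hh2). apply pow_incr. split.
    - left. destruct Hwbar as [Wx [_ [_ [_ [_ [_ PW]]]]]]. apply PW, Hx.
    - apply (wbar_nondecreasing d2 q h L a2 x2); assumption. }
  split.
  - intros Hzone Hmp Hh2.
    destruct (strict_subsolution_large_zone d1 d2 r m q h L a1 a2 x2)
      as [psi [psix [del Hpsi]]]; auto; [lra|].
    apply (coexistence_of_subsolution d1 d2 r m p q h L a1 a2 x2) with psi psix del; auto.
  - intros _ [mbar [Hmbar [Hpe Hlt]]] Hh2.
    pose proof (Rmin_l mbar (/ p * exp (- Rabs (a1 / d1 - a2 / d2) * x2))).
    pose proof (Rmin_r mbar (/ p * exp (- Rabs (a1 / d1 - a2 / d2) * x2))).
    destruct (strict_subsolution_small_zone d1 d2 r m q h L a1 a2 x2) with wbar mbar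
      as [psi [psix [del Hpsi]]]; auto; [lra|].
    apply (coexistence_of_subsolution d1 d2 r m p q h L a1 a2 x2) with psi psix del; auto.
    lra.
Qed.
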